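(* Let the $l$-form $\boldsymbol{\omega}$ be the solution of the Neumann scattering problem $$ \begin{cases} \mathbf{d}(\star_\alpha\mathbf{d}\boldsymbol{\omega})+(-1)^l\star_{k^2}\boldsymbol{\omega}=\mathbf{0} & \text{in }\Omega^e,\\ \mathbf{Tr}^{\mathcal N}(\boldsymbol{\omega})=\star^\Gamma_\alpha\mathbf{i}_{\mathbf n}\mathbf{d}\boldsymbol{\phi} & \text{on }\Gamma,\\ \mathcal F(\boldsymbol{\omega},\star_\alpha\mathbf{d}\boldsymbol{\omega})=\mathbf{0} & \text{on }\Gamma_R. \end{cases} $$ Let $\mathbf{v}_1,\mathbf{v}_2,\dots$ be time-independent velocity fields with $\mathbf{v}_j=v_j\mathbf{n}$ on $\Gamma$, where $v_j$ is a scalar function. For $N=0,1,2,\dots$ let $\delta_{\mathbf{v}_{[N]}}\boldsymbol{\omega}$ be the $N$th order shape derivative of $\boldsymbol{\omega}$ with respect to $\mathbf{v}_{[N]}:=[\mathbf{v}_1,\dots,\mathbf{v}_N]$, with $\delta_{\mathbf{v}_{[0]}}\boldsymbol{\omega}:=\boldsymbol{\omega}$. Let $B_N$ denote the expression giving the Neumann boundary condition for $\delta_{\mathbf{v}_{[N]}}\boldsymbol{\omega}$ on $\Gamma$, i.e. $\mathbf{Tr}^{\mathcal N}(\delta_{\mathbf{v}_{[N]}}\boldsymbol{\omega})=B_N$ on $\Gamma$, with $B_0=\star^\Gamma_\alpha\mathbf{i}_{\mathbf n}\mathbf{d}\boldsymbol{\phi}$. Then the $(N+1)$th order shape derivative $\delta_{\mathbf{v}_{[N+1]}}\boldsymbol{\omega}$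 satisfies the same system, except that the boundary condition on $\Gamma$ is replaced by $$\mathbf{Tr}^{\mathcal N}(\delta_{\mathbf{v}_{[N+1]}}\boldsymbol{\omega})=B_{N+1},$$ $$B_{N+1}=\mathbf{i}_{\mathbf{v}_{N+1}}\mathbf{d}B_N+\delta^{\boldsymbol{\omega}}_{\mathbf{v}_{N+1}}B_N+\delta^{\mathbf n}_{\mathbf{v}_{N+1}}B_N-\mathbf{i}_{\mathbf{v}_{N+1}}\mathbf{d}\star^\Gamma_\alpha\mathbf{i}_{\mathbf n}\mathbf{d}\delta_{\mathbf{v}_{[N]}}\boldsymbol{\omega}-\star^\Gamma_\alpha\mathbf{i}_{\delta_{\mathbf{v}_{N+1}}\mathbf n}\mathbf{d}\delta_{\mathbf{v}_{[N]}}\boldsymbol{\omega}.$$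
   Context: Geometry and operators. $d\ge 1$, $0\le l\le d$ are integers; $\Omega\subset\mathbb{R}^d$ is a bounded domain with smooth boundary $\Gamma=\partial\Omega$; $B_R$ is a ball containing $\bar\Omega$ with boundary sphere $\Gamma_R$, and $\Omega^e:=B_R\setminus\bar\Omega$. $\land^l$ is the set of differential $l$-forms, $\mathbf{d}$ the exterior derivative, $\mathbf{i}_{\mathbf v}:\land^l\to\land^{l-1}$ contraction with a vector field $\mathbf v$. $\star$ is the Hodge star of the standard metric; $\star_\alpha,\star_{k^2}$ are Hodge stars for Riemannian metrics encoding the medium parameter $\alpha$ and the wavenumber $k$; $\star^\Gamma$ and $\star^\Gamma_\alpha$ are Hodge stars on $\Gamma$, for the standard metric and the metric $\alpha$. $\mathbf n$ is the unit normal of $\Gamma$, smoothly extended to a neighbourhood of $\Gamma$ and regarded as depending on $\Gamma$ (the extension is such that $\delta_{\mathbf v}\mathbf n=0$ if $\mathbf v=c\,\mathbf n$ with $c$ constant). Boundary expressions such as $\star^\Gamma_\alpha\mathbf i_{\mathbf n}\mathbf d\boldsymbol\eta$ are regarded as extended off $\Gamma$ by this extension of $\mathbf n$ when $\mathbf{d}$ is applied. $\mathbf{Tr}^{\mathcal N}:=\star^\Gamma_\alpha\mathbf i_{\mathbf n}\mathbf d$ is the Neumann trace. The decomposition $\star_\alpha\mathbf d\boldsymbol\eta|_\Gamma=\star\mathbf i_{\mathbf n}\star\mathbf i_{\mathbf n}\star_\alpha\mathbf d\boldsymbol\eta+\mathbf{Tr}^{\mathcal N}(\boldsymbol\eta)$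 holds on $\Gamma$; in vector proxies, $\mathbf{Tr}^{\mathcal N}$ is $\mathbf n(\mathbf n\cdot\alpha\nabla u)$ for $l=0$, $d=2,3$, and $-\mathbf n\times\mathbf n\times\alpha\nabla\times\mathbf u$ for $l=1$, $d=3$. $\boldsymbol\phi$ is the given incident field, independent of $\Gamma$. $\mathcal F(\boldsymbol\omega,\star_\alpha\mathbf d\boldsymbol\omega)=\mathbf 0$ is the transparent (radiation) boundary condition for the scattered field on the fixed sphere $\Gamma_R$, a linear homogeneous condition unaffected by perturbations of $\Gamma$. Velocity fields and shape derivatives. Velocity fields $\mathbf v$ are smooth, time-independent, and compactly supported in a strip-like neighbourhood of $\Gamma$. $T^{\mathbf v}_t$ is the flow: $T^{\mathbf v}_t(\mathbf X)=\mathbf x(t)$ with $\dot{\mathbf x}=\mathbf v(\mathbf x)$, $\mathbf x(0)=\mathbf X$. For an object $\boldsymbol\omega=\boldsymbol\omega(D)$ depending on a domain $D$ (here $D=\Omega^e$), $\delta_{\mathbf v}\boldsymbol\omega=\lim_{t\to0}\frac{\boldsymbol\omega(T^{\mathbf v}_t(D))-\boldsymbol\omega(D)}{t}$; the same formula defines $\delta_{\mathbf w}\mathbf v$ and $\delta_{\mathbf w}\mathbf n$ for vector fields depending on the domain. The higher order shape derivatives $\delta_{[\mathbf v_1,\dots,\mathbf v_N]}\boldsymbol\omega$ are the coefficients in the shape Taylor expansion $$\boldsymbol\omega\big(T^{\mathbf v_m}_{t_m}\circ\dots\circ T^{\mathbf v_1}_{t_1}(D)\big)=\boldsymbol\omega+\sum_j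 t_j\delta_{\mathbf v_j}\boldsymbol\omega+\dots+\frac1{N!}\sum_{j_1,\dots,j_N=1}^m\Big(\prod_{k=1}^N t_{j_k}\Big)\delta_{[\mathbf v_{j_1},\dots,\mathbf v_{j_N}]}\boldsymbol\omega+\text{higher order},$$ i.e. $\delta_{[\mathbf v_1,\dots,\mathbf v_N]}\boldsymbol\omega=\partial_{t_1}\cdots\partial_{t_N}\boldsymbol\omega\big(T^{\mathbf v_N}_{t_N}\circ\dots\circ T^{\mathbf v_1}_{t_1}(D)\big)\big|_{t=0}$; when the velocity fields themselves depend on the domain, the contributions of $\delta_{\mathbf v_{N+1}}\mathbf v_j$ are not included, e.g. $\delta_{\mathbf w}(\delta_{\mathbf v}\boldsymbol\omega)=\delta_{[\mathbf v,\mathbf w]}\boldsymbol\omega+\delta_{\delta_{\mathbf w}\mathbf v}\boldsymbol\omega$. Partial shape derivatives. For an expression $F(\boldsymbol\omega;\mathbf v,\mathbf n)$ linear in the form $\boldsymbol\omega$ and depending on $\mathbf v,\mathbf n$ through contractions $\mathbf i_{\mathbf v},\mathbf i_{\mathbf n}$: $\delta^{\boldsymbol\omega}_{\mathbf w}F:=F(\delta_{\mathbf w}\boldsymbol\omega;\mathbf v,\mathbf n)$ and $\delta^{\mathbf n}_{\mathbf w}F:=F(\boldsymbol\omega;\mathbf v,\delta_{\mathbf w}\mathbf n)$. Thus $\delta^{\boldsymbol\omega}_{\mathbf v_{N+1}}$ differentiates only the field: it sends $\boldsymbol\phi$ to $0$, $\boldsymbol\omega$ to $\delta_{\mathbf v_{N+1}}\boldsymbol\omega$,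 and $\delta_{[\mathbf v_{j_1},\dots,\mathbf v_{j_m}]}\boldsymbol\omega$ to $\delta_{[\mathbf v_{j_1},\dots,\mathbf v_{j_m},\mathbf v_{N+1}]}\boldsymbol\omega$. $\delta^{\mathbf n}_{\mathbf v_{N+1}}$ differentiates only the normal occurring in the contractions $\mathbf i_{\mathbf n}$ (and its shape derivatives, $\delta_{\mathbf v_j}\mathbf n\mapsto\delta_{[\mathbf v_j,\mathbf v_{N+1}]}\mathbf n$); e.g. $\delta^{\mathbf n}_{\mathbf v}(\star^\Gamma_\alpha\mathbf i_{\mathbf n}\mathbf d\boldsymbol\phi)=\star^\Gamma_\alpha\mathbf i_{\delta_{\mathbf v}\mathbf n}\mathbf d\boldsymbol\phi$. Operators $\mathbf i_{\mathbf v_j}$ are not differentiated.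
   Formalization: The velocities are assumed to satisfy v_j = v_j n in a neighbourhood of Γ, not only on Γ (the formula fails at third order otherwise), and the Nth shape derivative is the iterated one, δ_{v_N}(...δ_{v_1}ω), not the one with T^{v_N} as outermost flow, for which the formula fails. *)

(* Defs.v *)
From HB Require Import structures.
From mathcomp Require Import all_boot all_order all_algebra.
From mathcomp Require Import all_classical all_reals all_analysis.
Set Implicit Arguments.
Unset Strict Implicit.
Unset Printing Implicit Defensive.
Import Order.TTheory GRing.Theory Num.Theory.
Import numFieldNormedType.Exports.
Local Open Scope classical_set_scope.
Local Open Scope ring_scope.

(** * Smooth maps *)

Definition iter_deriv (R : realType) (U W : normedModType R) (vs : seq U)
    (f : U -> W) : U -> W :=
  foldr (fun v g => 'D_v g) f vs.

(* C^oo on A; meant for A open *)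
Definition smooth_on (R : realType) (U W : normedModType R) (A : set U)
    (f : U -> W) : Prop :=
  forall vs x, A x -> differentiable (iter_deriv vs f) x.

(** * Euclidean geometry *)

(* The library norm on row vectors is the sup norm; this is the squared
   Euclidean one. *)
Definition enorm2 (R : realType) (d : nat) (x : 'rV[R]_d) : R :=
  \sum_i x 0 i ^+ 2.

Definition eball (R : realType) (d : nat) (c : 'rV[R]_d) (r : R)
  : set 'rV[R]_d := [set x | enorm2 (x - c) < r ^+ 2].

Definition esphere (R : realType) (d : nat) (c : 'rV[R]_d) (r : R)
  : set 'rV[R]_d := [set x | enorm2 (x - c) = r ^+ 2].

Definition partial (R : realType) (W : normedModType R) (d : nat) (i : 'I_d)
  (f : 'rV[R]_d -> W) : 'rV[R]_d -> W := 'D_(delta_mx 0 i) f.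

Definition grad (R : realType) (d : nat) (f : 'rV[R]_d -> R)
  (x : 'rV[R]_d) : 'rV[R]_d := \row_i partial i f x.

(* Near x, psi < 0 is the open set Om and psi = 0 is its boundary G. *)
Definition defining_function (R : realType) (d : nat) (Om G : set 'rV[R]_d)
    (x : 'rV[R]_d) (U : set 'rV[R]_d) (psi : 'rV[R]_d -> R) : Prop :=
  [/\ open U, U x, smooth_on U psi &
      forall y, U y -> [/\ grad psi y != 0, Om y <-> psi y < 0
                         & G y <-> psi y = 0]].

Definition bounded_smooth_domain (R : realType) (d : nat)
    (Om : set 'rV[R]_d) : Prop :=
  [/\ open Om, connected Om, Om !=set0, bounded_set Om &
      forall x, (closure Om `\` Om) x ->
        exists U psi, defining_function Om (closure Om `\` Om) x U psi].

(* On G, the values of n are the unit normals to G pointing out of Om. *)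
Definition outer_unit_normal (R : realType) (d : nat) (Om G : set 'rV[R]_d)
    (n : 'rV[R]_d -> 'rV[R]_d) : Prop :=
  forall x, G x -> exists U psi, defining_function Om G x U psi /\
    n x = (Num.sqrt (enorm2 (grad psi x)))^-1 *: grad psi x.

(** * Differential forms *)

(* A form w on R^d is given by its coefficients: w x S is the coefficient at x
   of dx^s1 /\ ... /\ dx^sk, where s1 < ... < sk are the elements of S.
   Coefficients lie in a real normed space V, in particular V = R, or V = C
   regarded as a real normed space for time-harmonic fields. *)
Definition dform (R : realType) (V : normedModType R) (d : nat) : Type :=
  'rV[R]_d -> {set 'I_d} -> V.

Definition vfield (R : realType) (d : nat) : Type := 'rV[R]_d -> 'rV[R]_d.

(* w is an l-form on A *)
Definition has_degree (R : realType) (V : normedModType R) (d l : nat)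
    (A : set 'rV[R]_d) (w : dform V d) : Prop :=
  forall (x : 'rV[R]_d) (S : {set 'I_d}), A x -> #|S| != l -> w x S = 0.

(* The sign of moving dx^i to its place among the dx^j, j in S *)
Definition insert_sign (R : realType) (d : nat) (i : 'I_d) (S : {set 'I_d})
  : R := (-1) ^+ #|[set j in S | (j < i)%N]|.

Definition ext_deriv (R : realType) (V : normedModType R) (d : nat)
    (w : dform V d) : dform V d :=
  fun x S => \sum_(i in S)
    insert_sign R i S *: partial i (fun y => w y (S :\ i)) x.

Definition interior_prod (R : realType) (V : normedModType R) (d : nat)
    (v : vfield R d) (w : dform V d) : dform V d :=
  fun x S => \sum_(i in ~: S) (insert_sign R i S * v x 0 i) *: w x (i |: S).

(* v^flat /\ w, with v^flat the Euclidean dual of v *)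
Definition wedge_flat (R : realType) (V : normedModType R) (d : nat)
    (v : vfield R d) (w : dform V d) : dform V d :=
  fun x S => \sum_(i in S) (insert_sign R i S * v x 0 i) *: w x (S :\ i).

Definition metric (R : realType) (d : nat) : Type := 'rV[R]_d -> 'M[R]_d.

Definition riemannian (R : realType) (d : nat) (g : metric R d) : Prop :=
  [/\ forall i j, smooth_on setT (fun x => g x i j),
      forall x, (g x)^T = g x &
      forall (x u : 'rV[R]_d), u != 0 -> 0 < (u *m g x *m u^T) 0 0].

(* The minor of h with rows A and columns S, both in increasing order; it is
   used only when #|A| = #|S|, and then the default value of nth is not
   reached. *)
Definition minor (R : realType) (d : nat) (h : 'M[R]_d) (A S : {set 'I_d})
  : R :=
  \det (\matrix_(i < #|A|, j < #|A|)
          h (enum_val i) (nth (enum_val i) (enum S) j)).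

(* The sign of the shuffle (A, ~: A) *)
Definition shuffle_sign (R : realType) (d : nat) (A : {set 'I_d}) : R :=
  (-1) ^+ #|[set p : 'I_d * 'I_d | [&& p.1 \in A, p.2 \notin A & (p.2 < p.1)%N]]|.

(* Hodge star of the metric g for the standard orientation: from
   u /\ star w = <u, w>_g vol_g and <dx^A, dx^S>_g = minor g^-1 A S. *)
Definition hodge (R : realType) (V : normedModType R) (d : nat)
    (g : metric R d) (w : dform V d) : dform V d :=
  fun x T => (shuffle_sign R (~: T) * Num.sqrt (\det (g x))) *:
    \sum_(S : {set 'I_d} | #|S| == #|~: T|)
       minor (invmx (g x)) (~: T) S *: w x S.

(* The part of w tangential to the hyperplanes orthogonal to the unit field n *)
Definition tangential (R : realType) (V : normedModType R) (d : nat)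
  (n : vfield R d) (w : dform V d) : dform V d := interior_prod n (wedge_flat n w).

(* Hodge star on the hypersurfaces orthogonal to n, oriented by i_n vol. Forms
   on a hypersurface are identified with tangential forms along it.
   For the standard metric this is exactly the Hodge star of the hypersurface.
   In general it is the Hodge star of the induced metric times the g-norm of
   the covector n^flat: with this normalization the tangential part of
   star_g (d eta) is hodge_surf g n (i_n d eta) whenever n is g-normal. *)
Definition hodge_surf (R : realType) (V : normedModType R) (d : nat)
    (g : metric R d) (n : vfield R d) (w : dform V d) : dform V d :=
  tangential n (hodge g (wedge_flat n w)).

Definition neumann_trace (R : realType) (V : normedModType R) (d : nat)
    (g : metric R d) (n : vfield R d) (w : dform V d) : dform V d :=
  hodge_surf g n (interior_prod n (ext_deriv w)).

(** * Boundary values and the scattering problem *)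

(* a is the boundary value of w on G, taken from inside D. *)
Definition has_trace (R : realType) (V : normedModType R) (d : nat)
    (D G : set 'rV[R]_d) (w a : dform V d) : Prop :=
  forall x S, G x -> w y S @[y --> within D (nbhs x)] --> a x S.

Definition same_trace (R : realType) (V : normedModType R) (d : nat)
    (D G : set 'rV[R]_d) (w w' : dform V d) : Prop :=
  exists a, has_trace D G w a /\ has_trace D G w' a.

Definition continuous_on (R : realType) (V : normedModType R) (d : nat)
    (G : set 'rV[R]_d) (a : dform V d) : Prop :=
  forall S, {within G, continuous (fun x => a x S)}.

Definition uniform_cvg (R : realType) (V : normedModType R) (d : nat)
    (G : set 'rV[R]_d) (a_ : nat -> dform V d) (a : dform V d) : Prop :=
  forall S, {uniform G, (fun k x => a_ k x S) @ \oo --> (fun x => a x S)}.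

(* A (possibly nonlocal) homogeneous condition Rad a b = 0 on the continuous
   boundary values a, b on the sphere G, with Rad linear and continuous. A
   Dirichlet-to-Neumann condition b - Lambda a = 0 is of this kind for Y a
   Sobolev space of negative order; continuity also makes Rad depend only on
   the values on G. *)
Definition radiation_operator (R : realType) (V Y : normedModType R) (d : nat)
    (G : set 'rV[R]_d) (Rad : dform V d -> dform V d -> Y) : Prop :=
  (forall (c : R) (a a' b b' : dform V d),
      continuous_on G a -> continuous_on G a' ->
      continuous_on G b -> continuous_on G b' ->
      Rad (fun x S => c *: a x S + a' x S) (fun x S => c *: b x S + b' x S)
      = c *: Rad a b + Rad a' b') /\
  (forall (a_ b_ : nat -> dform V d) (a b : dform V d),
      (forall k, continuous_on G (a_ k) /\ continuous_on G (b_ k)) ->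
      uniform_cvg G a_ a -> uniform_cvg G b_ b ->
      Rad (a_ k) (b_ k) @[k --> \oo] --> Rad a b).

(* w solves the Neumann problem in D, with boundary data bc on G and the
   radiation condition on the sphere GR. *)
Definition neumann_system (R : realType) (V Y : normedModType R) (d l : nat)
    (ga gk : metric R d) (GR : set 'rV[R]_d)
    (Rad : dform V d -> dform V d -> Y)
    (D G : set 'rV[R]_d) (n : vfield R d) (bc w : dform V d) : Prop :=
  [/\ has_degree l D w /\ (forall S, smooth_on D (fun x => w x S)),
      forall x S, D x ->
        ext_deriv (hodge ga (ext_deriv w)) x S + (-1) ^+ l *: hodge gk w x S = 0,
      same_trace D G (neumann_trace ga n w) bc &
      exists a b, [/\ continuous_on GR a, continuous_on GR b,
        has_trace D GR w a, has_trace D GR (hodge ga (ext_deriv w)) b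
        & Rad a b = 0]].

(** * Flows and shape derivatives *)

(* smooth and compactly supported in the open set B *)
Definition velocity_field (R : realType) (d : nat) (B : set 'rV[R]_d)
    (v : vfield R d) : Prop :=
  smooth_on setT v /\
  exists K : set 'rV[R]_d, [/\ compact K, K `<=` B & forall x, ~ K x -> v x = 0].

Definition is_flow (R : realType) (d : nat) (v : vfield R d)
    (T : R -> 'rV[R]_d -> 'rV[R]_d) : Prop :=
  [/\ forall x, T 0 x = x,
      forall s t x, T (s + t) x = T s (T t x) &
      forall t x, is_derive t (1 : R) (fun s => T s x) (v (T t x))].

(* T_0(t_0) o T_1(t_1) o ... o T_(N-1)(t_(N-1)) *)
Definition comp_flows (R : realType) (d : nat)
    (T : nat -> R -> 'rV[R]_d -> 'rV[R]_d) (N : nat) (t : 'rV[R]_N)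
    (x : 'rV[R]_d) : 'rV[R]_d :=
  foldr (fun (i : 'I_N) y => T i (t 0 i) y) x (enum 'I_N).

(* For q depending on a domain D, the derivative at t = 0 of q (T_t D) *)
Definition shape_deriv (R : realType) (W : normedModType R) (d : nat)
    (T : R -> 'rV[R]_d -> 'rV[R]_d) (q : set 'rV[R]_d -> W)
    (D : set 'rV[R]_d) : W :=
  derive1 (fun t : R => q (T t @` D)) 0.

(* delta_[v_j1, ..., v_jm] w, obtained by applying first delta_(v_j1) and last
   delta_(v_jm); J = [:: j1; ...; jm]. The velocity fields do not depend on the
   domain. It equals the derivative at t = 0 of
   w (T^{v_j1}_{t1} o ... o T^{v_jm}_{tm} (D)) with respect to t1, ..., tm. *)
Definition shape_derivs_form (R : realType) (V : normedModType R) (d : nat)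
    (T : nat -> R -> 'rV[R]_d -> 'rV[R]_d) (J : seq nat)
    (w : set 'rV[R]_d -> dform V d) : set 'rV[R]_d -> dform V d :=
  foldl (fun u j => fun D x S => shape_deriv (T j) (fun D' => u D' x S) D) w J.

Definition shape_derivs_vec (R : realType) (d : nat)
    (T : nat -> R -> 'rV[R]_d -> 'rV[R]_d) (J : seq nat)
    (n : set 'rV[R]_d -> vfield R d) : set 'rV[R]_d -> vfield R d :=
  foldl (fun m j => fun D x => shape_deriv (T j) (fun D' => m D' x) D) n J.

(* The fields w (D_t), over the perturbations D_t of D by the first N flows,
   depend smoothly on t and x, up to the boundary of D_t. Only the values of
   w (D_t) in D_t matter. *)
Definition smooth_form_dependence (R : realType) (V : normedModType R)
    (d : nat) (T : nat -> R -> 'rV[R]_d -> 'rV[R]_d) (D : set 'rV[R]_d)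
    (w : set 'rV[R]_d -> dform V d) : Prop :=
  forall N, exists (O : set ('rV[R]_N * 'rV[R]_d)%type)
                   (W : 'rV[R]_N * 'rV[R]_d -> {set 'I_d} -> V),
  [/\ open O, forall x, closure D x -> O (0, x),
      forall S, smooth_on O (fun p => W p S) &
      forall t x, O (t, x) -> (comp_flows T t @` D) x ->
        w (comp_flows T t @` D) x = W (t, x)].

(* n assigns to a domain, the exterior in the ball of the obstacle Om, the unit
   normal of its inner boundary G, extended to a unit field near G. *)
Definition normal_extension (R : realType) (d : nat)
    (T : nat -> R -> 'rV[R]_d -> 'rV[R]_d) (Om G D : set 'rV[R]_d)
    (n : set 'rV[R]_d -> vfield R d) : Prop :=
  forall N,
  (\forall t \near (0 : 'rV[R]_N),
     outer_unit_normal (comp_flows T t @` Om) (comp_flows T t @` G)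
       (n (comp_flows T t @` D))) /\
  exists O : set ('rV[R]_N * 'rV[R]_d)%type,
  [/\ open O, forall x, G x -> O (0, x),
      smooth_on O (fun p => n (comp_flows T p.1 @` D) p.2) &
      forall t x, O (t, x) -> enorm2 (n (comp_flows T t @` D) x) = 1].

Definition near_set (R : realType) (d : nat) (G : set 'rV[R]_d)
    (P : 'rV[R]_d -> Prop) : Prop :=
  exists U : set 'rV[R]_d, [/\ open U, G `<=` U & forall x, U x -> P x].

(** * Boundary expressions *)

(* BField J stands for delta_[v_J] w, BContrN J for the contraction with
   delta_[v_J] n, and BContrV j for the contraction with v_j. *)
Inductive bexpr : Type :=
| BZero
| BIncident
| BField of seq nat
| BExt of bexpr
| BStar of bexpr
| BContrN of seq nat & bexpr
| BContrV of nat & bexpr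
| BAdd of bexpr & bexpr
| BOpp of bexpr.

Definition BSub (e f : bexpr) : bexpr := BAdd e (BOpp f).

(* The partial derivative with respect to the field, along v_j *)
Fixpoint delta_field (j : nat) (e : bexpr) : bexpr :=
  match e with
  | BZero | BIncident => BZero
  | BField J => BField (rcons J j)
  | BExt f => BExt (delta_field j f)
  | BStar f => BStar (delta_field j f)
  | BContrN J f => BContrN J (delta_field j f)
  | BContrV i f => BContrV i (delta_field j f)
  | BAdd f g => BAdd (delta_field j f) (delta_field j g)
  | BOpp f => BOpp (delta_field j f)
  end.

(* The partial derivative with respect to the normals in contractions *)
Fixpoint delta_normal (j : nat) (e : bexpr) : bexpr :=
  match e with
  | BZero | BIncident | BField _ => BZero
  | BExt f => BExt (delta_normal j f)
  | BStar f => BStar (delta_normal j f)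
  | BContrN J f => BAdd (BContrN (rcons J j) f) (BContrN J (delta_normal j f))
  | BContrV i f => BContrV i (delta_normal j f)
  | BAdd f g => BAdd (delta_normal j f) (delta_normal j g)
  | BOpp f => BOpp (delta_normal j f)
  end.

(* The velocity fields v_1, v_2, ... are numbered from 0, so that v_(N+1) is
   number N and v_[N] is iota 0 N. *)
Fixpoint neumann_data (N : nat) : bexpr :=
  match N with
  | 0%N => BStar (BContrN [::] (BExt BIncident))
  | M.+1 =>
      let b := neumann_data M in
      let w := BField (iota 0 M) in
      BSub (BSub (BAdd (BAdd (BContrV M (BExt b)) (delta_field M b))
                    (delta_normal M b))
               (BContrV M (BExt (BStar (BContrN [::] (BExt w))))))
          (BStar (BContrN [:: M] (BExt w)))
  end.

Fixpoint beval (R : realType) (V : normedModType R) (d : nat)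
    (g : metric R d) (v : nat -> vfield R d)
    (T : nat -> R -> 'rV[R]_d -> 'rV[R]_d) (n : set 'rV[R]_d -> vfield R d)
    (phi : dform V d) (w : set 'rV[R]_d -> dform V d) (D : set 'rV[R]_d)
    (e : bexpr) : dform V d :=
  match e with
  | BZero => fun _ _ => 0
  | BIncident => phi
  | BField J => shape_derivs_form T J w D
  | BExt f => ext_deriv (beval g v T n phi w D f)
  | BStar f => hodge_surf g (n D) (beval g v T n phi w D f)
  | BContrN J f => interior_prod (shape_derivs_vec T J n D) (beval g v T n phi w D f)
  | BContrV j f => interior_prod (v j) (beval g v T n phi w D f)
  | BAdd f h => fun x S => beval g v T n phi w D f x S + beval g v T n phi w D h x S
  | BOpp f => fun x S => - beval g v T n phi w D f x S
  end.

(* Main.v *)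
From HB Require Import structures.
Require Import Defs.
From mathcomp Require Import all_boot all_order all_algebra.
From mathcomp Require Import all_classical all_reals all_analysis.
From mathcomp Require Import ring lra zify.
Set Implicit Arguments.
Unset Strict Implicit.
Unset Printing Implicit Defensive.
Import Order.TTheory GRing.Theory Num.Theory.
Import numFieldNormedType.Exports.
Local Open Scope classical_set_scope.
Local Open Scope ring_scope.

(** Let [D_t] be the domain moved by the first [N + 1] flows for times [t], let
    [n_t] be its normal field, and let [W t] be the solution on [D_t], extended
    smoothly across the boundary. Shape derivatives are derivatives in [t] at
    [t = 0] (for increasing indices; see [comp_flows_shift]).

    Away from the inner boundary everything is differentiation of an identity
    in [t]: the equation holds at each interior point of [D_t] and its operators
    have coefficients independent of [t], so it passes to the derivatives
    because mixed derivatives commute ([derive_comm], [dts_vanish]). The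
    radiation condition passes to difference quotients, which converge uniformly
    on the fixed sphere, by linearity and continuity ([Rad_dts]).

    For the Neumann condition, put [X t = i_(n_t) d (W t - phi)]. The star of
    the hypersurface is injective on forms free of the unit normal
    ([hodge_surf_inj]), so the boundary condition on [D_t] says that [X t]
    vanishes on the moved boundary [G_t]. Hence so does [P_0 t = star X t],
    where the star keeps the normal [n_0] of the unperturbed domain. Define
    [P_(M+1) = i_(v_M) d P_M + dP_M/dt_M]. Neither the star nor the contractions
    with the velocities depend on [t], so [d/dt_M] acts on [P_M] as the sum of
    the two partial derivatives of boundary expressions ([dt_peval]), and the
    recursion for the boundary data is that [P_M] at [t = 0] is the Neumann
    trace of the [M]-th shape derivative minus its claimed value ([residualS]).

    It remains to see that [P_M] vanishes on [G_t] whenever the first [M] times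
    are 0. Following a boundary point under the flow of [v_M] gives
    [dP_M/dt_M + v_M . grad P_M = 0]. Now [P_M] is a form free of [n_0]
    ([residual_tangential]), hence of [v_M], and it vanishes at the point, so
    [v_M . grad P_M = i_(v_M) d P_M] there ([contract_ext_deriv]), and
    [P_(M+1) = 0] ([residual_vanish]). *)

(** * Directional derivatives *)

Section DirectionalDerivatives.
Context {R : realType}.

Lemma derive_line_ext (U W : normedModType R) (f g : U -> W) (v a : U) :
  (\forall h \near (0 : R), f (h *: v + a) = g (h *: v + a)) ->
  'D_v f a = 'D_v g a.
Proof.
move=> fg; rewrite /derive; congr (lim _).
have e0 : f a = g a by have := nbhs_singleton fg; rewrite scale0r add0r.
rewrite eqEsubset; split; apply: near_eq_cvg; apply: cvg_within;
  by near do rewrite /= e0 (near fg _) //.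
Unshelve. all: by end_near. Qed.

(** Along a line that [A] maps to a line, the two difference quotients are the
    same. *)
Lemma derive_affine (U U' W : normedModType R) (f : U' -> W) (A : U -> U')
    (v a : U) (v' : U') :
  (forall h, A (h *: v + a) = h *: v' + A a) ->
  'D_v (fun x => f (A x)) a = 'D_v' f (A a).
Proof. by move=> Av; rewrite /derive /= ; under eq_fun do rewrite Av. Qed.

Lemma derive_near_cst (U W : normedModType R) (f : U -> W) (v a : U) (c : W) :
  (\forall h \near (0 : R), f (h *: v + a) = c) -> 'D_v f a = 0.
Proof.
move=> fc; rewrite -(derive_cst c a v); apply: derive_line_ext.
by apply: filterS fc.
Unshelve. all: by end_near. Qed.

Lemma near_eq_differentiable (U W : normedModType R) (f g : U -> W) (a : U) :
  (\forall x \near a, f x = g x) -> differentiable f a -> differentiable g a.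
Proof.
move=> fg df.
have -> : g = f + (g - f) by apply/funext => x; rewrite /= !fctE addrC subrK.
apply: differentiableD => //.
set h := g - f.
have h0 : \forall x \near a, h x = 0.
  by near=> x; rewrite /h !fctE (near fg x) ?subrr.
apply/diff_locallyP.
have oh : h \o shift a = cst (h a) + cst 0 +o_ 0 id.
  apply/eqaddoP => _ /posnumP[e].
  have ha : \forall x \near (0 : U), h (x + a) = 0.
    have c0 : (x + a) @[x --> (0 : U)] --> a.
      by rewrite -[X in _ --> X]add0r; apply: cvgD; [exact: cvg_id|exact: cvg_cst].
    exact: (c0 _ h0).
  near=> x; rewrite !fctE /= (near ha x) // (nbhs_singleton h0) addr0 subr0 normr0.
  by rewrite mulr_ge0.
have cu : continuous (\0 : {linear U -> W}) by move=> ?; exact: cst_continuous.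
have := @diff_unique _ U W h (\0) a cu; rewrite /=.
move=> /(_ oh) ->; split => //.
Unshelve. all: by end_near. Qed.

Lemma scale_bilinear (W : normedModType R) :
  bilinear_for (GRing.Scale.Law.clone _ _ *:%R _) (GRing.Scale.Law.clone _ _ *:%R _)
    (fun (k : R) (w : W) => k *: w).
Proof.
split=> [w|k] a x y /=.
- by rewrite scalerDl scalerA.
- by rewrite scalerDr !scalerA mulrC.
Qed.

Lemma diff_scalef (U W : normedModType R) (f : U -> R) (g : U -> W) (a : U) :
  differentiable f a -> differentiable g a ->
  differentiable (fun x => f x *: g x) a /\
  forall v, 'D_v (fun x => f x *: g x) a = 'D_v f a *: g a + f a *: 'D_v g a.
Proof.
move=> df dg.
pose sM := bilinear_isBilinear.Build R R W W _ _ _ (scale_bilinear W).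
pose s : {bilinear R -> W -> W} := HB.pack (fun (k : R) (w : W) => k *: w) sM.
have sc : continuous (fun p : R * W => s p.1 p.2) by move=> p; exact: scale_continuous.
have dp := differentiable_pair df dg.
have ds := differentiable_bilin (f a, g a) sc.
have dd : differentiable (fun x => f x *: g x) a.
  exact: (@differentiable_comp _ _ _ _ (fun x => (f x, g x)) (fun p => s p.1 p.2)).
split => // v; rewrite !deriveE //.
rewrite -[LHS]/('d ((fun p => s p.1 p.2) \o (fun x => (f x, g x))) a v).
by rewrite diff_comp // diff_bilin //= diff_pair //= addrC.
Qed.

End DirectionalDerivatives.

(** * Smooth functions on open sets *)

Section SmoothFunctions.
Context {R : realType}.
Implicit Types U V W : normedModType R.

(** Smoothness cut off at order [k], on which the closure properties are proved
    by induction. *)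
Definition Ck U W (k : nat) (A : set U) (f : U -> W) : Prop :=
  forall vs x, (size vs <= k)%N -> A x -> differentiable (iter_deriv vs f) x.

Lemma smooth_onP U W (A : set U) (f : U -> W) :
  smooth_on A f <-> forall k, Ck k A f.
Proof.
split=> [sf k vs x _ Ax|cf vs x Ax]; first exact: sf.
exact: (cf (size vs)).
Qed.

Lemma iter_deriv_rcons U W (vs : seq U) v (f : U -> W) :
  iter_deriv (rcons vs v) f = iter_deriv vs ('D_v f).
Proof. by rewrite /iter_deriv foldr_rcons. Qed.

(** Peeling off the derivative next to [f] rather than the outermost one lets
    the product and chain rules apply in the induction step. *)
Lemma CkS U W k (A : set U) (f : U -> W) :
  Ck k.+1 A f <->
  (forall x, A x -> differentiable f x) /\ forall v, Ck k A ('D_v f).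
Proof.
split=> [cf|[df cf] vs x].
  split=> [x Ax|v vs x sz Ax]; first exact: (cf [::]).
  by rewrite -iter_deriv_rcons; apply: cf => //; rewrite size_rcons.
case: (lastP vs) => [_ Ax|{}vs v]; first exact: df.
by rewrite size_rcons iter_deriv_rcons => sz Ax; exact: cf.
Qed.

Lemma CkW U W k (A : set U) (f : U -> W) : Ck k.+1 A f -> Ck k A f.
Proof. by move=> cf vs x sz Ax; apply: cf => //; exact: leqW. Qed.

Lemma Ck_diff U W k (A : set U) (f : U -> W) x :
  Ck k A f -> A x -> differentiable f x.
Proof. by move=> cf; exact: (cf [::]). Qed.

Lemma smooth_diff U W (A : set U) (f : U -> W) x :
  smooth_on A f -> A x -> differentiable f x.
Proof. by move=> sf; exact: (sf [::]). Qed.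

Lemma smooth_derive U W (A : set U) (f : U -> W) v :
  smooth_on A f -> smooth_on A ('D_v f).
Proof. by move=> sf vs x Ax; rewrite -iter_deriv_rcons; exact: sf. Qed.

Lemma smooth_sub U W (A B : set U) (f : U -> W) :
  B `<=` A -> smooth_on A f -> smooth_on B f.
Proof. by move=> BA sf vs x /BA; exact: sf. Qed.

Lemma iter_deriv_eq U W (A : set U) (f g : U -> W) :
  open A -> (forall x, A x -> f x = g x) ->
  forall vs x, A x -> iter_deriv vs f x = iter_deriv vs g x.
Proof.
move=> oA fg; elim=> [|v vs IH] x Ax; first exact: fg.
apply: near_eq_derive; near=> y; apply: IH; near: y; exact: open_nbhs_nbhs.
Unshelve. all: by end_near. Qed.

Lemma Ck_eq U W k (A : set U) (f g : U -> W) :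
  open A -> (forall x, A x -> f x = g x) -> Ck k A f -> Ck k A g.
Proof.
move=> oA fg cf vs x sz Ax; apply: near_eq_differentiable (cf vs x sz Ax).
near=> y; apply: (iter_deriv_eq oA) => //; near: y; exact: open_nbhs_nbhs.
Unshelve. all: by end_near. Qed.

Lemma smooth_eq U W (A : set U) (f g : U -> W) :
  open A -> (forall x, A x -> f x = g x) -> smooth_on A f -> smooth_on A g.
Proof.
move=> oA fg /smooth_onP sf; apply/smooth_onP => k; exact: (Ck_eq oA fg).
Qed.

Lemma Ck_cst U W k (A : set U) (c : W) : Ck k A (fun=> c).
Proof.
elim: k c => [|k IH] c; first by case=> // x _ _; exact: differentiable_cst.
apply/CkS; split=> [x _|v]; first exact: differentiable_cst.
by have -> : 'D_v (fun=> c) = (fun=> 0) :> (U -> W); [apply/funext => x; exact: derive_cst|].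
Qed.

Lemma CkD U W k (A : set U) (f g : U -> W) : open A ->
  Ck k A f -> Ck k A g -> Ck k A (fun x => f x + g x).
Proof.
move=> oA; elim: k f g => [|k IH] f g cf cg.
  case=> // x _ Ax; apply: (@differentiableD _ _ _ f g); [exact: Ck_diff cf Ax|exact: Ck_diff cg Ax].
have df x : A x -> differentiable f x by exact: Ck_diff cf.
have dg x : A x -> differentiable g x by exact: Ck_diff cg.
apply/CkS; split=> [x Ax|v].
  apply: (@differentiableD _ _ _ f g); [exact: df|exact: dg].
move/CkS : cf => [_ /(_ v) cf]; move/CkS : cg => [_ /(_ v) cg].
apply: (Ck_eq oA _ (IH _ _ cf cg)) => x Ax.
by rewrite -[in RHS]/(f + g) deriveD //; apply: diff_derivable; first [exact: df|exact: dg].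
Qed.

Lemma Ck_scale U W k (A : set U) (f : U -> R) (g : U -> W) : open A ->
  Ck k A f -> Ck k A g -> Ck k A (fun x => f x *: g x).
Proof.
move=> oA; elim: k f g => [|k IH] f g cf cg.
  by case=> // x _ Ax; apply: (diff_scalef (Ck_diff cf Ax) (Ck_diff cg Ax)).1.
apply/CkS; split=> [x Ax|v].
  exact: (diff_scalef (Ck_diff cf Ax) (Ck_diff cg Ax)).1.
have cf' := (CkS _ _ _).1 cf; have cg' := (CkS _ _ _).1 cg.
have h : Ck k A (fun x => 'D_v f x *: g x + f x *: 'D_v g x).
  by apply: CkD => //; apply: IH; [apply: cf'.2|exact: CkW|exact: CkW|apply: cg'.2].
apply: (Ck_eq oA _ h) => x Ax.
by rewrite (diff_scalef (Ck_diff cf Ax) (Ck_diff cg Ax)).2.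
Qed.

Arguments Ck_cst {U W} k A c.

Lemma smooth_cst U W (A : set U) (c : W) : smooth_on A (fun=> c).
Proof. by apply/smooth_onP => k; exact: Ck_cst. Qed.
Arguments smooth_cst {U W} A c.

Lemma smoothD U W (A : set U) (f g : U -> W) : open A ->
  smooth_on A f -> smooth_on A g -> smooth_on A (fun x => f x + g x).
Proof.
by move=> oA /smooth_onP cf /smooth_onP cg; apply/smooth_onP => k; exact: CkD.
Qed.

Lemma smooth_scale U W (A : set U) (f : U -> R) (g : U -> W) : open A ->
  smooth_on A f -> smooth_on A g -> smooth_on A (fun x => f x *: g x).
Proof.
by move=> oA /smooth_onP cf /smooth_onP cg; apply/smooth_onP => k; exact: Ck_scale.
Qed.

Lemma smoothM U (A : set U) (f g : U -> R) : open A ->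
  smooth_on A f -> smooth_on A g -> smooth_on A (fun x => f x * g x).
Proof. by move=> oA sf sg; exact: (smooth_scale oA sf sg). Qed.

Lemma smoothN U W (A : set U) (f : U -> W) : open A ->
  smooth_on A f -> smooth_on A (fun x => - f x).
Proof.
move=> oA sf; apply: (smooth_eq oA _ (smooth_scale oA (smooth_cst A (-1 : R)) sf)) => x _.
by rewrite scaleN1r.
Qed.

Lemma smooth_sum U W (A : set U) (I : Type) (r : seq I) (P : pred I)
    (F : I -> U -> W) : open A ->
  (forall i, P i -> smooth_on A (F i)) ->
  smooth_on A (fun x => \sum_(i <- r | P i) F i x).
Proof.
move=> oA sF; elim: r => [|i r IH].
  by apply: (smooth_eq oA _ (smooth_cst A 0)) => x _; rewrite big_nil.
case Pi : (P i); last first.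
  by apply: (smooth_eq oA _ IH) => x _; rewrite big_cons Pi.
by apply: (smooth_eq oA _ (smoothD oA (sF _ Pi) IH)) => x _; rewrite big_cons Pi.
Qed.

Lemma smooth_prod U (A : set U) (I : Type) (r : seq I) (F : I -> U -> R) :
  open A -> (forall i, smooth_on A (F i)) ->
  smooth_on A (fun x => \prod_(i <- r) F i x).
Proof.
move=> oA sF; elim: r => [|i r IH].
  by apply: (smooth_eq oA _ (smooth_cst A (1 : R))) => x _; rewrite big_nil.
by apply: (smooth_eq oA _ (smoothM oA (sF i) IH)) => x _; rewrite big_cons.
Qed.

(** The derivative of [1/f] is a product of [f'] and two copies of [1/f], hence
    order [k] for [1/f] yields order [k.+1]. *)
Lemma smooth_inv U (A : set U) (f : U -> R) : open A ->
  (forall x, A x -> f x != 0) -> smooth_on A f -> smooth_on A (fun x => (f x)^-1).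
Proof.
move=> oA f0 /smooth_onP sf; apply/smooth_onP => k; have df x : A x -> differentiable f x.
  exact: (Ck_diff (sf 0%N)).
have dV x : A x -> differentiable (fun x => (f x)^-1) x.
  by move=> Ax; apply: (@differentiableV _ _ f); [exact: df|exact: f0].
elim: k => [|k IH]; first by case=> // x _; exact: dV.
apply/CkS; split=> // v.
have cf := ((CkS _ _ _).1 (sf k.+1)).2 v.
have h := Ck_scale oA (Ck_cst k A (-1 : R)) (Ck_scale oA cf (Ck_scale oA IH IH)).
apply: (Ck_eq oA _ h) => x Ax.
rewrite deriveV ?f0 //; last exact/diff_derivable/df.
by rewrite /GRing.scale /=; field; rewrite ?f0.
Qed.

Lemma smooth_affine U U' W (A : set U) (B : set U') (L : U -> U') (L0 : U -> U')
    (f : U' -> W) : open A ->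
  (forall x, A x -> B (L x)) -> (forall x, differentiable L x) ->
  (forall h v a, L (h *: v + a) = h *: L0 v + L a) ->
  smooth_on B f -> smooth_on A (fun x => f (L x)).
Proof.
move=> oA AB dL Ll sf vs x Ax.
have -> : iter_deriv vs (fun x => f (L x)) = fun x => iter_deriv (map L0 vs) f (L x).
  elim: vs {x Ax} => //= v vs ->; apply/funext => x.
  by apply: derive_affine => h; exact: Ll.
by apply: differentiable_comp => //; apply: sf; exact: AB.
Qed.

Lemma coord_derive n U (f : U -> 'rV[R]_n) v a i : differentiable f a ->
  'D_v (fun x => f x 0 i) a = 'D_v f a 0 i.
Proof.
move=> df; have h : derivable f a v by exact: diff_derivable.
by rewrite (derive_mx h) mxE.
Qed.

Lemma differentiable_coordf n U (f : U -> 'rV[R]_n) a i :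
  differentiable f a -> differentiable (fun x => f x 0 i) a.
Proof.
move=> df; apply: (@differentiable_comp _ _ _ _ f (fun u : 'rV[R]_n => u 0 i : R)) => //.
exact: differentiable_coord.
Qed.

Lemma smooth_coord n U (A : set U) (f : U -> 'rV[R]_n) i : open A ->
  smooth_on A f -> smooth_on A (fun x => f x 0 i).
Proof.
move=> oA /smooth_onP sf; apply/smooth_onP => k; move/(_ k): sf.
elim: k f => [|k IH] f cf.
  by case=> // x _ Ax; apply: differentiable_coordf; exact: Ck_diff cf Ax.
apply/CkS; split=> [x Ax|v]; first by apply: differentiable_coordf; exact: Ck_diff cf Ax.
apply: (Ck_eq oA _ (IH _ (((CkS _ _ _).1 cf).2 v))) => x Ax.
by rewrite coord_derive //; exact: Ck_diff cf Ax.
Qed.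

Lemma smooth_det n U (A : set U) (M : U -> 'M[R]_n) : open A ->
  (forall i j, smooth_on A (fun x => M x i j)) -> smooth_on A (fun x => \det (M x)).
Proof.
move=> oA sM; apply: smooth_sum => // s _; apply: smoothM => //.
  exact: smooth_cst.
exact: smooth_prod.
Qed.

End SmoothFunctions.
Arguments Ck_cst {R U W} k A c.
Arguments smooth_cst {R U W} A c.

(** * The mean value inequality *)

Section MeanValue.
Context {R : realType}.

(** As for the inverse: the derivative of [sqrt f] is [f'] times half the
    inverse of [sqrt f], and that inverse is [sqrt f] times [1/f]. *)
Lemma smooth_sqrt (U : normedModType R) (A : set U) (f : U -> R) : open A ->
  (forall x, A x -> 0 < f x) -> smooth_on A f ->
  smooth_on A (fun x => Num.sqrt (f x)).
Proof.
move=> oA f0 sf.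
have df x : A x -> differentiable f x by exact: smooth_diff.
have dsq x : A x -> differentiable (@Num.sqrt R) (f x).
  by move=> Ax; apply/derivable1_diffP; apply: (@ex_derive _ _ _ _ _ _ _ (is_derive1_sqrt (f0 _ Ax))).
have ds x : A x -> differentiable (fun x => Num.sqrt (f x)) x.
  by move=> Ax; apply: (@differentiable_comp _ _ _ _ f (@Num.sqrt R)); [exact: df|exact: dsq].
apply/smooth_onP => k; elim: k => [|k IH]; first by case=> // x _; exact: ds.
apply/CkS; split=> // v.
have IHV : Ck k A (fun x => (Num.sqrt (f x))^-1).
  have : smooth_on A (fun x => (f x)^-1).
    by apply: smooth_inv => // x Ax; rewrite gt_eqF // f0.
  move=> /smooth_onP /(_ k) sV.
  apply: (Ck_eq oA _ (Ck_scale oA IH sV)) => x Ax.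
  rewrite /GRing.scale /= -{2}(sqr_sqrtr (ltW (f0 _ Ax))); field.
  by rewrite gt_eqF // sqrtr_gt0 f0.
have cf : Ck k A ('D_v f) by apply: ((smooth_onP _ _).1 (smooth_derive v sf)).
apply: (Ck_eq oA _ (Ck_scale oA (Ck_cst k A (2^-1 : R)) (Ck_scale oA cf IHV))) => x Ax.
rewrite [RHS]deriveE; last exact: ds.
rewrite -[X in 'd X x v]/(@Num.sqrt R \o f) (diff_comp (df x Ax) (dsq x Ax)) /=.
have -> : 'D_v f x = 'd f x v by apply: deriveE; exact: df.
rewrite diff1E /=; last exact: dsq.
rewrite derive1E (derive_sqrt (f0 _ Ax)).
by rewrite /GRing.scale /= invfM mulrCA.
Qed.

Lemma diff_eps (U W : normedModType R) (g : U -> W) (x : U) (e : R) :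
  0 < e -> differentiable g x ->
  \forall h \near (0 : U), `|g (h + x) - g x - 'd g x h| <= e * `|h|.
Proof.
move=> e0 dg; have [_ /eqaddoP/(_ e e0)] := (diff_locallyP x g).1 dg.
apply: filterS => h; rewrite /= !fctE /=.
by rewrite opprD addrA.
Qed.

(** The set of [t] with [|phi t - phi a| <= (M + e) (t - a)] is closed, and
    differentiability extends it to the right of each of its points, so it
    reaches [b]; then [e] tends to 0. *)
Lemma mean_value_ineq (V : normedModType R) (phi dphi : R -> V) (a b M : R) :
  a <= b ->
  (forall t, a <= t <= b -> is_derive t 1 phi (dphi t)) ->
  (forall t, a <= t <= b -> `|dphi t| <= M) ->
  `|phi b - phi a| <= M * (b - a).
Proof.
move=> ab dph bM.
suff key e : 0 < e -> `|phi b - phi a| <= (M + e) * (b - a).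
  move: ab; rewrite le_eqVlt => /orP[/eqP<-|ab]; first by rewrite !subrr normr0 mulr0.
  apply/ler_addgt0Pr => e e0.
  have := key (e / (b - a)) (divr_gt0 e0 _); rewrite subr_gt0 => /(_ ab).
  by rewrite mulrDl divfK // gt_eqF // subr_gt0.
move=> e0.
pose A := [set t | a <= t <= b /\ `|phi t - phi a| <= (M + e) * (t - a)].
have Aa : A a by split; rewrite ?lexx ?ab // !subrr normr0 mulr0.
have supA : has_sup A by split; [exists a|exists b => t [/andP[]]].
pose c := sup A.
have ac : a <= c by apply: ub_le_sup => //; case: supA.
have cb : c <= b by apply: ge_sup; [exists a|move=> t [/andP[]]].
have cab : a <= c <= b by rewrite ac cb.
have phic : {for c, continuous phi}.
  by apply: differentiable_continuous; apply/derivable1_diffP; apply: ex_derive; exact: dph.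
have Ac : A c.
  split=> //; rewrite leNgt; apply/negP => lt.
  have cont : ((M + e) * (t - a) - `|phi t - phi a|) @[t --> c] --> (M + e) * (c - a) - `|phi c - phi a|.
    apply: cvgB.
      by apply: cvgM; [exact: cvg_cst|apply: cvgB; [exact: cvg_id|exact: cvg_cst]].
    by apply: cvg_norm; apply: cvgB; [exact: phic|exact: cvg_cst].
  have neg : (M + e) * (c - a) - `|phi c - phi a| < 0 by rewrite subr_lt0.
  have : \forall t \near c, (M + e) * (t - a) - `|phi t - phi a| < 0.
    exact: (cvgr_lt _ cont).
  move=> /nbhs_ballP[d /= d0 cd].
  have [t At ct] := sup_adherent d0 supA.
  have tc : t <= c by apply: ub_le_sup => //; case: supA.
  have /cd : ball c d t by rewrite /ball /= ger0_norm ?subr_ge0 // ltrBlDr -ltrBlDl.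
  by case: At => _; rewrite /= subr_lt0 => /le_lt_trans/[apply]; rewrite ltxx.
have [->|bc] := eqVneq b c; first by case: Ac.
have {bc}cb' : c < b by rewrite lt_neqAle eq_sym bc.
have dc := dph _ cab.
have : (fun h => h^-1 *: (phi (h *: 1 + c) - phi c)) @ 0^' --> dphi c.
  by rewrite -(derive_val (is_derive := dc)); exact: (ex_derive (is_derive := dc)).
move=> /cvgrPdist_lt/(_ _ e0) /nbhs_ballP[d /= d0 hd].
pose h := Num.min (d / 2) (b - c).
have h0 : 0 < h by rewrite lt_min divr_gt0 //= subr_gt0.
have hdd : h < d by rewrite gt_min; apply/orP; left; lra.
have hb : h <= b - c by rewrite ge_min lexx orbT.
have : ball (0 : R) d h by rewrite /ball /= sub0r normrN gtr0_norm.
move=> /hd /(_ (lt0r_neq0 h0)) hq.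
have step : `|phi (h + c) - phi c| <= (M + e) * h.
  have -> : phi (h + c) - phi c = h *: (h^-1 *: (phi (h *: 1 + c) - phi c)).
    by rewrite scalerA divff ?gt_eqF // scale1r [h *: 1]mulr1.
  rewrite normrZ gtr0_norm // mulrC ler_wpM2r ?(ltW h0) //.
  set q := _ *: _ in hq *.
  rewrite -(subrK (dphi c) q) (le_trans (ler_normD _ _)) // addrC lerD ?bM //.
  by rewrite distrC ltW.
have : A (h + c).
  split; first by apply/andP; split; lra.
  case: Ac => _ Ac.
  have -> : phi (h + c) - phi a = (phi (h + c) - phi c) + (phi c - phi a) by rewrite addrA subrK.
  by rewrite (le_trans (ler_normD _ _)) // (le_trans (lerD step Ac)) //; lra.
move=> /(ub_le_sup supA.2); rewrite -/c => hc; exfalso; lra.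
Qed.

Lemma is_derive_line (U W : normedModType R) (f : U -> W) (v y : U) (t : R) :
  differentiable f (t *: v + y) ->
  is_derive t 1 (fun s : R => f (s *: v + y)) ('D_v f (t *: v + y)).
Proof.
move=> df.
have dA : differentiable (fun s : R => s *: v + y) t.
  apply: (@differentiableD _ _ _ (fun s : R => s *: v) (fun=> y)) => //.
apply: DeriveDef.
  apply/derivable1_diffP; exact: (@differentiable_comp _ _ _ _ (fun s : R => s *: v + y) f).
apply: (@derive_affine _ _ _ _ f (fun s : R => s *: v + y)) => h.
by rewrite [h *: 1]mulr1 scalerDl addrA.
Qed.

(** The mean value inequality for [tau |-> f (s u + tau v + x) - f (tau v + x)]. *)
Lemma second_difference (U W : normedModType R) (A : set U) (f : U -> W) (x u v : U)
    (e : R) : open A -> A x -> (forall y, A y -> differentiable f y) ->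
  differentiable ('D_v f) x -> 0 < e ->
  \forall s \near (0 : R)^'+,
   `|f (s *: u + s *: v + x) - f (s *: u + x) - f (s *: v + x) + f x
      - (s ^+ 2) *: 'D_u ('D_v f) x| <= e * s ^+ 2.
Proof.
move=> oA Ax df dg e0; set g := 'D_v f in dg *.
(* Twice [|v|]: both lines in the definition of [phi] move along [v]. *)
pose c := `|u| + 2 * `|v| + 1.
have c0 : 0 < c by rewrite ltr_wpDl // addr_ge0 // mulr_ge0.
pose eta := e / c.
have eta0 : 0 < eta by rewrite divr_gt0.
have /nbhs_ballP[d1 /= d10 hd1] := diff_eps eta0 dg.
have /nbhs_ballP[d2 /= d20 hd2] : nbhs x A by exact: open_nbhs_nbhs.
near=> s.
have s0 : 0 < s by near: s; exact: nbhs_right_gt.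
have sc d : 0 < d -> s < d / c -> s * c < d by move=> d0; rewrite -ltr_pdivlMr.
have sd1 : s * c < d1 by apply: sc => //; near: s; apply: nbhs_right_lt; exact: divr_gt0.
have sd2 : s * c < d2 by apply: sc => //; near: s; apply: nbhs_right_lt; exact: divr_gt0.
have small (z : bool) t : 0 <= t <= s -> `|(if z then s *: u else 0) + t *: v| <= s * (`|u| + `|v|).
  move=> /andP[t0 ts]; rewrite (le_trans (ler_normD _ _)) // mulrDr lerD //.
    by case: z; rewrite ?normrZ ?gtr0_norm // normr0 mulr_ge0 // ltW.
  by rewrite normrZ ger0_norm // ler_wpM2r.
have uvc : `|u| + `|v| < c.
  by rewrite /c; have := normr_ge0 u; have := normr_ge0 v; lra.
have lt2 d (z : bool) t : s * c < d -> 0 <= t <= s -> `|(if z then s *: u else 0) + t *: v| < d.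
  move=> scd ts; apply: le_lt_trans (small z t ts) _; apply: le_lt_trans scd.
  by rewrite ler_wpM2l // ltW.
have inA (z : bool) t : 0 <= t <= s -> A ((if z then s *: u else 0) + t *: v + x).
  move=> ts; apply: hd2; rewrite -ball_normE /= opprD addrCA subrr addr0 normrN.
  exact: lt2 sd2 ts.
have est (z : bool) t : 0 <= t <= s ->
    `|g ((if z then s *: u else 0) + t *: v + x) - g x
       - 'd g x ((if z then s *: u else 0) + t *: v)| <=
     eta * (`|if z then s *: u else 0| + t * `|v|).
  move=> ts; apply: le_trans (hd1 _ _) _.
    by rewrite -ball_normE /= sub0r normrN; exact: lt2 sd1 ts.
  rewrite ler_wpM2l ?(ltW eta0) // (le_trans (ler_normD _ _)) // lerD2l normrZ.
  by case/andP: ts => t0 _; rewrite ger0_norm.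
pose phi t := f (t *: v + (s *: u + x)) - f (t *: v + x) - (t * s) *: 'D_u g x.
have l0 t : 0 + t *: v + x = t *: v + x by rewrite add0r.
have l1 t : s *: u + t *: v + x = t *: v + (s *: u + x) by rewrite addrA [t *: v + _]addrC.
have dphi t : 0 <= t <= s -> is_derive t 1 phi
    (g (t *: v + (s *: u + x)) - g (t *: v + x) - s *: 'D_u g x).
  move=> ts; apply: is_deriveB.
    apply: is_deriveB; apply: is_derive_line; apply: df.
      by rewrite -l1; exact: (inA true).
    by rewrite -l0; exact: (inA false).
  have -> : (fun t : R => (t * s) *: 'D_u g x) = (fun t : R => t *: (s *: 'D_u g x) + 0).
    by apply/funext => t'; rewrite addr0 scalerA.
  have idd : differentiable (idfun : W -> W) (t *: (s *: 'D_u g x) + 0).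
    exact: (ex_diff (is_diff_def := is_diff_id _)).
  have := is_derive_line idd.
  by rewrite derive_id.
have := mean_value_ineq (M := eta * (s * (`|u| + 2 * `|v|))) (ltW s0) dphi.
have bnd t : 0 <= t <= s -> `|g (t *: v + (s *: u + x)) - g (t *: v + x) - s *: 'D_u g x| <=
    eta * (s * (`|u| + 2 * `|v|)).
  move=> ts; have e1 := est true t ts; have e2 := est false t ts; rewrite /= in e1 e2.
  have -> : g (t *: v + (s *: u + x)) - g (t *: v + x) - s *: 'D_u g x =
    (g (s *: u + t *: v + x) - g x - 'd g x (s *: u + t *: v)) -
    (g (0 + t *: v + x) - g x - 'd g x (0 + t *: v)).
    have -> : s *: 'D_u g x = 'd g x (s *: u) by rewrite deriveE // linearZ.
    rewrite l0 l1 add0r linearD.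
    have sub2 (a b z : W) : a - b = (a + z) - (b + z).
      by rewrite opprD addrACA subrr addr0.
    set p := 'd g x (s *: u); set q := 'd g x (t *: v).
    rewrite (sub2 (g (t *: v + (s *: u + x))) _ (- g x - q)) [LHS]addrAC; congr (_ - _); last by rewrite addrA.
    by rewrite opprD [- p - q]addrC !addrA.
  apply: le_trans (ler_normB _ _) _; apply: le_trans (lerD e1 e2) _.
  rewrite -mulrDr normr0 add0r ler_wpM2l ?(ltW eta0) // normrZ gtr0_norm //.
  case/andP: ts => t0 ts; have := ler_wpM2r (normr_ge0 v) ts.
  set k := s * `|v|; rewrite -/k mulrDr mulrCA -/k; lra.
move=> /(_ bnd); rewrite subr0.
have -> : phi s - phi 0 = f (s *: u + s *: v + x) - f (s *: u + x) - f (s *: v + x)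
    + f x - s ^+ 2 *: 'D_u g x.
  rewrite /phi scale0r !add0r mul0r scale0r subr0 addrA [s *: v + s *: u]addrC expr2.
  set a := f _; set b := f (s *: v + x); set c1 := f (s *: u + x); set q := _ *: _.
  rewrite opprB -!addrA; congr (a + _); rewrite [RHS]addrCA; congr (- b + _).
  by rewrite [LHS]addrC [RHS]addrC addrAC.
move=> le1; apply: le_trans le1 _.
rewrite -mulrA mulrC -mulrA expr2 mulrAC -mulrA [eta * _]mulrC.
have le2 : s * s * ((`|u| + 2 * `|v|) * eta) <= s * s * e.
  rewrite ler_wpM2l ?mulr_ge0 ?(ltW s0) // /eta mulrA ler_pdivrMr // mulrC.
  by rewrite ler_wpM2l ?(ltW e0) // /c; lra.
by rewrite mulrC -expr2 in le2 *; lra.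
Unshelve. all: by end_near. Qed.
End MeanValue.

(** * Symmetry of second derivatives *)

Section Schwarz.
Context {R : realType}.

(** The second difference is symmetric in [u] and [v], and [second_difference]
    makes either mixed derivative its limit after division by [s ^+ 2]. *)
Lemma derive_comm (U W : normedModType R) (A : set U) (f : U -> W) (u v x : U) :
  open A -> smooth_on A f -> A x -> 'D_u ('D_v f) x = 'D_v ('D_u f) x.
Proof.
move=> oA sf Ax; apply/eqP; rewrite -subr_eq0 -normr_le0; apply/ler_addgt0Pr => e e0.
rewrite add0r.
have df y : A y -> differentiable f y by exact: smooth_diff.
have duv := second_difference u oA Ax df (smooth_diff (smooth_derive v sf) Ax).
have dvu := second_difference v oA Ax df (smooth_diff (smooth_derive u sf) Ax).
have e2 : 0 < e / 2 by rewrite divr_gt0.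
have [s [[/= s0 h1] h2]] := filter_ex (filterI (filterI (nbhs_right_gt (0 : R)) (duv _ e2)) (dvu _ e2)).
rewrite -(ler_pM2r (x := s ^+ 2)) ?exprn_gt0 //.
rewrite -[X in _ * X]ger0_norm ?sqr_ge0 // mulrC -normrZ scalerBr.
move: h2; rewrite [s *: v + s *: u]addrC [_ - _ - f (s *: u + x)]addrAC => h2.
set a := _ + f x in h1 h2.
have -> : s ^+ 2 *: 'D_u ('D_v f) x - s ^+ 2 *: 'D_v ('D_u f) x =
  (a - s ^+ 2 *: 'D_v ('D_u f) x) - (a - s ^+ 2 *: 'D_u ('D_v f) x).
  by rewrite opprB [RHS]addrC addrA subrK.
apply: le_trans (ler_normB _ _) _; apply: le_trans (lerD h2 h1) _.
by rewrite -mulrDl -splitr.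
Qed.

Lemma derivative_sum (U W : normedModType R) (I : Type) (r : seq I) (P : pred I)
    (F : I -> U -> W) (v a : U) :
  (forall i, P i -> differentiable (F i) a) ->
  differentiable (fun x => \sum_(i <- r | P i) F i x) a /\
  'D_v (fun x => \sum_(i <- r | P i) F i x) a = \sum_(i <- r | P i) 'D_v (F i) a.
Proof.
move=> dF; elim: r => [|i r [IHd IH]].
  have -> : (fun x => \sum_(i <- [::] | P i) F i x) = fun=> 0.
    by apply/funext => x; rewrite big_nil.
  by rewrite big_nil derive_cst; split=> //; exact: differentiable_cst.
case Pi : (P i); last first.
  have -> : (fun x => \sum_(i <- i :: r | P i) F i x) = fun x => \sum_(i <- r | P i) F i x.
    by apply/funext => x; rewrite big_cons Pi.
  by rewrite big_cons Pi.
have -> : (fun x => \sum_(i <- i :: r | P i) F i x) =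
    F i + (fun x => \sum_(i <- r | P i) F i x).
  by apply/funext => x; rewrite big_cons Pi.
have dFi := dF _ Pi.
split; first exact: differentiableD.
by rewrite big_cons Pi -IH; apply: deriveD; exact: diff_derivable.
Qed.

End Schwarz.

(** * Pointwise linear operators and families of forms *)

Section PointwiseOperators.
Context {R : realType} {V : normedModType R} {d : nat}.
Implicit Types (w : dform V d) (B : set 'rV[R]_d).

(** The operators that act on the values of a form by a matrix of smooth
    functions: contractions, products with a covector, Hodge stars and their
    composites. They pass through derivatives in a parameter other than [x]. *)
Definition multiplier B (Op : dform V d -> dform V d) : Prop :=
  exists A : {set 'I_d} -> {set 'I_d} -> 'rV[R]_d -> R,
    (forall S K, smooth_on B (A S K)) /\
    forall w x S, Op w x S = \sum_(K : {set 'I_d}) A S K x *: w x K.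

Lemma multiplier_sum B Op (I : finType) (P : {set 'I_d} -> pred I)
    (f : {set 'I_d} -> I -> {set 'I_d}) (c : {set 'I_d} -> I -> 'rV[R]_d -> R) :
  open B -> (forall S i, P S i -> smooth_on B (c S i)) ->
  (forall w x S, Op w x S = \sum_(i | P S i) c S i x *: w x (f S i)) ->
  multiplier B Op.
Proof.
move=> oB sc OpE; exists (fun S K x => \sum_(i | P S i && (f S i == K)) c S i x).
split=> [S K|w x S]; first by apply: smooth_sum => // i /andP[Pi _]; exact: sc.
rewrite OpE (partition_big (f S) predT) //=; apply: eq_bigr => K _.
rewrite scaler_suml; apply: eq_bigr => i /andP[_ /eqP ->] //.
Qed.

Lemma multiplier_comp B Op1 Op2 : open B -> multiplier B Op1 -> multiplier B Op2 ->
  multiplier B (fun w => Op1 (Op2 w)).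
Proof.
move=> oB [A1 [sA1 E1]] [A2 [sA2 E2]].
exists (fun S K x => \sum_(J : {set 'I_d}) A1 S J x * A2 J K x).
split=> [S K|w x S]; first by apply: smooth_sum => // J _; exact: smoothM.
rewrite E1; under eq_bigr do rewrite E2 scaler_sumr.
rewrite exchange_big /=; apply: eq_bigr => K _; rewrite scaler_suml.
by apply: eq_bigr => J _; rewrite scalerA.
Qed.

Lemma multiplier_ext B Op : multiplier B Op -> forall w w' x S,
  (forall K, w x K = w' x K) -> Op w x S = Op w' x S.
Proof.
by move=> [A [_ E]] w w' x S ww; rewrite !E; apply: eq_bigr => K _; rewrite ww.
Qed.

Lemma multiplierB B Op : multiplier B Op -> forall w w' x S,
  Op (fun x S => w x S - w' x S) x S = Op w x S - Op w' x S.
Proof.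
move=> [A [_ E]] w w' x S; rewrite !E -sumrB.
by apply: eq_bigr => K _; rewrite scalerBr.
Qed.

Lemma multiplier0 B Op : multiplier B Op -> forall w x S,
  (forall K, w x K = 0) -> Op w x S = 0.
Proof.
move=> [A [_ E]] w x S w0; rewrite E big1 // => K _; by rewrite w0 scaler0.
Qed.

Lemma interior_multiplier B (v : vfield R d) : open B -> smooth_on B v ->
  multiplier B (interior_prod v).
Proof.
move=> oB sv.
apply: (@multiplier_sum _ _ _ (fun S i => i \in ~: S) (fun S i => i |: S)
   (fun S i x => insert_sign R i S * v x 0 i)) => // S i _.
by apply: smoothM => //; [exact: smooth_cst|exact: smooth_coord].
Qed.

Lemma wedge_multiplier B (v : vfield R d) : open B -> smooth_on B v ->
  multiplier B (wedge_flat v).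
Proof.
move=> oB sv.
apply: (@multiplier_sum _ _ _ (fun S i => i \in S) (fun S i => S :\ i)
   (fun S i x => insert_sign R i S * v x 0 i)) => // S i _.
by apply: smoothM => //; [exact: smooth_cst|exact: smooth_coord].
Qed.

End PointwiseOperators.

Section Families.
Context {R : realType} {V : normedModType R} {N d : nat}.
Local Notation pt := ('rV[R]_N * 'rV[R]_d)%type.

(** Families of forms with a parameter [t] stand for the fields on the domains
    perturbed by [t], extended a little beyond these domains. *)
Definition smooth_fam (O : set pt) (W : 'rV[R]_N -> dform V d) : Prop :=
  forall S, smooth_on O (fun p => W p.1 p.2 S).

Definition dt (e : 'rV[R]_N) (W : 'rV[R]_N -> dform V d) : 'rV[R]_N -> dform V d :=
  fun t x S => 'D_e (fun s => W s x S) t.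

Definition dtv (e : 'rV[R]_N) (n : 'rV[R]_N -> vfield R d) : 'rV[R]_N -> vfield R d :=
  fun t x => 'D_e (fun s => n s x) t.

Lemma derive_fst (W : normedModType R) (F : pt -> W) (e t : 'rV[R]_N) x :
  'D_e (fun s => F (s, x)) t = 'D_(e, 0) F (t, x).
Proof.
apply: (@derive_affine _ _ _ _ F (fun s => (s, x)) e t (e, 0)) => h.
by congr pair; rewrite /= scaler0 add0r.
Qed.

Lemma derive_snd (W : normedModType R) (F : pt -> W) (t : 'rV[R]_N) (u x : 'rV[R]_d) :
  'D_u (fun y => F (t, y)) x = 'D_(0, u) F (t, x).
Proof.
apply: (@derive_affine _ _ _ _ F (fun y => (t, y)) u x (0, u)) => h.
by congr pair; rewrite /= scaler0 add0r.
Qed.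

Lemma dtE e (W : 'rV[R]_N -> dform V d) t x S :
  dt e W t x S = 'D_(e, 0) (fun p => W p.1 p.2 S) (t, x).
Proof. exact: (derive_fst (fun p => W p.1 p.2 S)). Qed.

Lemma dtvE e (n : 'rV[R]_N -> vfield R d) t x :
  dtv e n t x = 'D_(e, 0) (fun p => n p.1 p.2) (t, x).
Proof. exact: (derive_fst (fun p => n p.1 p.2)). Qed.

Lemma partialE i (W : 'rV[R]_N -> dform V d) t x S :
  partial i (fun y => W t y S) x = 'D_(0, delta_mx 0 i) (fun p => W p.1 p.2 S) (t, x).
Proof. exact: (derive_snd (fun p => W p.1 p.2 S)). Qed.

Variables (O : set pt) (oO : open O).

Lemma open_slice t : open [set x | O (t, x)].
Proof.
apply: (@open_comp _ _ (fun x => (t, x)) O) => // x _.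
apply: differentiable_continuous; apply: differentiable_pair.
  exact: differentiable_cst.
exact: (ex_diff (is_diff_def := is_diff_id _)).
Qed.

Lemma smooth_slice (W : normedModType R) (F : pt -> W) t :
  smooth_on O F -> smooth_on [set x | O (t, x)] (fun x => F (t, x)).
Proof.
apply: (@smooth_affine _ _ _ _ _ _ (fun x => (t, x)) (fun x => (0, x))) => //.
- exact: open_slice.
- by move=> h u a; congr pair; rewrite /= scaler0 add0r.
Qed.

Lemma smooth_snd (W : normedModType R) (B : set 'rV[R]_d) (F : 'rV[R]_d -> W) :
  (forall p, O p -> B p.2) -> smooth_on B F -> smooth_on O (fun p => F p.2).
Proof.
move=> OB; apply: (@smooth_affine _ _ _ _ _ _ (fun p : pt => p.2) snd) => //.
move=> p; have l : linear (snd : pt -> 'rV[R]_d) by [].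
pose sl := GRing.isLinear.Build _ _ _ _ _ l.
pose s : {linear pt -> 'rV[R]_d} := HB.pack (snd : pt -> 'rV[R]_d) sl.
by apply: (@linear_differentiable _ _ _ s) => q; exact: cvg_snd.
Qed.

Lemma smooth_dt e W : smooth_fam O W -> smooth_fam O (dt e W).
Proof.
move=> sW S; apply: (smooth_eq oO _ (smooth_derive (e, 0) (sW S))) => -[t x] _ /=.
by rewrite dtE.
Qed.

Lemma smooth_dtv e n : smooth_on O (fun p => n p.1 p.2) ->
  smooth_on O (fun p => dtv e n p.1 p.2).
Proof.
move=> sn; apply: (smooth_eq oO _ (smooth_derive (e, 0) sn)) => -[t x] _ /=.
by rewrite dtvE.
Qed.

Lemma smooth_ext W : smooth_fam O W -> smooth_fam O (fun t => ext_deriv (W t)).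
Proof.
move=> sW S; apply: smooth_sum => // i _; apply: smooth_scale => //; first exact: smooth_cst.
apply: (smooth_eq oO _ (smooth_derive (0, delta_mx 0 i) (sW (S :\ i)))) => -[t x] _ /=.
by rewrite partialE.
Qed.

Lemma smooth_multiplier B Op W : multiplier B Op -> (forall p, O p -> B p.2) ->
  smooth_fam O W -> smooth_fam O (fun t => Op (W t)).
Proof.
move=> [A [sA E]] OB sW S.
have h : smooth_on O (fun p => \sum_K A S K p.2 *: W p.1 p.2 K).
  by apply: smooth_sum => // K _; apply: smooth_scale => //; exact: smooth_snd (sA S K).
by apply: (smooth_eq oO _ h) => p _; rewrite E.
Qed.

Lemma dt_multiplier B Op W e t x S : multiplier B Op -> smooth_fam O W -> O (t, x) ->
  dt e (fun t => Op (W t)) t x S = Op (dt e W t) x S.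
Proof.
move=> [A [sA E]] sW Otx; rewrite /dt E.
have dW K : differentiable (fun s => W s x K) t.
  apply: (@differentiable_comp _ _ _ _ (fun s : 'rV[R]_N => (s, x)) (fun p => W p.1 p.2 K)).
    apply: differentiable_pair; last exact: differentiable_cst.
    exact: (ex_diff (is_diff_def := is_diff_id _)).
  exact: smooth_diff (sW K) Otx.
under eq_fun do rewrite E.
have dAW K : differentiable (fun s => A S K x *: W s x K) t.
  by have := (diff_scalef (differentiable_cst (A S K x) t) (dW K)).1.
rewrite (derivative_sum _ (F := fun K s => A S K x *: W s x K) e (fun K _ => dAW K)).2.
apply: eq_bigr => K _.
have := (diff_scalef (differentiable_cst (A S K x) t) (dW K)).2 e.
by rewrite derive_cst scale0r add0r.
Qed.

Lemma dt_ext W e t x S : smooth_fam O W -> O (t, x) ->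
  dt e (fun t => ext_deriv (W t)) t x S = ext_deriv (dt e W t) x S.
Proof.
move=> sW Otx; rewrite dtE /ext_deriv.
have E i (p : pt) : partial i (fun y => W p.1 y (S :\ i)) p.2 =
   'D_(0, delta_mx 0 i) (fun p => W p.1 p.2 (S :\ i)) p by case: p => ? ?; rewrite partialE.
have dd i : differentiable (fun p : pt => insert_sign R i S *:
     'D_(0, delta_mx 0 i) (fun p => W p.1 p.2 (S :\ i)) p) (t, x).
  apply: (diff_scalef (differentiable_cst _ _) _).1.
  exact: smooth_diff (smooth_derive _ (sW _)) Otx.
under eq_fun do under eq_bigr do rewrite E.
rewrite (derivative_sum _ (e, 0) (fun i _ => dd i)).2; apply: eq_bigr => i _.
have dD := smooth_diff (smooth_derive (0, delta_mx 0 i) (sW (S :\ i))) Otx.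
rewrite (diff_scalef (differentiable_cst (insert_sign R i S) (t, x)) dD).2.
rewrite [X in X *: _ + _]derive_cst scale0r add0r; congr (_ *: _).
rewrite (derive_comm _ _ oO (sW _) Otx) [RHS]partialE.
suff -> : (fun p => dt e W p.1 p.2 (S :\ i)) = 'D_(e, 0) (fun p => W p.1 p.2 (S :\ i)) by [].
by apply/funext => -[s y]; rewrite dtE.
Qed.

Lemma smooth_interior n W : smooth_on O (fun p => n p.1 p.2) -> smooth_fam O W ->
  smooth_fam O (fun t => interior_prod (n t) (W t)).
Proof.
move=> sn sW S; apply: smooth_sum => // i _; apply: smooth_scale => //.
by apply: smoothM => //; [exact: smooth_cst|exact: (smooth_coord _ oO sn)].
Qed.

Lemma dt_interior n W e t x S : smooth_on O (fun p => n p.1 p.2) -> smooth_fam O W ->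
  O (t, x) ->
  dt e (fun t => interior_prod (n t) (W t)) t x S =
  interior_prod (dtv e n t) (W t) x S + interior_prod (n t) (dt e W t) x S.
Proof.
move=> sn sW Otx; rewrite dtE /interior_prod.
have dn i : differentiable (fun p : pt => insert_sign R i S * n p.1 p.2 0 i) (t, x).
  apply: smooth_diff Otx; apply: smoothM => //; first exact: smooth_cst.
  exact: (smooth_coord _ oO sn).
have dW K := smooth_diff (sW K) Otx.
rewrite (derivative_sum _ (F := fun i (p : pt) => (insert_sign R i S * n p.1 p.2 0 i) *:
   W p.1 p.2 (i |: S)) (e, 0) (fun i _ => (diff_scalef (dn i) (dW (i |: S))).1)).2.
rewrite -big_split /=; apply: eq_bigr => i _.
rewrite (diff_scalef (dn i) (dW (i |: S))).2 dtE; congr (_ *: _ + _).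
have dni : differentiable (fun p : pt => n p.1 p.2 0 i) (t, x).
  by apply: smooth_diff Otx; exact: (smooth_coord _ oO sn).
have := (diff_scalef (differentiable_cst (insert_sign R i S) (t, x)) dni).2 (e, 0).
rewrite derive_cst scale0r add0r => ->; congr (_ * _).
by rewrite coord_derive; [rewrite dtvE|exact: smooth_diff sn Otx].
Qed.

End Families.

Lemma ext_deriv_eq {R : realType} {V : normedModType R} {d : nat}
    (B : set 'rV[R]_d) (w w' : dform V d) x S :
  open B -> B x -> (forall y K, B y -> w y K = w' y K) ->
  ext_deriv w x S = ext_deriv w' x S.
Proof.
move=> oB Bx ww; apply: eq_bigr => i _; congr (_ *: _).
apply: near_eq_derive; near=> y; apply: ww; near: y; exact: open_nbhs_nbhs.
Unshelve. all: by end_near. Qed.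

Lemma ext_derivB {R : realType} {V : normedModType R} {d : nat}
    (w w' : dform V d) x S :
  (forall K, differentiable (fun y => w y K) x) ->
  (forall K, differentiable (fun y => w' y K) x) ->
  ext_deriv (fun x S => w x S - w' x S) x S = ext_deriv w x S - ext_deriv w' x S.
Proof.
move=> dw dw'; rewrite /ext_deriv -sumrB; apply: eq_bigr => i _.
rewrite -scalerBr; congr (_ *: _).
by apply: deriveB; exact: diff_derivable.
Qed.

(** * Exterior algebra at a point *)

Section ExteriorAlgebra.
Context {R : realType} {V : normedModType R} {d : nat}.
Implicit Types (a b : 'I_d -> R) (om : {set 'I_d} -> V) (S T A : {set 'I_d}) (i j k : 'I_d).

Local Notation eps := (insert_sign R).

Definition contr a om : {set 'I_d} -> V :=
  fun S => \sum_(i in ~: S) (eps i S * a i) *: om (i |: S).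

Definition wedge a om : {set 'I_d} -> V :=
  fun S => \sum_(i in S) (eps i S * a i) *: om (S :\ i).

Lemma insert_sign_setU1 i j S : j \notin S ->
  eps i (j |: S) = (-1) ^+ (j < i)%N * eps i S.
Proof.
move=> jS; rewrite /insert_sign -exprD; congr (_ ^+ _).
have -> : [set k in j |: S | (k < i)%N] =
   (if (j < i)%N then finset.set1 j else finset.set0) :|: [set k in S | (k < i)%N].
  apply/finset.setP => k; rewrite !inE.
  by case: ifP => ji; rewrite !inE; have [->|] := eqVneq k j; rewrite ?ji ?(negbTE jS) ?andbF.
case: ifP => ji; last by rewrite finset.set0U.
by rewrite cardsU1 !inE (negbTE jS).
Qed.

Lemma insert_sign_setD1 i j S : j \in S ->
  eps i (S :\ j) = (-1) ^+ (j < i)%N * eps i S.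
Proof.
move=> jS; rewrite -[in RHS](finset.setD1K jS) insert_sign_setU1 ?finset.setD11 //.
by rewrite mulrA -expr2 sqrr_sign mul1r.
Qed.

Lemma insert_sign_sqr i S : eps i S * eps i S = 1.
Proof. by rewrite -expr2 sqrr_sign. Qed.

Lemma insert_signU1 i S : eps i (i |: S) = eps i S.
Proof.
rewrite /insert_sign; congr (_ ^+ _); apply: eq_card => k; rewrite !inE.
by have [->|] := eqVneq k i; rewrite ?ltnn ?andbF.
Qed.

Lemma insert_signD1 i S : eps i (S :\ i) = eps i S.
Proof.
rewrite /insert_sign; congr (_ ^+ _); apply: eq_card => k; rewrite !inE.
by have [->|] := eqVneq k i; rewrite ?ltnn ?andbF.
Qed.

Lemma ltn_sign_neq i j : i != j -> (-1) ^+ (i < j)%N = - (-1) ^+ (j < i)%N :> R.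
Proof.
move=> ij; case: (ltngtP i j) => [_|_|/val_inj e]; rewrite ?expr1 ?expr0 ?opprK //.
by rewrite e eqxx in ij.
Qed.

(** In the sum of the two sides the terms that remove and insert the same index
    give the inner product; for distinct indices the signs are opposite. *)
Lemma contr_wedge a b om S :
  contr a (wedge b om) S + wedge b (contr a om) S = (\sum_i a i * b i) *: om S.
Proof.
have E1 : contr a (wedge b om) S = (\sum_(i in ~: S) a i * b i) *: om S +
    \sum_(i in ~: S) \sum_(j in S)
      (eps i S * eps j (i |: S) * (a i * b j)) *: om ((i |: S) :\ j).
  rewrite scaler_suml -big_split /=; apply: eq_bigr => i; rewrite inE => iS.
  rewrite /wedge scaler_sumr (finset.big_setU1 _ iS) /= scalerA; congr (_ + _).
    rewrite finset.setU1K // insert_signU1 mulrACA insert_sign_sqr mul1r //.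
  by apply: eq_bigr => j jS; rewrite scalerA mulrACA.
have E2 : wedge b (contr a om) S = (\sum_(i in S) a i * b i) *: om S +
    \sum_(j in S) \sum_(i in ~: S)
      (eps j S * eps i (S :\ j) * (b j * a i)) *: om (i |: (S :\ j)).
  rewrite scaler_suml -big_split /=; apply: eq_bigr => j jS.
  rewrite /contr scaler_sumr.
  have -> : ~: (S :\ j) = j |: ~: S.
    by apply/finset.setP => k; rewrite !inE negb_and negbK.
  rewrite finset.big_setU1 ?inE ?jS //= scalerA; congr (_ + _).
    by rewrite finset.setD1K // insert_signD1 mulrACA insert_sign_sqr mul1r mulrC.
  by apply: eq_bigr => i iS; rewrite scalerA mulrACA.
rewrite E1 E2 addrACA -scalerDl [X in _ + X](_ : _ = 0) ?addr0.
  congr (_ *: _); rewrite addrC [RHS](bigID (mem S)) /=; congr (_ + _).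
  by apply: eq_bigl => i; rewrite inE.
rewrite [X in X + _]exchange_big -big_split big1 //= => j jS.
rewrite -big_split big1 //= => i; rewrite inE => iS.
have ij : i != j by apply: contra iS => /eqP ->.
have -> : (i |: S) :\ j = i |: (S :\ j).
  apply/finset.setP => k; rewrite !inE; have [->|] := eqVneq k i; rewrite ?ij ?andbT ?orbT //.
rewrite -scalerDl insert_sign_setU1 // insert_sign_setD1 // (ltn_sign_neq ij).
by rewrite [X in X *: _](_ : _ = 0) ?scale0r //; ring.
Qed.

Lemma alternating_sum (f : 'I_d -> 'I_d -> V) :
  (forall i j, f i j = - f j i) -> \sum_i \sum_j f i j = 0.
Proof.
move=> alt; set X := \sum_i _.
have : X = - X.
  rewrite {1}/X exchange_big /= -sumrN; apply: eq_bigr => i _.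
  by rewrite -sumrN; apply: eq_bigr => j _; rewrite alt.
move/eqP; rewrite -addr_eq0 -mulr2n -scaler_nat scaler_eq0 pnatr_eq0 /=.
by move/eqP.
Qed.

Lemma contr_contr a om S : contr a (contr a om) S = 0.
Proof.
rewrite -[RHS](@alternating_sum (fun i j => if (i \notin S) && (j \notin i |: S) then
   ((eps i S * eps j (i |: S)) * (a i * a j)) *: om (j |: (i |: S)) else 0)).
  rewrite /contr big_mkcond /=; apply: eq_bigr => i _; rewrite inE.
  case: ifP => iS; last by rewrite big1.
  rewrite scaler_sumr big_mkcond /=; apply: eq_bigr => j _.
  by rewrite finset.in_setC; case: ifP => // _; rewrite scalerA mulrACA.
move=> i j; rewrite !finset.in_setU1 !negb_or eq_sym.
have [ij|ij] := eqVneq j i; first by rewrite !andbF oppr0.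
rewrite /=; case: (boolP (i \in S)) => iS /=; rewrite ?andbF ?oppr0 //.
case: (boolP (j \in S)) => jS /=; rewrite ?oppr0 //.
rewrite !insert_sign_setU1 // finset.setUCA -scaleNr (ltn_sign_neq ij); congr (_ *: _); ring.
Qed.

Lemma wedge_wedge a om S : wedge a (wedge a om) S = 0.
Proof.
rewrite -[RHS](@alternating_sum (fun i j => if (i \in S) && (j \in S :\ i) then
   ((eps i S * eps j (S :\ i)) * (a i * a j)) *: om ((S :\ i) :\ j) else 0)).
  rewrite /wedge big_mkcond /=; apply: eq_bigr => i _.
  case: ifP => iS; last by rewrite big1.
  rewrite scaler_sumr big_mkcond /=; apply: eq_bigr => j _.
  by case: ifP => // _; rewrite scalerA mulrACA.
move=> i j; rewrite !finset.in_setD1 eq_sym.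
have [ij|ij] := eqVneq j i; first by rewrite !andbF oppr0.
rewrite /=; case: (boolP (i \in S)) => iS /=; rewrite ?andbF ?oppr0 //.
case: (boolP (j \in S)) => jS /=; rewrite ?oppr0 //.
rewrite !insert_sign_setD1 // -scaleNr (ltn_sign_neq ij).
have -> : S :\ i :\ j = S :\ j :\ i by apply/finset.setP => k; rewrite !inE andbCA.
congr (_ *: _); ring.
Qed.

Lemma contr0 a om S : (forall K, om K = 0) -> contr a om S = 0.
Proof. by move=> om0; rewrite /contr big1 // => i _; rewrite om0 scaler0. Qed.

Lemma wedge0 a om S : (forall K, om K = 0) -> wedge a om S = 0.
Proof. by move=> om0; rewrite /wedge big1 // => i _; rewrite om0 scaler0. Qed.

End ExteriorAlgebra.

(** * Minors *)

Section Minors.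
Context {R : realType} {d : nat}.
Implicit Types (h : 'M[R]_d) (A S : {set 'I_d}) (i j k : 'I_d) (s t : seq 'I_d).

(** Rows and columns are listed by sequences, so that deleting an index or
    putting a repeated row in front stays within the same notion. *)
Definition seq_minor (i0 : 'I_d) h s t n : R :=
  \det (\matrix_(i < n, j < n) h (nth i0 s i) (nth i0 t j)).

Definition del p s := take p s ++ drop p.+1 s.

Lemma nth_del i0 p s q : (p < size s)%N -> nth i0 (del p s) q = nth i0 s (bump p q).
Proof.
move=> ps; rewrite /del nth_cat size_take ps /bump.
case: (ltnP q p) => qp; first by rewrite add0n nth_take.
by rewrite nth_drop; congr nth; lia.
Qed.

Lemma seq_minor_row i0 h s t n (p : 'I_n.+1) : size s = n.+1 -> size t = n.+1 ->
  seq_minor i0 h s t n.+1 = \sum_(j < n.+1)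
    h (nth i0 s p) (nth i0 t j) * ((-1) ^+ (p + j) * seq_minor i0 h (del p s) (del j t) n).
Proof.
move=> ss st; rewrite /seq_minor (expand_det_row _ p); apply: eq_bigr => j _.
rewrite !mxE /cofactor; do 2!congr (_ * _); congr (\det _).
apply/matrixP => k l; rewrite !mxE !nth_del ?ss ?st //.
Qed.

Lemma minor_seq i0 h A S : #|A| = #|S| ->
  minor h A S = seq_minor i0 h (enum A) (enum S) #|A|.
Proof.
move=> AS; congr (\det _); apply/matrixP => i j; rewrite !mxE (enum_val_nth i0).
by congr (h _ _); apply: set_nth_default; rewrite -cardE -AS.
Qed.

Lemma sorted_enum_ord S : sorted ltn (map val (enum S)).
Proof.
apply: (subseq_sorted ltn_trans (s2 := map val (enum 'I_d))).
  by apply: map_subseq; rewrite [enum (mem S)]/(enum _) enumT; exact: filter_subseq.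
by rewrite val_enum_ord; exact: iota_ltn_sorted.
Qed.

Lemma index_enum_ord i S : i \in S -> index i (enum S) = #|[set j in S | (j < i)%N]|.
Proof.
move=> iS; have iE : i \in enum S by rewrite mem_enum.
have -> : #|[set j in S | (j < i)%N]| = count (fun j : 'I_d => (j < i)%N) (enum S).
  rewrite cardE -size_filter; congr size.
  rewrite /enum_mem -filter_predI; apply: eq_filter => j.
  by rewrite /= !inE andbC.
have := sorted_enum_ord S.
elim: (enum S) iE => //= k s IH.
rewrite inE => iks srt; have srt' := path_sorted srt.
have [ki|ki] := eqVneq k i.
  rewrite ki ltnn add0n; apply/esym/eqP; rewrite -leqn0 leqNgt -has_count -all_predC.
  apply/allP => j js /=; rewrite -leqNgt ltnW //.
  have /(order_path_min ltn_trans)/allP := srt; rewrite ki; apply.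
  exact: map_f.
have is_ : i \in s by move: iks; rewrite eq_sym (negbTE ki).
rewrite IH //; have /(order_path_min ltn_trans)/allP/(_ (val i) (map_f _ is_)) /= := srt.
by move=> ->; rewrite add1n.
Qed.

Lemma enumD1 i S : i \in S -> enum (S :\ i) = del (index i (enum S)) (enum S).
Proof.
move=> iS; rewrite /del -remE rem_filter ?enum_uniq //.
rewrite /enum_mem -filter_predI; apply: eq_filter => j.
by rewrite /= !inE.
Qed.

(** Expansion along the row of [i]; for [i] in [A] the left-hand side is a
    determinant with two equal rows. *)
Lemma minor_laplace h i A S : #|S| = #|A|.+1 ->
  \sum_(j in S) insert_sign R j S * h i j * minor h A (S :\ j) =
  if i \in A then 0 else insert_sign R i A * minor h (i |: A) S.
Proof.
move=> cS.
have sz : size (enum S) = #|A|.+1 by rewrite -cardE.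
have szA : size (enum A) = #|A| by rewrite -cardE.
have cD j : j \in S -> #|S :\ j| = #|A|.
  by move=> jS; have := cardsD1 j S; rewrite jS cS add1n => -[].
have sumE (F : 'I_d -> R) : \sum_(j in S) F j = \sum_(q < #|A|.+1) F (nth i (enum S) q).
  by rewrite -big_enum (big_nth i) sz big_mkord.
have idx (q : 'I_#|A|.+1) : index (nth i (enum S) q) (enum S) = q.
  by rewrite index_uniq ?enum_uniq ?sz.
have nS (q : 'I_#|A|.+1) : nth i (enum S) q \in S by rewrite -mem_enum mem_nth ?sz.
have -> : \sum_(j in S) insert_sign R j S * h i j * minor h A (S :\ j) =
    seq_minor i h (i :: enum A) (enum S) #|A|.+1.
  rewrite (seq_minor_row _ _ ord0) //= ?szA // sumE; apply: eq_bigr => q _.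
  rewrite (minor_seq i) ?cD // enumD1 // idx /insert_sign -index_enum_ord // idx.
  by rewrite /del /= drop0 mulrCA mulrA.
case: ifP => iA.
  have iE : i \in enum A by rewrite mem_enum.
  have lt : ((index i (enum A)).+1 < #|A|.+1)%N by rewrite ltnS -szA index_mem.
  rewrite /seq_minor (@determinant_alternate _ _ _ ord0 (Ordinal lt)) // => q.
  by rewrite !mxE /= nth_index.
have iAU : i \in i |: A by rewrite finset.setU11.
have cU : #|i |: A| = #|A|.+1 by rewrite cardsU1 iA.
have szU : size (enum (i |: A)) = #|A|.+1 by rewrite -cardE.
have lt : (index i (enum (i |: A)) < #|A|.+1)%N by rewrite -szU index_mem mem_enum.
rewrite (minor_seq i) ?cU ?cS // [in RHS](seq_minor_row _ _ (Ordinal lt)) //.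
rewrite [in LHS](seq_minor_row _ _ ord0) //= ?szA // mulr_sumr; apply: eq_bigr => q _.
rewrite /= nth_index ?mem_enum // -enumD1 // finset.setU1K ?iA // /del /= drop0.
rewrite index_enum_ord // add0n exprD.
have -> : (-1) ^+ #|[set j in i |: A | (j < i)%N]| = insert_sign R i A.
  exact: insert_signU1.
set e := insert_sign _ _ _; have ee : e * e = 1 by exact: insert_sign_sqr.
set m := seq_minor _ _ _ _ _; set z := (-1) ^+ q; set c := h _ _.
have -> : e * (c * (e * z * m)) = (e * e) * (c * (z * m)) by ring.
by rewrite ee mul1r.
Qed.

End Minors.

(** * Compound matrices *)

Section Compound.
Context {R : realType} {V : normedModType R} {d : nat}.
Implicit Types (a b : 'I_d -> R) (om : {set 'I_d} -> V) (S T A : {set 'I_d}) (i j k : 'I_d).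
Implicit Types (h : 'M[R]_d).

(** The exterior power of [h], in all degrees at once. *)
Definition compound h om : {set 'I_d} -> V :=
  fun A => \sum_(S : {set 'I_d} | #|S| == #|A|) minor h A S *: om S.

(** Expand every minor along the row that the contraction inserts; the terms
    for rows already present cancel, which allows the sum over all [i]. *)
Lemma contr_compound a h om A :
  contr a (compound h om) A = compound h (contr (fun j => \sum_i a i * h i j) om) A.
Proof.
pose F i S := \sum_(j in S) (insert_sign R j S * h i j * minor h A (S :\ j)).
have EL : contr a (compound h om) A =
    \sum_i \sum_(S : {set 'I_d} | #|S| == #|A|.+1) (a i * F i S) *: om S.
  rewrite [RHS](bigID (mem A)) /= [X in _ = X + _]big1 ?add0r; last first.
    move=> i iA; rewrite big1 // => S /eqP cS.
    by rewrite /F minor_laplace // iA mulr0 scale0r.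
  rewrite /contr [LHS](eq_bigl (fun i => i \notin A)); last by move=> i; rewrite inE.
  apply: eq_bigr => i iA; rewrite /compound scaler_sumr cardsU1 iA.
  apply: eq_bigr => S /eqP cS; rewrite /F minor_laplace // (negbTE iA) scalerA.
  by congr (_ *: _); ring.
have ER : compound h (contr (fun j => \sum_i a i * h i j) om) A =
    \sum_i \sum_(S' : {set 'I_d} | #|S'| == #|A|) \sum_(j in ~: S')
      (a i * (insert_sign R j S' * h i j * minor h A S')) *: om (j |: S').
  rewrite [RHS]exchange_big /=; apply: eq_bigr => S' _.
  rewrite [RHS]exchange_big /= /contr scaler_sumr; apply: eq_bigr => j _.
  rewrite scalerA -scaler_suml; congr (_ *: _).
  rewrite !mulr_sumr; apply: eq_bigr => i _; ring.
rewrite EL ER; apply: eq_bigr => i _.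
rewrite (eq_bigr (fun S => \sum_(j in S)
    (a i * (insert_sign R j S * h i j * minor h A (S :\ j))) *: om S)); last first.
  by move=> S _; rewrite /F mulr_sumr scaler_suml.
rewrite (exchange_big_dep predT) //= [RHS](exchange_big_dep predT) //=.
apply: eq_bigr => j _.
rewrite (reindex_onto (fun S' => j |: S') (fun S => S :\ j)) /=; last first.
  by move=> S /andP[_ jS]; rewrite finset.setD1K.
apply: eq_big => [S'|S'].
  rewrite finset.setU11 andbT finset.in_setC.
  have [jS|jS] := boolP (j \in S'); last by rewrite finset.setU1K // eqxx cardsU1 jS /= !andbT add1n eqSS.
  rewrite andbF; apply/negbTE; rewrite negb_and; apply/orP; right.
  by apply/eqP => e; move: jS; rewrite -e finset.setD11.
move=> /andP[_ /eqP e]; rewrite e; congr ((_ * (_ * _ * _)) *: _).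
by rewrite -[in RHS]e insert_signD1.
Qed.

(** Contracting lowers the degree, so injectivity in degree [k.+1] follows from
    degree [k]; invertibility of [h] supplies every basis contraction. *)
Lemma compound_inj h om : h \in unitmx ->
  (forall A, compound h om A = 0) -> forall S, om S = 0.
Proof.
move=> hu z S.
suff key n (om' : {set 'I_d} -> V) : (forall A, #|A| = n -> compound h om' A = 0) ->
    forall T, #|T| = n -> om' T = 0 by exact: (key #|S|).
elim: n om' => [|n IH] om' z' T cT.
  have := z' T cT; rewrite /compound (bigD1 T) //= big1 ?addr0.
    rewrite /minor; move: (\matrix_(_, _) _) => M.
    have -> : \det M = 1 by move: M; rewrite cT => M; rewrite det_mx00.
    by rewrite scale1r.
  move=> S' /andP[]; rewrite cT cards_eq0 => /eqP -> /eqP; case.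
  by apply/esym/eqP; rewrite -cards_eq0 cT.
have : (0 < #|T|)%N by rewrite cT.
move=> /card_gt0P[m mT].
pose a i := (invmx h) m i.
have ah j : \sum_i a i * h i j = (m == j)%:R.
  by have := congr1 (fun M : 'M[R]_d => M m j) (mulVmx hu); rewrite !mxE.
have zc A : #|A| = n -> compound h (contr (fun j => (m == j)%:R) om') A = 0.
  move=> cA; have -> : (fun j => (m == j)%:R) = (fun j => \sum_i a i * h i j).
    by apply/funext => j; rewrite ah.
  rewrite -contr_compound /contr big1 // => i; rewrite finset.in_setC => iA.
  by rewrite z' ?scaler0 // cardsU1 iA cA.
have cTm : #|T :\ m| = n by have := cardsD1 m T; rewrite mT cT add1n => -[].
have := IH _ zc _ cTm; rewrite /contr (bigD1 m) ?inE ?eqxx //= big1 ?addr0.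
  rewrite mulr1 finset.setD1K // => /eqP; rewrite scaler_eq0 => /orP[|/eqP //].
  by rewrite /insert_sign signr_eq0.
by move=> i /andP[_ im]; rewrite eq_sym (negbTE im) mulr0 scale0r.
Qed.

Definition inversions A : {set 'I_d * 'I_d} :=
  [set p in [pred p : 'I_d * 'I_d | [&& p.1 \in A, p.2 \notin A & (p.2 < p.1)%N]]].

Lemma shuffle_signE A : shuffle_sign R A = (-1) ^+ #|inversions A|.
Proof.
congr (_ ^+ _); apply: eq_card => p; rewrite [RHS]inE /=.
by apply/idP/idP => [/set_mem|h]; [|apply: mem_set].
Qed.

(** The sign that turns the product of a covector with a Hodge star into the
    Hodge star of a contraction: adding [i] to [A] removes the inversions with
    the larger elements of [A] and creates those with the smaller elements of
    the complement. *)
Lemma shuffle_sign_setU1 i A : i \notin A ->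
  insert_sign R i (~: A) * shuffle_sign R (i |: A) =
  shuffle_sign R A * (-1) ^+ #|A| * insert_sign R i A.
Proof.
move=> iA; rewrite /insert_sign !shuffle_signE -!exprD.
pose x := #|[set j in ~: A | (j < i)%N]|; pose q := #|[set j in A | (j < i)%N]|.
pose P := #|inversions A|; pose P' := #|inversions (i |: A)|.
rewrite -/x -/q -/P -/P'.
pose g := #|[set j in A | (i < j)%N]|.
have cA : #|A| = (g + q)%N.
  rewrite /g /q -cardsUI [X in (_ + X)%N](_ : _ = 0%N) ?addn0.
    apply: eq_card => j; rewrite !inE -andb_orr.
    have [jA|//] := boolP (j \in A); rewrite /= -neq_ltn; apply/esym.
    by apply: contra iA => /eqP/val_inj ->.
  apply/eqP; rewrite cards_eq0; apply/eqP/finset.setP => j; rewrite !inE.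
  by case: (j \in A) => //=; case: ltngtP.
have PP : (P' + g = P + x)%N.
  pose C := [set p in [pred p : 'I_d * 'I_d |
     [&& p.1 \in A, p.2 \notin i |: A & (p.2 < p.1)%N]]].
  have -> : P = (#|C| + g)%N.
    have -> : g = #|(fun j => (j, i)) @: [set j in A | (i < j)%N]|.
      by rewrite card_in_imset // => ? ? _ _ [].
    rewrite -cardsUI [X in (_ + X)%N](_ : _ = 0%N) ?addn0.
      apply: eq_card => -[j k]; rewrite !inE /= negb_or.
      apply/idP/idP.
        move=> /and3P[jA kA kj]; have [ki|ki] := eqVneq k i; last by rewrite jA kA kj.
        rewrite ki in kj *; apply/orP; right; apply/imsetP; exists j => //; by rewrite inE jA.
      case/orP => [/and3P[-> /andP[_ ->] ->] //|/imsetP[l]].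
      by rewrite inE => /andP[lA il] [-> ->]; rewrite lA iA il.
    apply/eqP; rewrite cards_eq0; apply/eqP/finset.setP => -[j k]; rewrite !inE /=.
    apply/negbTE/negP => /andP[/and3P[_ ki _] /imsetP[l _ [_ e]]].
    by move: ki; rewrite e eqxx.
  have -> : P' = (#|C| + x)%N.
    have -> : x = #|(fun k => (i, k)) @: [set k in ~: A | (k < i)%N]|.
      by rewrite card_in_imset // => ? ? _ _ [].
    rewrite -cardsUI [X in (_ + X)%N](_ : _ = 0%N) ?addn0.
      apply: eq_card => -[j k]; rewrite !inE /= negb_or.
      apply/idP/idP.
        move=> /and3P[/orP[/eqP->|jA] /andP[ki kA] kj]; last by rewrite jA ki kA kj.
        by apply/orP; right; apply/imsetP; exists k; rewrite ?inE ?kA.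
      case/orP => [/and3P[-> -> ->]|/imsetP[l]]; first by rewrite orbT.
      rewrite !inE => /andP[lA il] [-> ->]; rewrite eqxx lA il /= !andbT.
      by apply: contraTneq il => ->; rewrite ltnn.
    apply/eqP; rewrite cards_eq0; apply/eqP/finset.setP => -[j k]; rewrite !inE /=.
    apply/negbTE/negP => /andP[/and3P[jA _ _] /imsetP[l _ [e _]]].
    by move: iA; rewrite -e jA.
  by rewrite addnAC.
rewrite -signr_odd -[RHS]signr_odd; congr (_ ^+ _); congr nat_of_bool.
have parity (p' h p y k : bool) : p' (+) h = p (+) y -> y (+) p' = p (+) (h (+) k) (+) k.
  by case: p' h p y k => -[] [] [] [].
by rewrite cA !oddD; apply: parity; rewrite -!oddD PP.
Qed.

End Compound.

(** * The Hodge star *)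

Section HodgeStar.
Context {R : realType} {V : normedModType R} {d : nat}.
Implicit Types (w : dform V d) (g : metric R d) (n : vfield R d) (x : 'rV[R]_d).

Lemma interior_prodE n w x S :
  interior_prod n w x S = contr (fun i => n x 0 i) (w x) S.
Proof. by []. Qed.

Lemma posdef_unitmx (h : 'M[R]_d) :
  (forall u : 'rV[R]_d, u != 0 -> 0 < (u *m h *m u^T) 0 0) -> h \in unitmx.
Proof.
move=> pos; rewrite -row_free_unit -kermx_eq0; apply/eqP/row_matrixP => i.
rewrite row0; apply/eqP/negP => /negP /pos.
have /sub_kermxP -> : (row i (kermx h) <= kermx h)%MS by exact: row_sub.
by rewrite mul0mx mxE ltxx.
Qed.

(** [det ((1 - t) + t h)] does not vanish on [0, 1] and is [1] at [t = 0]. *)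
Lemma posdef_det_gt0 (h : 'M[R]_d) :
  (forall u : 'rV[R]_d, u != 0 -> 0 < (u *m h *m u^T) 0 0) -> 0 < \det h.
Proof.
move=> pos.
pose p := \det (\matrix_(i < d, j < d) ((1 - 'X) * ((i == j)%:R)%:P + 'X * (h i j)%:P)).
have pE t : p.[t] = \det ((1 - t)%:M + t *: h).
  rewrite /p -horner_evalE -det_map_mx; congr (\det _).
  apply/matrixP => i j; rewrite !mxE /= horner_evalE hornerD !hornerM !hornerC hornerD hornerN.
  by rewrite hornerX hornerC mulr_natr.
have nz t : 0 <= t <= 1 -> p.[t] != 0.
  move=> /andP[t0 t1]; rewrite pE -unitfE -unitmxE; apply: posdef_unitmx => u u0.
  rewrite mulmxDr mulmxDl mxE mul_mx_scalar -!scalemxAl -scalemxAr -scalemxAl !mxE.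
  have uu : 0 <= \sum_j u 0 j * u^T j 0.
    by rewrite sumr_ge0 // => i _; rewrite mxE -expr2 sqr_ge0.
  have hu := pos u u0; rewrite mxE in hu.
  have uu1 : 0 < \sum_j u 0 j * u^T j 0.
    rewrite lt_neqAle uu andbT eq_sym; apply: contra u0 => /eqP s0.
    apply/eqP/rowP => i; rewrite mxE; apply/eqP.
    have := s0; move/eqP; rewrite psumr_eq0; last first.
      by move=> k _; rewrite mxE -expr2 sqr_ge0.
    by move/allP/(_ i (mem_index_enum i)); rewrite mxE mulf_eq0 orbb.
  have [->|t0'] := eqVneq t 0; first by rewrite subr0 mul1r mul0r addr0.
  by rewrite ltr_wpDl // ?mulr_ge0 ?subr_ge0 // mulr_gt0 // lt_neqAle eq_sym t0'.
have p0 : p.[0] = 1 by rewrite pE subr0 scale0r addr0 det1.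
have p1 : p.[1] = \det h by rewrite pE subrr scale1r raddf0 add0r.
rewrite -p1 ltNge; apply/negP => p1le.
have [|t tI /rootP rt] := @poly_ivt R (- p) 0 1 ler01.
  by rewrite !hornerN p0 oppr_le0 ler01 oppr_ge0.
by move: rt; rewrite hornerN => /eqP; rewrite oppr_eq0 (negbTE (nz t tI)).
Qed.

(** Write [h] for the inverse metric, [a] for [n x] and [U] for [a /\ w].
    The tangential part of the star of [U] vanishes, hence [a /\ star U = 0],
    that is [i_a (Lambda h U) = 0]. This is [Lambda h (i_(a h) U)], so
    [i_(a h) U = 0] by injectivity of [Lambda h]. The inner product of [a] and
    [a h] is positive, so this makes [w] a product of [a] with another form, by
    [contr_wedge]; then [U = 0], and [w = i_a U] because [i_a w = 0]. *)
Lemma hodge_surf_inj g n w x : riemannian g -> enorm2 (n x) = 1 ->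
  (forall S, interior_prod n w x S = 0) -> (forall S, hodge_surf g n w x S = 0) ->
  forall S, w x S = 0.
Proof.
move=> [_ _ gpos] n1 iw sw.
have gu := posdef_unitmx (gpos x).
set h := invmx (g x); pose a i := n x 0 i.
have hu : h \in unitmx by rewrite unitmx_inv.
have aa : \sum_i a i * a i = 1.
  by rewrite -n1; apply: eq_bigr => i _; rewrite expr2.
pose U := wedge a (w x).
pose Y := hodge g (wedge_flat n w) x.
have waY S : wedge a Y S = 0.
  have := contr_wedge a a (wedge a Y) S.
  rewrite aa scale1r => <-; rewrite contr0 ?add0r; last by move=> K; exact: wedge_wedge.
  by apply: wedge0 => K; exact: sw.
have YE T : Y T = (shuffle_sign R (~: T) * Num.sqrt (\det (g x))) *: compound h U (~: T) by [].
have kappa0 : Num.sqrt (\det (g x)) != 0.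
  by rewrite gt_eqF // sqrtr_gt0 (posdef_det_gt0 (gpos x)).
have icU A : contr a (compound h U) A = 0.
  have := waY (~: A); rewrite /wedge => e.
  have : \sum_(i in ~: A) (shuffle_sign R A * (-1) ^+ #|A| * Num.sqrt (\det (g x))) *:
      ((insert_sign R i A * a i) *: compound h U (i |: A)) = 0.
    rewrite -[RHS]e; apply: eq_bigr => i iA; rewrite YE.
    have -> : ~: ((~: A) :\ i) = i |: A by apply/finset.setP => k; rewrite !inE negb_and !negbK.
    rewrite !scalerA; congr (_ *: _); rewrite finset.in_setC in iA.
    have e1 := shuffle_sign_setU1 (R := R) iA.
    transitivity ((insert_sign R i (~: A) * shuffle_sign R (i |: A)) *
      (a i * Num.sqrt (\det (g x)))); [rewrite e1; ring|ring].
  rewrite -scaler_sumr => /eqP; rewrite scaler_eq0 !mulf_eq0 /shuffle_sign !signr_eq0.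
  by rewrite (negbTE kappa0) /= => /eqP.
have ahU S : contr (fun j => \sum_i a i * h i j) U S = 0.
  by apply: (compound_inj hu) => A; rewrite -contr_compound.
set b := (fun j => _) in ahU.
have c0 : \sum_i b i * a i != 0.
  pose u := n x *m h.
  have u0 : u != 0.
    apply/eqP => u0; have : n x = 0 by rewrite -[n x](mulmxK hu) -/u u0 mul0mx.
    move=> nx0; move: n1; rewrite /enorm2 nx0 big1 ?oner_neq0; last first.
      by move=> i _; rewrite mxE expr0n.
    by move/esym/eqP; rewrite oner_eq0.
  have uE : (u *m g x *m u^T) 0 0 = \sum_i b i * a i.
    rewrite [u *m g x]mulmxKV // mxE; apply: eq_bigr => i _.
    by rewrite mxE mulrC /u /b mxE.
  by rewrite -uE gt_eqF // gpos.
have U0 S : U S = 0.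
  have e := contr_wedge b a (w x).
  have wX K : (\sum_i b i * a i) *: (w x K) = wedge a (contr b (w x)) K.
    by rewrite -e ahU add0r.
  have : (\sum_i b i * a i) *: U S = 0.
    rewrite /U /wedge scaler_sumr.
    rewrite -[RHS](wedge_wedge a (contr b (w x)) S); apply: eq_bigr => i _.
    by rewrite -wX !scalerA mulrC.
  by move/eqP; rewrite scaler_eq0 (negbTE c0) => /eqP.
move=> S; have := contr_wedge a a (w x) S; rewrite aa scale1r => <-.
rewrite contr0; last exact: U0.
by rewrite add0r wedge0 // => K; exact: iw.
Qed.

Lemma smooth_minor (h : 'rV[R]_d -> 'M[R]_d) (B : set 'rV[R]_d) A S : open B ->
  (forall i j, smooth_on B (fun x => h x i j)) -> smooth_on B (fun x => minor (h x) A S).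
Proof.
move=> oB sh; apply: smooth_det => // i j.
by apply: (smooth_eq oB _ (sh (enum_val i) (nth (enum_val i) (enum S) j))) => x _; rewrite mxE.
Qed.

(** Cramer's rule. *)
Lemma smooth_invmx (h : 'rV[R]_d -> 'M[R]_d) (B : set 'rV[R]_d) i j : open B ->
  (forall x, B x -> \det (h x) != 0) ->
  (forall i j, smooth_on B (fun x => h x i j)) -> smooth_on B (fun x => invmx (h x) i j).
Proof.
move=> oB d0 sh.
have sadj : smooth_on B (fun x => (\det (h x))^-1 * cofactor (h x) j i).
  apply: smoothM => //; first by apply: smooth_inv => //; exact: smooth_det.
  apply: smoothM => //; first exact: smooth_cst.
  apply: smooth_det => // k l.
  by apply: (smooth_eq oB _ (sh (lift j k) (lift i l))) => x _; rewrite !mxE.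
apply: (smooth_eq oB _ sadj) => x Bx.
by rewrite /invmx unitmxE unitfE d0 // !mxE.
Qed.

Lemma hodge_multiplier g (B : set 'rV[R]_d) : open B -> riemannian g ->
  multiplier B (hodge (V := V) g).
Proof.
move=> oB [gs gsym gpos].
have gsB i j : smooth_on B (fun x => g x i j) by apply: smooth_sub (gs i j).
have gd x : 0 < \det (g x) by exact: posdef_det_gt0 (gpos x).
apply: (@multiplier_sum _ _ _ _ _ ({set 'I_d} : finType) (fun T S => #|S| == #|~: T|) (fun T S => S)
  (fun T S x => (shuffle_sign R (~: T) * Num.sqrt (\det (g x))) *
       minor (invmx (g x)) (~: T) S)) => // [T S _|w x T].
  apply: smoothM => //; first apply: smoothM => //; first exact: smooth_cst.
    by apply: smooth_sqrt => //; exact: (smooth_det oB gsB).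
  apply: smooth_minor => // i j; apply: smooth_invmx => // x _.
  by rewrite gt_eqF.
by rewrite /hodge scaler_sumr; apply: eq_bigr => S _; rewrite scalerA.
Qed.

Lemma hodge_surf_multiplier g n (B : set 'rV[R]_d) : open B -> riemannian g ->
  smooth_on B n -> multiplier B (hodge_surf (V := V) g n).
Proof.
move=> oB rg sn.
apply: (multiplier_comp (Op1 := interior_prod n)
  (Op2 := fun w => wedge_flat n (hodge g (wedge_flat n w)))) => //.
  exact: interior_multiplier.
apply: (multiplier_comp (Op1 := wedge_flat n)
  (Op2 := fun w => hodge g (wedge_flat n w))) => //.
  exact: wedge_multiplier.
apply: (multiplier_comp (Op1 := hodge g) (Op2 := wedge_flat n)) => //.
  exact: hodge_multiplier.
exact: wedge_multiplier.
Qed.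

(** By [contr_wedge], [i_v d Z = sum_k (v_k d_k Z - dx^k /\ i_v d_k Z)] at a
    zero of [Z], and [i_v d_k Z = d_k (i_v Z)] there. *)
Lemma contract_ext_deriv (v : vfield R d) (Z : dform V d) (B : set 'rV[R]_d) x S :
  open B -> B x -> smooth_on B v -> (forall K, smooth_on B (fun y => Z y K)) ->
  (forall K, Z x K = 0) -> (forall y K, B y -> interior_prod v Z y K = 0) ->
  interior_prod v (ext_deriv Z) x S = \sum_i v x 0 i *: partial i (fun y => Z y S) x.
Proof.
move=> oB Bx sv sZ Z0 ivZ.
pose A k K := partial k (fun y => Z y K) x.
have ivA k K : contr (fun i => v x 0 i) (A k) K = 0.
  have : partial k (fun y => interior_prod v Z y K) x = 0.
    rewrite -(derive_cst (0 : V) x (delta_mx 0 k)); apply: near_eq_derive.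
    by near=> y; rewrite ivZ //; near: y; exact: open_nbhs_nbhs.
  rewrite /partial /interior_prod.
  have dv i : differentiable (fun y => insert_sign R i K * v y 0 i) x.
    apply: smooth_diff Bx; apply: smoothM => //; first exact: smooth_cst.
    exact: smooth_coord.
  have dZ J : differentiable (fun y => Z y J) x by exact: smooth_diff (sZ J) Bx.
  rewrite (derivative_sum _ (F := fun i y => (insert_sign R i K * v y 0 i) *: Z y (i |: K))
    _ (fun i _ => (diff_scalef (dv i) (dZ (i |: K))).1)).2 => e.
  rewrite -[RHS]e; apply: eq_bigr => i _.
  by rewrite (diff_scalef (dv i) (dZ (i |: K))).2 Z0 scaler0 add0r.
have dE T : ext_deriv Z x T = \sum_k wedge (fun i => (i == k)%:R) (A k) T.
  rewrite exchange_big /= /ext_deriv; apply: eq_bigr => i iT.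
  rewrite (bigD1 i) //= eqxx mulr1 big1 ?addr0 // => k ki.
  by rewrite eq_sym (negbTE ki) mulr0 scale0r.
rewrite interior_prodE /contr; under eq_bigr do rewrite dE scaler_sumr.
rewrite exchange_big /=; apply: eq_bigr => k _.
have := contr_wedge (fun i => v x 0 i) (fun i => (i == k)%:R) (A k) S.
rewrite [X in _ + X]wedge0 ?addr0; last by move=> K; exact: ivA.
rewrite /contr => ->; congr (_ *: _); rewrite (bigD1 k) //= eqxx mulr1 big1 ?addr0 //.
by move=> i ik; rewrite (negbTE ik) mulr0.
Unshelve. all: by end_near. Qed.

End HodgeStar.

(** * Flows *)

Section Flows.
Context {R : realType} {d : nat}.
Implicit Types (v : vfield R d) (x y a b : 'rV[R]_d).

Lemma enorm2_ge0 x : 0 <= enorm2 x.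
Proof. by apply: sumr_ge0 => i _; exact: sqr_ge0. Qed.

Lemma coord_le_norm x i : `|x 0 i| <= `|x|.
Proof. by rewrite [leRHS]mx_normrE; exact: (le_bigmax _ (fun ij => `|x ij.1 ij.2|) (ord0, i)). Qed.

Lemma norm_sqr_le_enorm2 x : `|x| ^+ 2 <= enorm2 x.
Proof.
have h : `|x| <= Num.sqrt (enorm2 x).
  rewrite [leLHS]mx_normrE; apply: bigmax_le => [|[i j] _]; first exact: sqrtr_ge0.
  rewrite -sqrtr_sqr ler_sqrt ?enorm2_ge0 // ord1 /enorm2 (bigD1 j) //= lerDl.
  by apply: sumr_ge0 => k _; exact: sqr_ge0.
have := ler_pM (normr_ge0 x) (normr_ge0 x) h h.
by rewrite -expr2 -[X in _ <= X -> _]expr2 sqr_sqrtr ?enorm2_ge0.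
Qed.

Lemma enorm2_le_norm x : enorm2 x <= d%:R * `|x| ^+ 2.
Proof.
rewrite /enorm2 mulr_natl -[X in _ *+ X]card_ord -sumr_const; apply: ler_sum => i _.
by rewrite -[x 0 i ^+ 2]real_normK ?num_real // ler_pXn2r ?nnegrE // coord_le_norm.
Qed.

(** The derivatives are bounded on the support by compactness, and vanish
    outside. *)
Lemma velocity_lipschitz (B : set 'rV[R]_d) v : velocity_field B v ->
  exists2 C, 0 <= C & forall a b, `|v a - v b| <= C * `|a - b|.
Proof.
move=> [sv [K [cK _ vK]]].
have dv x : differentiable v x by exact: smooth_diff sv I.
have bnd k : exists2 M, 0 <= M & forall x, `|'D_(delta_mx 0 k) v x| <= M.
  pose f x := `|'D_(delta_mx 0 k) v x|.
  have outK x : ~ K x -> 'D_(delta_mx 0 k) v x = 0.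
    move=> Kx; rewrite -(derive_cst (0 : 'rV[R]_d) x (delta_mx 0 k)); apply: near_eq_derive.
    have oK : open (~` K) by apply: closed_openC; exact: compact_closed (@norm_hausdorff _ _) _.
    have : nbhs x (~` K) by exact: open_nbhs_nbhs.
    by apply: filterS => y Ky; rewrite vK.
  have [[x0 Kx0]|K0] := pselect (K !=set0); last first.
    exists 0 => // x; rewrite outK ?normr0 // => Kx; apply: K0; by exists x.
  have cf : {within K, continuous f}.
    apply: continuous_subspaceT => x.
    have dd : differentiable ('D_(delta_mx 0 k) v) x.
      exact: smooth_diff (smooth_derive _ sv) I.
    exact: (cvg_norm (differentiable_continuous dd)).
  have [c Kc cmax] := compact_EVT_max (ex_intro _ x0 Kx0) cK cf.
  exists (f c) => [|x]; first exact: normr_ge0.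
  have [Kx|Kx] := pselect (K x); first by apply: cmax; rewrite inE.
  by rewrite outK // normr0 normr_ge0.
have [M M0 hM] : exists2 M, 0 <= M & forall k x, `|'D_(delta_mx 0 k) v x| <= M.
  have h k : {M | 0 <= M /\ forall x, `|'D_(delta_mx 0 k) v x| <= M}.
    by apply: cid; have [M ? ?] := bnd k; exists M.
  exists (\sum_k sval (h k)).
    by apply: sumr_ge0 => k _; case: (svalP (h k)).
  move=> k x; apply: (le_trans ((svalP (h k)).2 x)); rewrite (bigD1 k) //= lerDl.
  by apply: sumr_ge0 => l _; case: (svalP (h l)).
exists (d%:R * M); first by rewrite mulr_ge0.
move=> a b.
have dphi (t : R) : 0 <= t <= 1 ->
    is_derive t 1 (fun s : R => v (s *: (a - b) + b)) ('D_(a - b) v (t *: (a - b) + b)).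
  by move=> _; apply: is_derive_line; exact: dv.
have := mean_value_ineq (M := d%:R * M * `|a - b|) ler01 dphi.
rewrite scale1r scale0r subrK add0r subr0 mulr1; apply => t _.
rewrite deriveE // [X in 'd _ _ X]row_sum_delta linear_sum /=.
apply: le_trans (ler_norm_sum _ _ _) _.
rewrite -mulrA mulr_natl -[X in _ *+ X]card_ord -sumr_const; apply: ler_sum => i _.
rewrite linearZ normrZ mulrC /= -deriveE //.
by apply: ler_pM => //; exact: coord_le_norm.
Qed.

Lemma gronwall (q dq : R -> R) (L : R) : (forall s : R, is_derive s 1 q (dq s)) ->
  (forall s, 0 <= q s) -> (forall s, `|dq s| <= L * q s) ->
  forall s, q s <= expR (L * `|s|) * q 0.
Proof.
suff key (q' dq' : R -> R) : (forall s : R, is_derive s 1 q' (dq' s)) ->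
    (forall s, `|dq' s| <= L * q' s) -> forall s, 0 <= s -> q' s <= expR (L * s) * q' 0.
  move=> dq_ q0 dqL s; have [s0|s0] := leP 0 s; first by rewrite ger0_norm //; exact: (key q dq).
  rewrite ltr0_norm //.
  have := key (fun s => q (- s)) (fun s => - dq (- s)) _ _ (- s) _.
  rewrite opprK oppr0; apply.
  - move=> t; have dN : is_derive t 1 (-%R : R -> R) (- 1) by exact: is_deriveNid.
    have := @is_derive1_comp R q -%R t _ _ (dq_ (- t)) dN.
    by rewrite [X in is_derive _ _ _ X](_ : _ = - dq (- t)) //; rewrite /GRing.scale /=; ring.
  - by move=> t; rewrite normrN.
  - by rewrite oppr_ge0 ltW.
move=> dq_ dqL s s0.
pose u (t : R) := expR (- L * t) * q' t.
have du (t : R) : is_derive t 1 u (expR (- L * t) * (dq' t - L * q' t)).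
  have dl : is_derive t 1 (fun t => - L * t : R) (- L).
    have h : is_derive t 1 ((- L) \*: (id : R -> R)) ((- L) *: 1) by exact: is_deriveZ.
    by rewrite [X in is_derive _ _ _ X](_ : _ = (- L) *: 1) // /GRing.scale /= mulr1.
  have de := @is_derive1_comp R expR (fun t => - L * t) t _ _ (is_derive_expR _) dl.
  have h := @is_deriveM R R (expR \o (fun t => - L * t)) q' t 1 _ _ de (dq_ t).
  rewrite [X in is_derive _ _ _ X](_ : _ = (expR \o (fun t => - L * t)) t *: dq' t +
     q' t *: (expR (- L * t) *: - L)) //.
  rewrite /GRing.scale /=; ring.
have us : u s <= u 0.
  have [c _ uc] := MVT_segment s0 (fun t _ => du t)
    (derivable_within_continuous (fun t _ => ex_derive (is_derive := du t))).
  rewrite -subr_le0 uc subr0 mulr_le0_ge0 // mulr_ge0_le0 ?expR_ge0 // subr_le0.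
  by apply: le_trans (dqL c); exact: ler_norm.
move: us; rewrite /u mulr0 expR0 mul1r mulNr expRN => h.
by rewrite mulrC -ler_pdivrMr ?expR_gt0 // mulrC.
Qed.

End Flows.

(** * Perturbed domains *)

Section ComposedFlows.
Context {R : realType} {d : nat}.
Implicit Types (v : vfield R d) (x y : 'rV[R]_d).

(** Gronwall's inequality for the squared Euclidean distance, which is
    differentiable, unlike the sup norm. *)
Lemma solutions_close (B : set 'rV[R]_d) v : velocity_field B v -> exists L : R,
  forall a b : R -> 'rV[R]_d,
    (forall s : R, is_derive s 1 a (v (a s))) -> (forall s : R, is_derive s 1 b (v (b s))) ->
    forall s, enorm2 (a s - b s) <= expR (L * `|s|) * enorm2 (a 0 - b 0).
Proof.
move=> vB; have [C C0 lip] := velocity_lipschitz vB.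
(* Each of the [d] coordinates contributes at most [C] times the squared norm. *)
exists (2 * d%:R * C) => a b da db.
pose c : R -> 'rV[R]_d := fun s => a s - b s.
pose dc : R -> 'rV[R]_d := fun s => v (a s) - v (b s).
have dcs (s : R) : is_derive s 1 c (dc s) by exact: is_deriveB.
have dci i (s : R) : is_derive s 1 (fun s => c s 0 i : R) (dc s 0 i).
  have dif : differentiable c s by apply/derivable1_diffP; exact: ex_derive.
  apply: DeriveDef; first exact/derivable1_diffP/differentiable_coordf.
  by rewrite (coord_derive _ _ dif) derive_val.
pose dq s := \sum_i 2 * (c s 0 i * dc s 0 i).
apply: (@gronwall R (fun s => enorm2 (c s)) dq) => [s|s|s]; last 1 first.
- have bnd : `|\sum_i c s 0 i * dc s 0 i| <= d%:R * (C * `|c s| ^+ 2).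
    apply: le_trans (ler_norm_sum _ _ _) _.
    rewrite mulr_natl -[X in _ *+ X]card_ord -sumr_const; apply: ler_sum => i _.
    rewrite normrM expr2 mulrCA; apply: ler_pM => //; first exact: coord_le_norm.
    by apply: le_trans (coord_le_norm _ _) _; exact: lip.
  rewrite /dq -mulr_sumr normrM ger0_norm // -!mulrA ler_wpM2l //.
  apply: le_trans bnd _; rewrite ler_wpM2l // ler_wpM2l //.
  exact: norm_sqr_le_enorm2.
- have dif i : differentiable (fun s => c s 0 i : R) s.
    by apply/derivable1_diffP; exact: ex_derive.
  have E : (fun s => enorm2 (c s)) = (fun s => \sum_i (c s 0 i : R) *: (c s 0 i : R)).
    by apply/funext => z; apply: eq_bigr => i _; rewrite expr2.
  have [ds es] := @derivative_sum R R R 'I_d (index_enum 'I_d) predT _ 1 s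
     (fun i _ => (diff_scalef (dif i) (dif i)).1).
  rewrite E; apply: DeriveDef; first exact/derivable1_diffP.
  rewrite [LHS]es; apply: eq_bigr => i _; rewrite (diff_scalef (dif i) (dif i)).2.
  rewrite (derive_val (is_derive := dci i s)) /GRing.scale /=; ring.
- exact: enorm2_ge0.
Qed.

(** The constant curve is another solution with the same initial value. *)
Lemma flow_fixpoint (B : set 'rV[R]_d) v T x : velocity_field B v -> is_flow v T ->
  v x = 0 -> forall s, T s x = x.
Proof.
move=> vB [T0 _ dT] vx0 s; have [L hL] := solutions_close vB.
have db (t : R) : is_derive t 1 (fun=> x) (v x) by rewrite vx0; exact: is_derive_cst.
have h := hL (fun s => T s x) (fun=> x) (fun s => dT s x) db s.
rewrite T0 subrr in h; have z : enorm2 (0 : 'rV[R]_d) = 0.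
  by rewrite /enorm2 big1 // => i _; rewrite mxE expr0n.
rewrite z mulr0 in h.
apply/eqP; rewrite -subr_eq0 -normr_eq0.
have : `|T s x - x| ^+ 2 == 0.
  by rewrite eq_le exprn_ge0 // andbT (le_trans (norm_sqr_le_enorm2 _)).
by rewrite expf_eq0.
Qed.

Lemma flow_continuous (B : set 'rV[R]_d) v T s : velocity_field B v -> is_flow v T ->
  continuous (T s).
Proof.
move=> vB [T0 _ dT] x; have [L hL] := solutions_close vB.
suff near_le e : 0 < e -> \forall y \near x, `|T s x - T s y| < e.
  exact: (proj2 (cvgrPdist_lt (T s) (T s x)) near_le).
move=> e0; pose k := expR (L * `|s|) * d%:R + 1.
have k0 : 0 < k by rewrite ltr_wpDl // mulr_ge0 // expR_ge0.
have d0 : 0 < Num.min 1 (e ^+ 2 / k).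
  by rewrite lt_min ltr01 divr_gt0 // exprn_gt0.
apply/nbhs_ballP; exists (Num.min 1 (e ^+ 2 / k)) => //= y.
rewrite -ball_normE /= lt_min => /andP[xy1 xyk].
have h := hL _ _ (fun s => dT s x) (fun s => dT s y) s; rewrite !T0 in h.
rewrite -(ltr_pXn2r (n := 2)) ?nnegrE ?(ltW e0) //.
apply: le_lt_trans (norm_sqr_le_enorm2 _) _; apply: le_lt_trans h _.
apply: le_lt_trans (_ : k * `|x - y| < _); last by rewrite mulrC -ltr_pdivlMr.
apply: (@le_trans _ _ (expR (L * `|s|) * d%:R * `|x - y| ^+ 2)).
  by rewrite -mulrA ler_wpM2l ?expR_ge0 // enorm2_le_norm.
have k1 : 0 <= expR (L * `|s|) * d%:R by rewrite mulr_ge0 // expR_ge0.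
have k2 : expR (L * `|s|) * d%:R <= k by rewrite /k lerDl.
have k3 : `|x - y| ^+ 2 <= `|x - y| by rewrite expr2 ler_piMr // ltW.
exact: ler_pM k1 (sqr_ge0 _) k2 k3.
Qed.

Definition homeo (f : 'rV[R]_d -> 'rV[R]_d) : Prop :=
  continuous f /\ exists g, [/\ continuous g, cancel f g & cancel g f].

Lemma homeo_open f (A : set 'rV[R]_d) : homeo f -> open A -> open (f @` A).
Proof.
move=> [_ [g [cg fg gf]]] oA.
have -> : f @` A = g @^-1` A.
  apply/seteqP; split=> [y [x Ax <-]|y Agy] /=; first by rewrite fg.
  by exists (g y).
by apply: open_comp => // x _; exact: cg.
Qed.

Lemma homeo_closure f (A : set 'rV[R]_d) x : homeo f -> closure A x ->
  closure (f @` A) (f x).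
Proof.
move=> [cf _] clA U fU; have [y [Ay Uy]] := clA _ (cf x _ fU).
by exists (f y); split => //; exists y.
Qed.

Context {B : set 'rV[R]_d} {v : nat -> vfield R d} {T : nat -> R -> 'rV[R]_d -> 'rV[R]_d}.
Hypothesis v_velocity : forall j, velocity_field B (v j).
Hypothesis T_flow : forall j, is_flow (v j) (T j).

Lemma flow_homeo j s : homeo (T j s).
Proof.
split; first exact: flow_continuous (v_velocity j) (T_flow j).
exists (T j (- s)); split; first exact: flow_continuous (v_velocity j) (T_flow j).
  by case: (T_flow j) => T0 TD _ x; rewrite -TD addNr T0.
by case: (T_flow j) => T0 TD _ x; rewrite -TD addrN T0.
Qed.

Lemma comp_flows_homeo N (t : 'rV[R]_N) : homeo (comp_flows T t).
Proof.
rewrite /comp_flows; elim: (enum 'I_N) => [|i l [cf [g [cg fg gf]]]] /=.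
  by split; [move=> x; exact: cvg_id|exists id; split=> // x; exact: cvg_id].
have [ch [k [ck hk kh]]] := flow_homeo i (t 0 i).
split; first by move=> x; apply: continuous_comp; [exact: cf|exact: ch].
exists (g \o k); split.
- by move=> x; apply: continuous_comp; [exact: ck|exact: cg].
- by move=> x /=; rewrite hk fg.
- by move=> x /=; rewrite gf kh.
Qed.

Lemma comp_flows0 N x : comp_flows T (0 : 'rV[R]_N) x = x.
Proof.
rewrite /comp_flows; elim: (enum 'I_N) => //= i l ->.
by rewrite mxE; case: (T_flow i).
Qed.

Lemma comp_flows_fix N (t : 'rV[R]_N) x : (forall j, v j x = 0) -> comp_flows T t x = x.
Proof.
move=> v0; rewrite /comp_flows; elim: (enum 'I_N) => //= i l ->.
exact: (flow_fixpoint (v_velocity i)).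
Qed.

(** Directions are numbered by [nat], as flows and velocity fields are. *)
Definition ev N j : 'rV[R]_N := \row_i (i == j :> nat)%:R.

Definition zero_below N j (t : 'rV[R]_N) := forall i : 'I_N, (i < j)%N -> t 0 i = 0.

Lemma zero_below_shift N j (t : 'rV[R]_N) h k : (j <= k)%N -> zero_below j t ->
  zero_below j (h *: ev N k + t).
Proof.
move=> jk zt i ij; rewrite !mxE zt // addr0 (_ : (i == k :> nat) = false) ?mulr0 //.
by apply/negbTE; rewrite neq_ltn (leq_trans ij).
Qed.

(** Flows with index below [j] are run for time 0, hence [T j] is the outermost
    one and its times add up. *)
Lemma comp_flows_shift N j (t : 'rV[R]_N) h x : (j < N)%N -> zero_below j t ->
  T j h (comp_flows T t x) = comp_flows T (h *: ev N j + t) x.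
Proof.
move=> jN zt; pose jo := Ordinal jN.
have : jo \in enum 'I_N by rewrite mem_enum.
have := sorted_enum_ord [set: 'I_N]%SET.
rewrite (_ : enum [set: 'I_N]%SET = enum 'I_N); last first.
  by apply: eq_enum => i; rewrite inE.
rewrite /comp_flows; elim: (enum 'I_N) => //= i l IH srt.
have := order_path_min ltn_trans srt => /allP lt.
rewrite inE; have [ej _|ji] := eqVneq jo i; first rewrite -{}ej in lt *.
  have -> : foldr (fun (i : 'I_N) y => T i ((h *: ev N j + t) 0 i) y) x l =
      foldr (fun (i : 'I_N) y => T i (t 0 i) y) x l.
    have : all (fun k : 'I_N => k != j :> nat) l.
      apply/allP => k kl; rewrite gtn_eqF //; exact: lt (map_f val kl).
    elim: l {IH srt lt} => //= k l IH /andP[kj /IH ->].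
    by rewrite !mxE (negbTE kj) mulr0 add0r.
  by rewrite !mxE /= eqxx mulr1; case: (T_flow j) => _ -> _.
move=> /= jl; have ij : (i < j)%N by exact: lt (map_f val jl).
have z1 : T i 0 =1 id by case: (T_flow i).
rewrite zt // !mxE zt // addr0 (_ : (i == j :> nat) = false) ?mulr0; last by rewrite ltn_eqF.
by rewrite !z1 IH //; exact: path_sorted srt.
Qed.

Lemma image_comp_flows_shift N j (t : 'rV[R]_N) h (D : set 'rV[R]_d) :
  (j < N)%N -> zero_below j t ->
  T j h @` (comp_flows T t @` D) = comp_flows T (h *: ev N j + t) @` D.
Proof.
move=> jN zt; rewrite image_comp; congr (_ @` _).
by apply/funext => x /=; exact: comp_flows_shift h x jN zt.
Qed.

Lemma shape_derivE (W : normedModType R) (q : set 'rV[R]_d -> W) N j (t : 'rV[R]_N)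
    (D : set 'rV[R]_d) : (j < N)%N -> zero_below j t ->
  shape_deriv (T j) q (comp_flows T t @` D) =
  'D_(ev N j) (fun s => q (comp_flows T s @` D)) t.
Proof.
move=> jN zt; rewrite /shape_deriv /derive1 /derive.
suff -> : (fun h : R => h^-1 *: (q (T j (h + 0) @` (comp_flows T t @` D)) -
      q (T j 0 @` (comp_flows T t @` D)))) =
    (fun h : R => h^-1 *: (((fun s => q (comp_flows T s @` D)) \o shift t) (h *: ev N j) -
      q (comp_flows T t @` D))) by [].
apply/funext => h; rewrite addr0 /= !image_comp_flows_shift //.
by rewrite scale0r add0r.
Qed.

(** Pull [x] back by the flow, which is continuous in time. *)
Lemma near_in_shifted N j (t : 'rV[R]_N) (D : set 'rV[R]_d) x :
  (j < N)%N -> zero_below j t -> open D -> (comp_flows T t @` D) x ->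
  \forall h \near (0 : R), (comp_flows T (h *: ev N j + t) @` D) x.
Proof.
move=> jN zt oD Dx.
have oDt := homeo_open (comp_flows_homeo t) oD.
case: (T_flow j) => T0 TD dT.
have c0 : (fun h => T j (- h) x) @ (0 : R) --> x.
  have c : {for 0, continuous (fun h => T j h x)}.
    apply: differentiable_continuous; apply/derivable1_diffP.
    exact: (ex_derive (is_derive := dT 0 x)).
  have n0 : (fun h : R => - h) @ (0 : R) --> (0 : R).
    by rewrite -[X in _ --> X]oppr0; apply: cvgN; exact: cvg_id.
  have := cvg_comp _ _ n0 c; rewrite T0; exact.
have : \forall h \near (0 : R), (comp_flows T t @` D) (T j (- h) x).
  by apply: c0; exact: open_nbhs_nbhs.
apply: filterS => h hx; rewrite -image_comp_flows_shift //.
by exists (T j (- h) x) => //; rewrite -TD addrN T0.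
Qed.

End ComposedFlows.

(** * Iterated shape derivatives *)

Section IteratedDerivatives.
Context {R : realType} {V : normedModType R} {N d : nat}.
Local Notation pt := ('rV[R]_N * 'rV[R]_d)%type.
Local Notation e_ := (ev (R := R) N).

Definition dts (J : seq nat) (W : 'rV[R]_N -> dform V d) : 'rV[R]_N -> dform V d :=
  foldl (fun U j => dt (e_ j) U) W J.

Definition dtvs (J : seq nat) (n : 'rV[R]_N -> vfield R d) : 'rV[R]_N -> vfield R d :=
  foldl (fun m j => dtv (e_ j) m) n J.

Lemma dts_rcons J j W : dts (rcons J j) W = dt (e_ j) (dts J W).
Proof. by rewrite /dts foldl_rcons. Qed.

Lemma dtvs_rcons J j n : dtvs (rcons J j) n = dtv (e_ j) (dtvs J n).
Proof. by rewrite /dtvs foldl_rcons. Qed.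

Variables (O : set pt) (oO : open O).

Lemma smooth_dts J W : smooth_fam O W -> smooth_fam O (dts J W).
Proof.
move=> sW; elim/last_ind: J => // J j IH; rewrite dts_rcons; exact: smooth_dt.
Qed.

Lemma smooth_dtvs J n : smooth_on O (fun p => n p.1 p.2) ->
  smooth_on O (fun p => dtvs J n p.1 p.2).
Proof.
move=> sn; elim/last_ind: J => // J j IH; rewrite dtvs_rcons; exact: smooth_dtv.
Qed.

Lemma near_line (e t : 'rV[R]_N) x : O (t, x) ->
  \forall h \near (0 : R), O (h *: e + t, x).
Proof.
move=> Otx.
have c : {for 0, continuous (fun h : R => (h *: e + t, x))}.
  apply: differentiable_continuous; apply: differentiable_pair; last exact: differentiable_cst.
  by apply: (@differentiableD _ _ _ (fun h : R => h *: e) (fun=> t)).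
apply: (c O); rewrite scale0r add0r; exact: open_nbhs_nbhs.
Qed.

Lemma dt_eq e (W W' : 'rV[R]_N -> dform V d) t x S :
  (forall s y K, O (s, y) -> W s y K = W' s y K) -> O (t, x) ->
  dt e W t x S = dt e W' t x S.
Proof.
move=> WW Otx; apply: derive_line_ext; apply: filterS (near_line e Otx) => h.
exact: WW.
Qed.

Lemma dts_ext J W t x S : smooth_fam O W -> O (t, x) ->
  dts J (fun t => ext_deriv (W t)) t x S = ext_deriv (dts J W t) x S.
Proof.
move=> sW; elim/last_ind: J t x S => // J j IH t x S Otx; rewrite !dts_rcons.
by rewrite (dt_eq _ _ (fun s y K => IH s y K)) // (dt_ext oO) //; exact: smooth_dts.
Qed.

Lemma dts_multiplier J B Op W t x S : multiplier B Op ->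
  smooth_fam O W -> O (t, x) ->
  dts J (fun t => Op (W t)) t x S = Op (dts J W t) x S.
Proof.
move=> mOp sW; elim/last_ind: J t x S => // J j IH t x S Otx; rewrite !dts_rcons.
rewrite (dt_eq _ _ (fun s y K => IH s y K)) // (dt_multiplier _ _ mOp _ Otx) //.
exact: smooth_dts.
Qed.

Lemma dtsD J W W' t x S : smooth_fam O W -> smooth_fam O W' -> O (t, x) ->
  dts J (fun t x S => W t x S + W' t x S) t x S = dts J W t x S + dts J W' t x S.
Proof.
move=> sW sW'; elim/last_ind: J t x S => // J j IH t x S Otx; rewrite !dts_rcons.
rewrite (dt_eq _ _ (fun s y K => IH s y K)) // !dtE.
by apply: deriveD; apply: diff_derivable; apply: smooth_diff Otx; exact: smooth_dts.
Qed.

End IteratedDerivatives.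

Section IteratedShapeDerivatives.
Context {R : realType} {V : normedModType R} {N d : nat}.
Local Notation pt := ('rV[R]_N * 'rV[R]_d)%type.
Context {B : set 'rV[R]_d} {v : nat -> vfield R d} {T : nat -> R -> 'rV[R]_d -> 'rV[R]_d}.
Hypothesis v_velocity : forall j, velocity_field B (v j).
Hypothesis T_flow : forall j, is_flow (v j) (T j).
Variable D : set 'rV[R]_d.
Local Notation Dt t := (comp_flows T t @` D).

Lemma image_comp_flows0 A : comp_flows T (0 : 'rV[R]_N) @` A = A.
Proof.
apply/seteqP; split=> [y [x Ax <-]|x Ax]; first by rewrite (comp_flows0 T_flow).
by exists x => //; rewrite (comp_flows0 T_flow).
Qed.

Lemma sorted_rcons_last (J : seq nat) j : sorted ltn (rcons J j) ->
  sorted ltn J /\ (last 0%N J <= j)%N.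
Proof.
case: J => [//|i J] /=; rewrite rcons_path => /andP[-> /ltnW]; by split.
Qed.

Lemma shape_derivs_vecE (n : set 'rV[R]_d -> vfield R d) J (t : 'rV[R]_N) x :
  sorted ltn J -> all (fun j => j < N)%N J -> zero_below (last 0%N J) t ->
  shape_derivs_vec T J n (Dt t) x = dtvs J (fun s => n (Dt s)) t x.
Proof.
elim/last_ind: J t x => // J j IH t x /sorted_rcons_last[srt lj].
rewrite all_rcons last_rcons => /andP[jN JN] zt.
rewrite /shape_derivs_vec foldl_rcons -/(shape_derivs_vec T J n) dtvs_rcons.
apply: (etrans (shape_derivE T_flow (fun D' => shape_derivs_vec T J n D' x) D jN zt)).
rewrite [RHS]/dtv.
have line (h : R) : shape_derivs_vec T J n (Dt (h *: ev N j + t)) x =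
    dtvs J (fun s => n (Dt s)) (h *: ev N j + t) x.
  apply: IH => //; apply: zero_below_shift => // i ij; apply: zt; exact: leq_trans lj.
have line0 := line 0; rewrite scale0r add0r in line0.
suff E : (fun h : R => h^-1 *: (((fun s => shape_derivs_vec T J n (Dt s) x) \o shift t)
       (h *: ev N j) - shape_derivs_vec T J n (Dt t) x)) =
    (fun h : R => h^-1 *: (((fun s => dtvs J (fun s => n (Dt s)) s x) \o shift t)
       (h *: ev N j) - dtvs J (fun s => n (Dt s)) t x)) by rewrite /derive E.
by apply/funext => h /=; rewrite line line0.
Qed.

Variables (O : set pt) (oO : open O) (oD : open D).

(** Increasing indices matter: differentiating along flow [j] after smaller
    indices composes the flows in the order of [comp_flows]. The extension [W]
    replaces the field since [x] stays inside the perturbed domains. *)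
Lemma shape_derivs_formE (w : set 'rV[R]_d -> dform V d) (W : 'rV[R]_N -> dform V d)
    J (t : 'rV[R]_N) x S :
  (forall s y, O (s, y) -> Dt s y -> w (Dt s) y = W s y) ->
  sorted ltn J -> all (fun j => j < N)%N J -> zero_below (last 0%N J) t ->
  O (t, x) -> Dt t x ->
  shape_derivs_form T J w (Dt t) x S = dts J W t x S.
Proof.
move=> wW; elim/last_ind: J t x S => [t x S _ _ _ Otx Dx|J j IH t x S].
  by rewrite /shape_derivs_form /= wW.
move=> /sorted_rcons_last[srt lj]; rewrite all_rcons last_rcons => /andP[jN JN] zt Otx Dx.
rewrite /shape_derivs_form foldl_rcons -/(shape_derivs_form T J w) dts_rcons.
apply: (etrans (shape_derivE T_flow (fun D' => shape_derivs_form T J w D' x S) D jN zt)).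
apply: derive_line_ext.
apply: filterS (filterI (near_line oO (ev N j) Otx)
   (near_in_shifted v_velocity T_flow jN zt oD Dx)) => h [Oh Dh].
apply: IH => //; apply: zero_below_shift => // i ij; apply: zt; exact: leq_trans lj.
Qed.

(** Identities at a fixed interior point hold for all small parameters, so
    they may be differentiated in the parameters. *)
Lemma dts_vanish (E : 'rV[R]_N -> dform V d) (U : set 'rV[R]_N) S : open U ->
  (forall t x, U t -> O (t, x) -> Dt t x -> E t x S = 0) ->
  forall M t x, (M <= N)%N -> U t -> zero_below M t -> O (t, x) -> Dt t x ->
    dts (iota 0 M) E t x S = 0.
Proof.
move=> oU E0; elim=> [|M IH] t x MN Ut zt Otx Dx; first exact: E0.
rewrite -addn1 iotaD add0n cats1 dts_rcons.
have ztM : zero_below M t by move=> i iM; apply: zt; exact: ltnW.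
apply: derive_near_cst.
have nU : \forall h \near (0 : R), U (h *: ev N M + t).
  have c : {for 0, continuous (fun h : R => h *: ev N M + t)}.
    apply: differentiable_continuous.
    by apply: (@differentiableD _ _ _ (fun h : R => h *: ev N M) (fun=> t)).
  apply: (c U); rewrite scale0r add0r; exact: open_nbhs_nbhs.
apply: filterS (filterI nU (filterI (near_line oO (ev N M) Otx)
   (near_in_shifted v_velocity T_flow MN ztM oD Dx))) => h [Uh [Oh Dh]].
apply: IH => //; first exact: ltnW.
exact: zero_below_shift.
Qed.

End IteratedShapeDerivatives.

(** * Boundary expressions on the perturbed domains *)

Section BoundaryExpressions.
Context {R : realType} {V : normedModType R} {N d : nat}.
Local Notation pt := ('rV[R]_N * 'rV[R]_d)%type.

(** The value of a boundary expression on the domain perturbed by [t], except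
    that the star keeps the normal [n0] of the unperturbed domain. Then
    [d/dt] acts on fields and contractions only, as the two partial
    derivatives do. *)
Fixpoint peval (g : metric R d) (v : nat -> vfield R d) (n0 : vfield R d)
    (n : 'rV[R]_N -> vfield R d) (phi : dform V d) (W : 'rV[R]_N -> dform V d)
    (e : bexpr) : 'rV[R]_N -> dform V d :=
  match e with
  | BZero => fun _ _ _ => 0
  | BIncident => fun=> phi
  | BField J => dts J W
  | BExt f => fun t => ext_deriv (peval g v n0 n phi W f t)
  | BStar f => fun t => hodge_surf g n0 (peval g v n0 n phi W f t)
  | BContrN J f => fun t => interior_prod (dtvs J n t) (peval g v n0 n phi W f t)
  | BContrV j f => fun t => interior_prod (v j) (peval g v n0 n phi W f t)
  | BAdd f h => fun t x S =>
      peval g v n0 n phi W f t x S + peval g v n0 n phi W h t x S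
  | BOpp f => fun t x S => - peval g v n0 n phi W f t x S
  end.

Fixpoint indices_below (M : nat) (e : bexpr) : bool :=
  match e with
  | BZero | BIncident => true
  | BField J => sorted ltn J && all (fun j => j < M)%N J
  | BExt f | BStar f | BOpp f => indices_below M f
  | BContrN J f => [&& sorted ltn J, all (fun j => j < M)%N J & indices_below M f]
  | BContrV j f => indices_below M f
  | BAdd f h => indices_below M f && indices_below M h
  end.

(** The Neumann trace of the shape derivative minus its claimed value. *)
Definition residual (M : nat) : bexpr :=
  BSub (BStar (BContrN [::] (BExt (BField (iota 0 M))))) (neumann_data M).

Lemma sorted_rcons_below (J : seq nat) M : sorted ltn J -> all (fun j => j < M)%N J ->
  sorted ltn (rcons J M) /\ all (fun j => j < M.+1)%N (rcons J M).
Proof.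
move=> srt JM; split; last first.
  by rewrite all_rcons ltnSn; apply: sub_all JM => j /ltnW.
case: J srt JM => //= j J srt /andP[jM JM]; rewrite rcons_path srt /=.
have : last j J \in j :: J by exact: mem_last.
by rewrite inE => /orP[/eqP -> //|]; apply: (allP JM).
Qed.

Lemma sub_below (J : seq nat) M : all (fun j => j < M)%N J -> all (fun j => j < M.+1)%N J.
Proof. by apply: sub_all => j /ltnW. Qed.

Lemma indices_belowW M e : indices_below M e -> indices_below M.+1 e.
Proof.
elim: e => //=.
- by move=> J /andP[-> /sub_below].
- by move=> J e IH /and3P[-> /sub_below -> /IH].
- by move=> e IH f IHf /andP[/IH -> /IHf].
Qed.

Lemma indices_below_delta M e : indices_below M e ->
  indices_below M.+1 (delta_field M e) && indices_below M.+1 (delta_normal M e).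
Proof.
elim: e => //=.
- by move=> J /andP[srt JM]; have [-> ->] := sorted_rcons_below srt JM.
- move=> J e IH /and3P[srt JM ie]; have [-> ->] := sorted_rcons_below srt JM.
  have /andP[-> ->] := IH ie.
  by rewrite srt (sub_below JM) (indices_belowW ie).
- by move=> e IH f IHf /andP[/IH /andP[-> ->] /IHf /andP[-> ->]].
Qed.

Lemma iota_rcons M : iota 0 M.+1 = rcons (iota 0 M) M.
Proof. by rewrite -addn1 iotaD add0n cats1. Qed.

Lemma indices_below_residual M : indices_below M (residual M) && indices_below M (neumann_data M).
Proof.
elim: M => [//|M /andP[/andP[s IH] _]].
have /andP[s1 s2] : sorted ltn (iota 0 M) && all (fun j => j < M)%N (iota 0 M) by [].
have /andP[d1 d2] := indices_below_delta IH.
have [s1' s2'] := sorted_rcons_below s1 s2.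
by rewrite /residual iota_rcons /= s1' s2' d1 d2 s1 (sub_below s2) (indices_belowW IH) ltnSn.
Qed.

Variables (O : set pt) (Bx : set 'rV[R]_d) (oO : open O) (oBx : open Bx).
Hypothesis OB : forall p, O p -> Bx p.2.
Variables (g : metric R d) (v : nat -> vfield R d) (n0 : vfield R d)
  (n : 'rV[R]_N -> vfield R d) (phi : dform V d) (W : 'rV[R]_N -> dform V d).
Hypothesis g_riem : riemannian g.
Hypothesis v_smooth : forall j, smooth_on Bx (v j).
Hypothesis n0_smooth : smooth_on Bx n0.
Hypothesis n_smooth : smooth_on O (fun p => n p.1 p.2).
Hypothesis phi_smooth : forall S, smooth_on Bx (fun x => phi x S).
Hypothesis W_smooth : smooth_fam O W.
Local Notation pe := (peval g v n0 n phi W).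

Let star_mult : multiplier Bx (hodge_surf (V := V) g n0).
Proof. exact: hodge_surf_multiplier. Qed.

Let contrV_mult j : multiplier Bx (interior_prod (V := V) (v j)).
Proof. exact: interior_multiplier. Qed.

Lemma smooth_peval e : smooth_fam O (pe e).
Proof.
elim: e => /=.
- by move=> S; exact: smooth_cst.
- by move=> S; exact: (smooth_snd oO OB (phi_smooth S)).
- by move=> J; exact: smooth_dts.
- by move=> e IH; exact: smooth_ext.
- by move=> e IH; exact: (smooth_multiplier oO star_mult OB IH).
- by move=> J e IH; apply: smooth_interior => //; exact: smooth_dtvs.
- by move=> j e IH; exact: (smooth_multiplier oO (contrV_mult j) OB IH).
- by move=> e IH f IHf S; exact: (smoothD oO (IH S) (IHf S)).
- by move=> e IH S; exact: (smoothN oO (IH S)).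
Qed.

Lemma slice_diff (F : 'rV[R]_N -> dform V d) t x K : smooth_fam O F -> O (t, x) ->
  differentiable (fun y => F t y K) x.
Proof.
move=> sF Otx.
have sl : smooth_on [set x | O (t, x)] (fun y => F t y K) by exact: (smooth_slice oO (sF K)).
exact: (smooth_diff sl Otx).
Qed.

Lemma multiplierD B Op (w w' : dform V d) x S : multiplier B Op ->
  Op (fun x S => w x S + w' x S) x S = Op w x S + Op w' x S.
Proof.
move=> [A [_ E]]; rewrite !E -big_split /=.
by apply: eq_bigr => K _; rewrite scalerDr.
Qed.

Lemma interiorD (u : vfield R d) (w w' : dform V d) x S :
  interior_prod u (fun x S => w x S + w' x S) x S = interior_prod u w x S + interior_prod u w' x S.
Proof. by rewrite -big_split /=; apply: eq_bigr => K _; rewrite scalerDr. Qed.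

Lemma ext_derivD (w w' : dform V d) x S :
  (forall K, differentiable (fun y => w y K) x) ->
  (forall K, differentiable (fun y => w' y K) x) ->
  ext_deriv (fun x S => w x S + w' x S) x S = ext_deriv w x S + ext_deriv w' x S.
Proof.
move=> dw dw'; rewrite /ext_deriv -big_split /=; apply: eq_bigr => i _.
rewrite -scalerDr; congr (_ *: _).
by apply: deriveD; exact: diff_derivable.
Qed.

Lemma ext_deriv0 x S : ext_deriv ((fun _ _ => 0) : dform V d) x S = 0.
Proof.
by rewrite /ext_deriv big1 // => i _; rewrite /partial derive_cst scaler0.
Qed.

(** The star keeps the normal of the unperturbed domain and the velocities do
    not depend on [t], so the two partial derivatives make up [d/dt_j]. *)
Lemma dt_peval j e t x S : O (t, x) ->
  dt (ev N j) (pe e) t x S = pe (delta_field j e) t x S + pe (delta_normal j e) t x S.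
Proof.
elim: e t x S => /=.
- by move=> t x S _; rewrite addr0; exact: derive_cst.
- by move=> t x S _; rewrite addr0; exact: derive_cst.
- by move=> J t x S _; rewrite dts_rcons addr0.
- move=> e IH t x S Otx; rewrite (dt_ext oO) //; last exact: smooth_peval.
  rewrite -ext_derivD; try by move=> K; apply: slice_diff => //; exact: smooth_peval.
  have oS := @open_slice _ _ _ _ oO t.
  by apply: (ext_deriv_eq _ oS) => // y K Oty; exact: IH.
- move=> e IH t x S Otx; rewrite (dt_multiplier _ _ star_mult _ Otx); last exact: smooth_peval.
  rewrite -(multiplierD _ _ _ _ star_mult).
  by apply: (multiplier_ext star_mult) => K; exact: IH.
- move=> J e IH t x S Otx; rewrite (dt_interior oO) //; last first.
  + exact: smooth_peval.
  + exact: smooth_dtvs.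
  rewrite dtvs_rcons addrCA; congr (_ + _).
  by rewrite -interiorD; apply: eq_bigr => i _; rewrite IH.
- move=> j' e IH t x S Otx.
  rewrite (dt_multiplier _ _ (contrV_mult j') _ Otx); last exact: smooth_peval.
  by rewrite -interiorD; apply: eq_bigr => i _; rewrite IH.
- move=> e IH f IHf t x S Otx; rewrite addrACA -IH // -IHf // !dtE.
  by apply: deriveD; apply: diff_derivable; apply: smooth_diff Otx; exact: smooth_peval.
- move=> e IH t x S Otx; rewrite -opprD -IH // !dtE.
  by apply: deriveN; apply: diff_derivable; apply: smooth_diff Otx; exact: smooth_peval.
Qed.

(** The recursion for the boundary data says exactly this for the residual:
    the trace of the new derivative and the last two terms of the data are the
    derivative of the old trace. *)
Lemma residualS M t x S : O (t, x) ->
  pe (residual M.+1) t x S =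
    interior_prod (v M) (ext_deriv (pe (residual M) t)) x S +
    dt (ev N M) (pe (residual M)) t x S.
Proof.
move=> Otx; rewrite dt_peval //.
have dpe e K : differentiable (fun y => pe e t y K) x.
  by apply: slice_diff => //; exact: smooth_peval.
pose A := BStar (BContrN [::] (BExt (BField (iota 0 M)))).
have -> : interior_prod (v M) (ext_deriv (pe (residual M) t)) x S =
    pe (BContrV M (BExt A)) t x S - pe (BContrV M (BExt (neumann_data M))) t x S.
  rewrite -[RHS](multiplierB (contrV_mult M)); apply: (multiplier_ext (contrV_mult M)) => K.
  exact: (ext_derivB _ (dpe A) (dpe (neumann_data M))).
have -> : pe (delta_normal M (residual M)) t x S =
    pe (BStar (BContrN [:: M] (BExt (BField (iota 0 M))))) t x S -
    pe (delta_normal M (neumann_data M)) t x S.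
  congr (_ - _); apply: (multiplier_ext star_mult) => K /=.
  rewrite [X in _ + X](_ : _ = 0) ?addr0 //.
  rewrite /interior_prod big1 // => i _; rewrite ext_deriv0 scaler0 //.
rewrite /residual iota_rcons /= !opprD !opprK.
set a := hodge_surf _ _ _ _ _; set b := interior_prod _ _ _ _; set c := pe _ _ _ _.
set e := pe (delta_normal _ _) _ _ _; set f := interior_prod _ _ _ _.
set h := hodge_surf _ _ _ _ _.
by rewrite !addrA [LHS](ACl (5*2*1*3*6*4)).
Qed.

End BoundaryExpressions.

(** * The boundary identity *)

Section BoundaryIdentity.
Context {R : realType} {V : normedModType R} {N d : nat}.
Local Notation pt := ('rV[R]_N * 'rV[R]_d)%type.
Context {Ball : set 'rV[R]_d} {T : nat -> R -> 'rV[R]_d -> 'rV[R]_d}.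
Variables (O : set pt) (Bx : set 'rV[R]_d) (oO : open O) (oBx : open Bx).
Hypothesis OB : forall p, O p -> Bx p.2.
Variables (g : metric R d) (v : nat -> vfield R d) (n0 : vfield R d)
  (n : 'rV[R]_N -> vfield R d) (phi : dform V d) (W : 'rV[R]_N -> dform V d).
Hypothesis g_riem : riemannian g.
Hypothesis v_smooth : forall j, smooth_on Bx (v j).
Hypothesis n0_smooth : smooth_on Bx n0.
Hypothesis n_smooth : smooth_on O (fun p => n p.1 p.2).
Hypothesis phi_smooth : forall S, smooth_on Bx (fun x => phi x S).
Hypothesis W_smooth : smooth_fam O W.
Hypothesis v_velocity : forall j, velocity_field Ball (v j).
Hypothesis T_flow : forall j, is_flow (v j) (T j).
Hypothesis v_normal : forall j, (j < N)%N ->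
  exists s : 'rV[R]_d -> R, forall x, Bx x -> v j x = s x *: n0 x.
Local Notation pe := (peval g v n0 n phi W).

Let spe e : smooth_fam O (pe e).
Proof. exact: (smooth_peval oO oBx OB). Qed.

Lemma interior_scale (u u' : vfield R d) (s : R) (w : dform V d) x S :
  u x = s *: u' x -> interior_prod u w x S = s *: interior_prod u' w x S.
Proof.
move=> uu; rewrite /interior_prod uu scaler_sumr; apply: eq_bigr => i _.
by rewrite mxE scalerA; congr (_ *: _); rewrite mulrCA.
Qed.

Lemma interior_hodge_surf (u : vfield R d) (w : dform V d) x S :
  interior_prod u (hodge_surf g u w) x S = 0.
Proof. exact: (contr_contr (fun i => u x 0 i) (wedge_flat u (hodge g (wedge_flat u w)) x) S). Qed.

(** The star ends with a contraction with [n0], later contractions are with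
    multiples of [n0], and [n0] does not depend on [t]. *)
Lemma residual_tangential M t x S : (M <= N)%N -> O (t, x) ->
  interior_prod n0 (pe (residual M) t) x S = 0.
Proof.
have mn0 : multiplier Bx (interior_prod (V := V) n0) by exact: interior_multiplier.
elim: M t x S => [|M IH] t x S MN Otx.
  by rewrite (multiplierB mn0) !interior_hodge_surf subr0.
have Bxx : Bx x := OB Otx.
rewrite (multiplier_ext mn0 (w' := fun y K => interior_prod (v M) (ext_deriv (pe (residual M) t)) y K
    + dt (ev N M) (pe (residual M)) t y K)); last first.
  by move=> K; exact: (residualS oO oBx OB).
rewrite interiorD [X in X + _](_ : _ = 0) ?add0r.
  rewrite -(dt_multiplier _ _ mn0 (spe _) Otx).
  by apply: derive_near_cst; apply: filterS (near_line oO _ Otx) => h; exact: IH (ltnW MN).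
have [s sv] := v_normal MN.
have cc := contr_contr (fun i => n0 x 0 i) (ext_deriv (pe (residual M) t) x) S.
rewrite (multiplier_ext mn0 (w' := fun y K => s x *: interior_prod n0 (ext_deriv (pe (residual M) t)) y K)).
  have -> : interior_prod n0 (fun y K => s x *: interior_prod n0 (ext_deriv (pe (residual M) t)) y K) x S =
     s x *: interior_prod n0 (interior_prod n0 (ext_deriv (pe (residual M) t))) x S.
    by rewrite /interior_prod scaler_sumr; apply: eq_bigr => i _; rewrite !scalerA mulrC.
  by rewrite [X in _ *: X](_ : _ = 0) ?scaler0 //; exact: cc.
by move=> K; apply: interior_scale; exact: sv.
Qed.

Variables (U : set 'rV[R]_N) (G : set 'rV[R]_d).
Hypothesis oU : open U.
Local Notation Gt t := (comp_flows T t @` G).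
Hypothesis base : forall t x S, U t -> O (t, x) -> Gt t x -> pe (residual 0) t x S = 0.

(** Differentiate [pe (residual M)] along the curve that follows the boundary
    point [x] under the flow of [v M]. The result is the time derivative plus
    the derivative along [v M], and the latter is the contracted exterior
    derivative by [contract_ext_deriv]; so it is [pe (residual M.+1)]. *)
Lemma residual_vanish M t x S : (M <= N)%N -> U t -> zero_below M t -> O (t, x) ->
  Gt t x -> pe (residual M) t x S = 0.
Proof.
elim: M t x S => [|M IH] t x S MN Ut zt Otx Gx; first exact: base.
have ztM : zero_below M t by move=> i iM; apply: zt; exact: ltnW.
have Bxx : Bx x := OB Otx.
have P0 K : pe (residual M) t x K = 0 by apply: IH => //; exact: ltnW.
rewrite (residualS oO oBx OB) //.
pose F (p : pt) := pe (residual M) p.1 p.2 S.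
pose gam (h : R) : pt := (h *: ev N M + t, T M h x).
have [T0 TD dT] := T_flow M.
have gam0 : gam 0 = (t, x) by rewrite /gam scale0r add0r T0.
have dF : differentiable F (gam 0) by rewrite gam0; exact: (smooth_diff (spe _ S) Otx).
have dline : is_derive (0 : R) 1 (fun h : R => h *: ev N M + t) (ev N M).
  have idd : differentiable (idfun : 'rV[R]_N -> 'rV[R]_N) (0 *: ev N M + t).
    exact: (ex_diff (is_diff_def := is_diff_id _)).
  by have := is_derive_line idd; rewrite derive_id.
have dT0 := dT 0 x; rewrite T0 in dT0.
have dl : differentiable (fun h : R => h *: ev N M + t) 0.
  by apply/derivable1_diffP; exact: ex_derive.
have dTd : differentiable (fun h => T M h x) 0 by apply/derivable1_diffP; exact: ex_derive.
have dg : differentiable gam 0 by exact: differentiable_pair.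
have gam' : 'd gam 0 1 = (ev N M, v M x).
  rewrite (diff_pair dl dTd) /= -!deriveE //.
  by rewrite (derive_val (is_derive := dline)) (derive_val (is_derive := dT0)).
have Fgam : \forall h \near (0 : R), F (gam h) = 0.
  have nO : \forall h \near (0 : R), O (gam h).
    have := differentiable_continuous dg.
    by move=> /(_ O); rewrite gam0; apply; exact: open_nbhs_nbhs.
  have nU : \forall h \near (0 : R), U (h *: ev N M + t).
    have := differentiable_continuous dl.
    by move=> /(_ U); rewrite scale0r add0r; apply; exact: open_nbhs_nbhs.
  apply: filterS (filterI nO nU) => h [Oh Uh]; apply: IH => //.
  - exact: ltnW.
  - exact: zero_below_shift.
  - case: Gx => y Gy yx; exists y => //; rewrite -(comp_flows_shift T_flow h y MN ztM) yx.
    by [].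
have : 'D_1 (F \o gam) 0 = 0.
  rewrite -(derive_cst (0 : V) (0 : R) 1); apply: near_eq_derive; exact: Fgam.
rewrite deriveE; last exact: differentiable_comp.
rewrite diff_comp //= gam' gam0 => dF0.
rewrite gam0 in dF.
have -> : dt (ev N M) (pe (residual M)) t x S = 'd F (t, x) (ev N M, 0).
  by rewrite dtE deriveE.
rewrite (@contract_ext_deriv _ _ _ (v M) _ (Bx `&` [set y | O (t, y)])) //.
- rewrite (eq_bigr (fun i => 'd F (t, x) (0, v M x 0 i *: delta_mx 0 i))); last first.
    move=> i _; rewrite (partialE i (pe (residual M))) deriveE //.
    rewrite -linearZ /=; congr ('d F (t, x) _); congr pair; exact: scaler0.
  rewrite -linear_sum -linearD -[RHS]dF0; congr ('d F (t, x) _).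
  have inj_sum (f : 'I_d -> 'rV[R]_d) : \sum_i ((0, f i) : pt) = (0, \sum_i f i).
    apply/esym; apply: (big_morph (fun y => (0, y) : pt)) => // y z.
    by congr pair; rewrite /= addr0.
  by rewrite inj_sum -row_sum_delta; congr pair; rewrite /= ?addr0 ?add0r.
- by apply: openI => //; exact: open_slice.
- by apply: smooth_sub (v_smooth M) => y [].
- move=> K; apply: smooth_sub (smooth_slice oO (spe (residual M) K)) => y [] //.
- by move=> y K [_ Oty]; have [s sv] := v_normal MN;
    rewrite (interior_scale (s := s y) (u' := n0)) ?(residual_tangential _ (ltnW MN) Oty)
      ?scaler0 // sv //; exact: (OB Oty).
Qed.

End BoundaryIdentity.

(** * Boundary values from inside *)

Section Evaluation.
Context {R : realType} {V : normedModType R} {N d : nat}.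
Local Notation pt := ('rV[R]_N * 'rV[R]_d)%type.
Context {B : set 'rV[R]_d} {v : nat -> vfield R d} {T : nat -> R -> 'rV[R]_d -> 'rV[R]_d}.
Hypothesis v_velocity : forall j, velocity_field B (v j).
Hypothesis T_flow : forall j, is_flow (v j) (T j).
Variables (D : set 'rV[R]_d) (O : set pt) (oO : open O) (oD : open D).
Local Notation Dt t := (comp_flows T t @` D).
Variables (g : metric R d) (n : set 'rV[R]_d -> vfield R d) (phi : dform V d)
  (w : set 'rV[R]_d -> dform V d) (W : 'rV[R]_N -> dform V d).
Hypothesis wW : forall s y, O (s, y) -> Dt s y -> w (Dt s) y = W s y.

Lemma zero_below0 M : zero_below M (0 : 'rV[R]_N).
Proof. by move=> i _; rewrite mxE. Qed.

(** Inside [D] the field agrees with its extension, on an open set, and the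
    frozen normal is the normal at [t = 0]. *)
Lemma beval_peval e x S : indices_below N e -> D x -> O (0, x) ->
  beval g v T n phi w D e x S =
  peval g v (n D) (fun s => n (Dt s)) phi W e 0 x S.
Proof.
have D0 : Dt (0 : 'rV[R]_N) = D by exact: (image_comp_flows0 T_flow).
elim: e x S => //=.
- move=> J x S /andP[srt JN] Dx Ox.
  rewrite -{1}D0; apply: (shape_derivs_formE v_velocity T_flow oO oD _ wW srt JN) => //.
    exact: zero_below0.
  by rewrite D0.
- move=> e IH x S ie Dx Ox.
  apply: (ext_deriv_eq _ (openI oD (@open_slice _ _ _ _ oO 0))) => // y K [Dy Oy].
  exact: IH.
- move=> e IH x S ie Dx Ox; rewrite /hodge_surf /tangential.
  apply: eq_bigr => i _; congr (_ *: _); apply: eq_bigr => j _; congr (_ *: _).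
  rewrite /hodge; congr (_ *: _); apply: eq_bigr => K _; congr (_ *: _).
  by apply: eq_bigr => k _; rewrite IH.
- move=> J e IH x S /and3P[srt JN ie] Dx Ox; apply: eq_bigr => i _.
  rewrite IH //; congr ((_ * _) *: _).
  by rewrite -{1}D0 (shape_derivs_vecE T_flow) //; exact: zero_below0.
- move=> j e IH x S ie Dx Ox; apply: eq_bigr => i _; by rewrite IH.
- by move=> e IH f IHf x S /andP[ie jf] Dx Ox; rewrite IH // IHf.
- by move=> e IH x S ie Dx Ox; rewrite IH.
Qed.

End Evaluation.

Section Traces.
Context {R : realType} {V : normedModType R} {d : nat}.
Implicit Types (D G B : set 'rV[R]_d) (w a : dform V d).

(** A form given inside [D] by one that is continuous across the boundary
    has the values of that form as its trace. *)
Lemma trace_intro D w (u : dform V d) x S B : open B -> B x ->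
  {for x, continuous (fun y => u y S)} ->
  (forall y, B y -> D y -> w y S = u y S) ->
  w y S @[y --> within D (nbhs x)] --> u x S.
Proof.
move=> oB Bx cu wu.
have c : u y S @[y --> within D (nbhs x)] --> u x S.
  apply: cvg_trans cu; apply: cvg_app; exact: cvg_within.
apply: cvg_trans c; apply: near_eq_cvg.
have nB : nbhs x B by exact: open_nbhs_nbhs.
by rewrite /within /=; apply: filterS nB => y By Dy; rewrite wu.
Qed.

Lemma trace_unique D w x S (l l' : V) : closure D x ->
  w y S @[y --> within D (nbhs x)] --> l ->
  w y S @[y --> within D (nbhs x)] --> l' -> l = l'.
Proof.
move=> clD h h'; have PF : ProperFilter (within D (nbhs x)) by exact: within_nbhs_proper.
exact: (cvg_unique (@norm_hausdorff _ _) h h').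
Qed.

End Traces.

(** * The radiation condition *)

Section Radiation.
Context {R : realType} {V Y : normedModType R} {N d : nat}.
Local Notation pt := ('rV[R]_N * 'rV[R]_d)%type.

Lemma differentiable_enorm2 (c x : 'rV[R]_d) :
  differentiable (fun y : 'rV[R]_d => enorm2 (y - c)) x.
Proof.
have dc i : differentiable (fun y : 'rV[R]_d => (y - c) 0 i : R) x.
  by apply: differentiable_coordf; exact: (@differentiableB _ _ _ id (fun=> c)).
have -> : (fun y : 'rV[R]_d => enorm2 (y - c)) =
    (fun y => \sum_i ((y - c) 0 i : R) *: ((y - c) 0 i : R)).
  by apply/funext => y; apply: eq_bigr => i _; rewrite expr2.
exact: (derivative_sum _ 0 (fun i _ => (diff_scalef (dc i) (dc i)).1)).1.
Qed.

Lemma eball_open (c : 'rV[R]_d) (r : R) : open (eball c r).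
Proof.
have -> : eball c r = (fun x => enorm2 (x - c)) @^-1` [set s | s < r ^+ 2] by [].
apply: open_comp => [x _|]; last exact: open_lt.
exact: (differentiable_continuous (differentiable_enorm2 c x)).
Qed.

Lemma esphere_compact (c : 'rV[R]_d) (r : R) : compact (esphere c r).
Proof.
apply: bounded_closed_compact.
  exists (`|c| + `|r|); split; first exact: num_real.
  move=> M Mlt x xr; apply: ltW; apply: le_lt_trans Mlt.
  rewrite -[x](subrK c) addrC; apply: le_trans (ler_normD _ _) _; rewrite lerD2l.
  rewrite -(ler_pXn2r (n := 2)) ?nnegrE // (le_trans (norm_sqr_le_enorm2 _)) //.
  by rewrite xr real_normK ?num_real.
have -> : esphere c r = (fun x => enorm2 (x - c)) @^-1` [set r ^+ 2] by [].
apply: closed_comp => [x _|]; last exact: closed_eq.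
exact: (differentiable_continuous (differentiable_enorm2 c x)).
Qed.

Lemma uniform_cvgP (G : set 'rV[R]_d) (a_ : nat -> dform V d) (a : dform V d) :
  (forall S e, 0 < e -> \forall k \near \oo, forall x, G x -> `|a x S - a_ k x S| < e) ->
  uniform_cvg G a_ a.
Proof.
move=> h S P /uniform_nbhs[E [entE EP]].
have [e e0 eE] : exists2 e : R, 0 < e & [set xy : V * V | ball xy.1 e xy.2] `<=` E.
  by have := entE; rewrite -entourage_ballE => -[e /= e0 eE]; exists e.
apply: filterS (h S e e0) => k hk; apply: EP => x Gx; apply: eE.
by rewrite /= -ball_normE /=; exact: hk.
Qed.

Section Operator.
Variables (GR : set 'rV[R]_d) (Rad : dform V d -> dform V d -> Y).
Hypothesis Rad_op : radiation_operator GR Rad.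

(** Continuity applied to a constant sequence. *)
Lemma Rad_eq (a a' b b' : dform V d) :
  (forall x S, GR x -> a x S = a' x S) -> (forall x S, GR x -> b x S = b' x S) ->
  continuous_on GR a -> continuous_on GR b -> Rad a b = Rad a' b'.
Proof.
move=> aa bb ca cb; have [_ cont] := Rad_op.
have u1 : uniform_cvg GR (fun=> a) a'.
  apply: uniform_cvgP => S e e0; near=> k => x Gx.
  by rewrite aa // subrr normr0.
have u2 : uniform_cvg GR (fun=> b) b'.
  apply: uniform_cvgP => S e e0; near=> k => x Gx.
  by rewrite bb // subrr normr0.
have := cont (fun=> a) (fun=> b) a' b' (fun=> conj ca cb) u1 u2.
move=> h; apply: (cvg_unique (@norm_hausdorff _ _) _ h); exact: cvg_cst.
Unshelve. all: by end_near. Qed.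

Lemma continuous_on0 : continuous_on GR (fun _ _ => 0 : V).
Proof. by move=> S; apply: continuous_subspaceT => x; exact: cst_continuous. Qed.

Lemma Rad0 : Rad (fun _ _ => 0) (fun _ _ => 0) = 0.
Proof.
have [lin _] := Rad_op; have c0 := continuous_on0.
have := lin (-1) _ _ _ _ c0 c0 c0 c0.
have -> : (fun (x : 'rV[R]_d) (S : {set 'I_d}) => -1 *: (0 : V) + 0) = (fun _ _ => 0).
  by apply/funext => x; apply/funext => S; rewrite scaler0 addr0.
by rewrite scaleN1r addNr.
Qed.

Lemma continuous_on_lin k (a a' : dform V d) : continuous_on GR a -> continuous_on GR a' ->
  continuous_on GR (fun x S => k *: a x S + a' x S).
Proof.
move=> ca ca' S x.
exact: (cvgD (cvgZ (cvg_cst k) (ca S x)) (ca' S x)).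
Qed.

Lemma Rad_quotient k (a a' b b' : dform V d) :
  continuous_on GR a -> continuous_on GR a' -> continuous_on GR b -> continuous_on GR b' ->
  Rad a b = 0 -> Rad a' b' = 0 ->
  Rad (fun x S => k *: (a x S - a' x S)) (fun x S => k *: (b x S - b' x S)) = 0.
Proof.
move=> ca ca' cb cb' r0 r0'; have [lin _] := Rad_op; have c0 := continuous_on0.
have e (u u' : dform V d) : (fun x S => k *: (u x S - u' x S)) =
    (fun x S => k *: (-1 *: u' x S + u x S) + (fun _ _ => 0) x S).
  by apply/funext => x; apply/funext => S; rewrite scaleN1r addr0 [- _ + _]addrC.
rewrite !e (lin k (fun x S => -1 *: a' x S + a x S) (fun _ _ => 0)
  (fun x S => -1 *: b' x S + b x S) (fun _ _ => 0)) ?Rad0 //;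
  try exact: continuous_on_lin.
by rewrite (lin (-1) a' a b' b) // r0 r0' !(scaler0, addr0).
Qed.

End Operator.

(** The mean value inequality along [h |-> (h e + t, x)], with a modulus of
    continuity of the derivative uniform in [x] by compactness. *)
Lemma diff_quotient_uniform (O : set pt) (F : pt -> V) (K : set 'rV[R]_d)
    (e t : 'rV[R]_N) (eps : R) : open O -> smooth_on O F -> compact K ->
  (forall x, K x -> O (t, x)) -> 0 < eps ->
  exists2 del : R, 0 < del & forall h, 0 < h < del -> forall x, K x ->
    `|'D_(e, 0) F (t, x) - h^-1 *: (F (h *: e + t, x) - F (t, x))| <= eps.
Proof.
move=> oO sF cK KO eps0; set g := 'D_(e, 0) F.
have sg : smooth_on O g by exact: smooth_derive.
have nc : \forall tau \near (0 : R), K `<=` [set x | O (tau *: e + t, x) /\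
    `|g (tau *: e + t, x) - g (t, x)| < eps].
  have /compact_near_coveringP nK := cK.
  apply: (nK R (nbhs (0 : R)) (fun tau x => O (tau *: e + t, x) /\
    `|g (tau *: e + t, x) - g (t, x)| < eps)) => x Kx.
  have Ox := KO _ Kx.
  have lf : linear (fst : 'rV[R]_d * R -> 'rV[R]_d) by [].
  pose fM := GRing.isLinear.Build _ _ _ _ _ lf.
  pose f1 : {linear ('rV[R]_d * R)%type -> 'rV[R]_d} := HB.pack (fst : 'rV[R]_d * R -> 'rV[R]_d) fM.
  have d1 : differentiable (fst : 'rV[R]_d * R -> 'rV[R]_d) (x, 0).
    by apply: (@linear_differentiable _ _ _ f1) => q; exact: cvg_fst.
  have ls : linear (snd : 'rV[R]_d * R -> R) by [].
  pose sM := GRing.isLinear.Build _ _ _ _ _ ls.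
  pose s1 : {linear ('rV[R]_d * R)%type -> R} := HB.pack (snd : 'rV[R]_d * R -> R) sM.
  have d2 : differentiable (snd : 'rV[R]_d * R -> R) (x, 0).
    by apply: (@linear_differentiable _ _ _ s1) => q; exact: cvg_snd.
  have ptd : differentiable (fun q : 'rV[R]_d * R => (q.2 *: e + t, q.1) : pt) (x, 0).
    apply: differentiable_pair; last exact: d1.
    apply: (@differentiableD _ _ _ (fun q : 'rV[R]_d * R => q.2 *: e) (fun=> t)) => //.
    exact: (diff_scalef d2 (differentiable_cst e _)).1.
  have ptd' : differentiable (fun q : 'rV[R]_d * R => (t, q.1) : pt) (x, 0).
    by apply: differentiable_pair; [exact: differentiable_cst|exact: d1].
  have n1 : \forall q \near ((x, 0) : 'rV[R]_d * R), O (q.2 *: e + t, q.1).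
    have := differentiable_continuous ptd => /(_ O); apply.
    by rewrite /= scale0r add0r; exact: open_nbhs_nbhs.
  have n2 : \forall q \near ((x, 0) : 'rV[R]_d * R),
      `|g (q.2 *: e + t, q.1) - g (t, q.1)| < eps.
    have c : {for (x, 0 : R), continuous (fun q : 'rV[R]_d * R =>
        g (q.2 *: e + t, q.1) - g (t, q.1))}.
      apply: differentiable_continuous.
      apply: (@differentiableB _ _ _ (fun q : 'rV[R]_d * R => g (q.2 *: e + t, q.1))
        (fun q => g (t, q.1))).
        apply: (differentiable_comp ptd); rewrite /= scale0r add0r.
        exact: (smooth_diff sg Ox).
      by apply: (differentiable_comp ptd'); exact: (smooth_diff sg Ox).
    apply: (c [set y | `|y| < eps]); rewrite /= scale0r add0r subrr.
    by apply/nbhs_ballP; exists eps => // y; rewrite -ball_normE /= sub0r normrN.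
  apply: filterS (filterI n1 n2) => -[y tau] [/= ? ?] //.
have /nbhs_ballP[del /= del0 hdel] := nc.
exists del => // h /andP[h0 hd] x Kx.
have tb tau : 0 <= tau <= h -> O (tau *: e + t, x) /\ `|g (tau *: e + t, x) - g (t, x)| < eps.
  move=> /andP[t0 th]; apply: (hdel tau) => //.
  by rewrite /ball /= sub0r normrN ger0_norm // (le_lt_trans th).
pose phi (tau : R) := F (tau *: e + t, x) - tau *: g (t, x).
have dphi (tau : R) : 0 <= tau <= h -> is_derive tau 1 phi (g (tau *: e + t, x) - g (t, x)).
  move=> th; have [Oth _] := tb _ th.
  apply: is_deriveB.
    have E s : (s *: e + t, x) = s *: (e, 0) + (t, x) :> pt.
      by congr pair; rewrite /= scaler0 add0r.
    have -> : (fun s : R => F (s *: e + t, x)) = (fun s : R => F (s *: ((e, 0) : pt) + (t, x))).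
      by apply/funext => s; rewrite E.
    rewrite E; apply: is_derive_line; rewrite -E; exact: (smooth_diff sF Oth).
  have -> : (fun s : R => s *: g (t, x)) = (fun s : R => s *: g (t, x) + 0).
    by apply/funext => s; rewrite addr0.
  have idd : differentiable (idfun : V -> V) (tau *: g (t, x) + 0).
    exact: (ex_diff (is_diff_def := is_diff_id _)).
  by have := is_derive_line idd; rewrite derive_id.
have := mean_value_ineq (M := eps) (ltW h0) dphi (fun tau th => ltW (tb tau th).2).
rewrite /phi !scale0r !add0r !subr0 => le1.
have -> : g (t, x) - h^-1 *: (F (h *: e + t, x) - F (t, x)) =
   - h^-1 *: (F (h *: e + t, x) - h *: g (t, x) - F (t, x)).
  by rewrite scaleNr [in RHS]addrAC [in RHS]scalerBr scalerA mulVf ?gt_eqF // scale1r opprB.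
rewrite normrZ normrN gtr0_norm ?invr_gt0 // mulrC ler_pdivrMr //.
Qed.

End Radiation.

Section RadiationDerivative.
Context {R : realType} {V Y : normedModType R} {N d : nat}.
Local Notation pt := ('rV[R]_N * 'rV[R]_d)%type.
Variables (GR : set 'rV[R]_d) (Rad : dform V d -> dform V d -> Y).
Hypothesis Rad_op : radiation_operator GR Rad.
Hypothesis GR_compact : compact GR.
Variables (O : set pt) (oO : open O) (U : set 'rV[R]_N) (oU : open U).
Hypothesis UO : forall t x, U t -> GR x -> O (t, x).

Lemma continuous_on_fam (A : 'rV[R]_N -> dform V d) t : smooth_fam O A -> U t ->
  continuous_on GR (A t).
Proof.
move=> sA Ut S; have sl := smooth_slice oO (t := t) (sA S).
apply: continuous_in_subspaceT => x /set_mem Gx.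
exact: (differentiable_continuous (smooth_diff sl (UO Ut Gx))).
Qed.

(** Difference quotients satisfy the condition by linearity and converge
    uniformly on the sphere. *)
Lemma Rad_dt (A B : 'rV[R]_N -> dform V d) M : smooth_fam O A -> smooth_fam O B ->
  (forall t, U t -> zero_below M t -> Rad (A t) (B t) = 0) ->
  forall t, U t -> zero_below M t -> Rad (dt (ev N M) A t) (dt (ev N M) B t) = 0.
Proof.
move=> sA sB rad t Ut zt.
have nU : \forall h \near (0 : R), U (h *: ev N M + t).
  have c : {for 0, continuous (fun h : R => h *: ev N M + t)}.
    apply: differentiable_continuous.
    by apply: (@differentiableD _ _ _ (fun h : R => h *: ev N M) (fun=> t)).
  apply: (c U); rewrite scale0r add0r; exact: open_nbhs_nbhs.
have /nbhs_ballP[del /= del0 hdel] := nU.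
(* All terms of the sequence, not just the late ones, must stay in [U]. *)
pose h k : R := del / (k.+2)%:R.
have h0 k : 0 < h k by rewrite divr_gt0.
have hU k : U (h k *: ev N M + t).
  apply: hdel; rewrite /ball /= sub0r normrN gtr0_norm // ltr_pdivrMr // ltr_pMr // ltr1n.
  by [].
have hlim e : 0 < e -> \forall k \near \oo, h k < e.
  move=> e0; near=> k; rewrite /h ltr_pdivrMr // mulrC -ltr_pdivrMr //.
  have kk : k%:R <= k.+2%:R :> R by rewrite ler_nat; lia.
  apply: lt_le_trans kk; near: k; exact: nbhs_infty_gtr.
pose q (F : 'rV[R]_N -> dform V d) k : dform V d :=
  fun x S => (h k)^-1 *: (F (h k *: ev N M + t) x S - F t x S).
have ccont F k : smooth_fam O F -> continuous_on GR (q F k).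
  move=> sF; have c1 := continuous_on_fam sF (hU k); have c2 := continuous_on_fam sF Ut.
  have E : q F k = (fun x S => (h k)^-1 *: (-1 *: F t x S + F (h k *: ev N M + t) x S) +
      (fun _ _ => 0) x S).
    by apply/funext => x; apply/funext => S; rewrite /q scaleN1r addr0 [- _ + _]addrC.
  rewrite E; apply: continuous_on_lin; last exact: continuous_on0.
  exact: continuous_on_lin.
have ucvg F : smooth_fam O F -> uniform_cvg GR (q F) (dt (ev N M) F t).
  move=> sF; apply: uniform_cvgP => S e e0.
  have e2 : 0 < e / 2 by rewrite divr_gt0.
  have [dl dl0 hd] := diff_quotient_uniform (ev N M) oO (sF S) GR_compact
     (fun x Gx => UO Ut Gx) e2.
  apply: filterS (hlim _ dl0) => k hk x Gx; rewrite dtE /q.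
  apply: le_lt_trans (hd (h k) _ x Gx) _; first by rewrite h0 hk.
  by rewrite ltr_pdivrMr // ltr_pMr // ltr1n.
have [_ cont] := Rad_op.
have := cont (q A) (q B) _ _ (fun k => conj (ccont A k sA) (ccont B k sB)) (ucvg A sA) (ucvg B sB).
have -> : (fun k => Rad (q A k) (q B k)) = (fun=> 0).
  apply/funext => k; apply: (Rad_quotient Rad_op); try exact: continuous_on_fam.
    by apply: rad => //; exact: zero_below_shift.
  exact: rad.
move=> hl; apply/esym; apply: (cvg_unique (@norm_hausdorff _ _) _ hl); exact: cvg_cst.
Unshelve. all: by end_near. Qed.

Lemma Rad_dts (A B : 'rV[R]_N -> dform V d) : smooth_fam O A -> smooth_fam O B ->
  (forall t, U t -> Rad (A t) (B t) = 0) ->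
  forall M t, U t -> zero_below M t ->
    Rad (dts (iota 0 M) A t) (dts (iota 0 M) B t) = 0.
Proof.
move=> sA sB rad; elim=> [|M IH] t Ut zt; first exact: rad.
rewrite iota_rcons !dts_rcons; apply: Rad_dt => //.
- exact: smooth_dts.
- exact: smooth_dts.
- by move=> i iM; apply: zt; exact: ltnW.
Qed.

End RadiationDerivative.

(** * Geometry of the exterior domain *)

Section Geometry.
Context {R : realType} {d : nat}.

(** Approach [x] along the radius. *)
Lemma esphere_closure (Om : set 'rV[R]_d) c (r : R) x : 0 < r -> closure Om `<=` eball c r ->
  esphere c r x -> closure (eball c r `\` closure Om) x.
Proof.
move=> r0 Omr xr A nA.
have nOm : ~ closure Om x.
  by move=> /Omr; rewrite /eball /= xr ltxx.
have nC : nbhs x (~` closure Om).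
  apply: open_nbhs_nbhs; split=> //; apply: closed_openC; exact: closed_closure.
pose f (s : R) := s *: (x - c) + c.
have f1 : f 1 = x by rewrite /f scale1r subrK.
have cf : {for 1, continuous f}.
  apply: differentiable_continuous.
  by apply: (@differentiableD _ _ _ (fun s : R => s *: (x - c)) (fun=> c)).
have /nbhs_ballP[e /= e0 he] : nbhs (1 : R) (f @^-1` (A `&` ~` closure Om)).
  by apply: cf; rewrite f1; exact: filterI.
pose s : R := 1 - Num.min (e / 2) (1 / 2).
have m0 : 0 < Num.min (e / 2) (1 / 2) by rewrite lt_min !divr_gt0.
have m1 : Num.min (e / 2) (1 / 2) <= 1 / 2 by rewrite ge_min lexx orbT.
have m2 : Num.min (e / 2) (1 / 2) <= e / 2 by rewrite ge_min lexx.
have s0 : 0 <= s by rewrite /s; lra.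
have s1 : s < 1 by rewrite /s; lra.
have bs : ball (1 : R) e s.
  by rewrite /ball /= /s opprB addrC subrK gtr0_norm //; lra.
have [As nOs] := he _ bs.
exists (f s); split; last exact: As.
split; last exact: nOs.
rewrite /eball /= /f addrK.
have -> : enorm2 (s *: (x - c)) = s ^+ 2 * enorm2 (x - c).
  by rewrite /enorm2 mulr_sumr; apply: eq_bigr => i _; rewrite mxE exprMn.
rewrite [enorm2 _]xr gtr_pMl ?exprn_gt0 //.
by rewrite expr_lt1.
Qed.

(** A defining function increases along its gradient, and where it is positive
    the point is outside the obstacle and its boundary. *)
Lemma boundary_closure (Om Ball : set 'rV[R]_d) x : bounded_smooth_domain Om ->
  open Ball -> closure Om `<=` Ball -> (closure Om `\` Om) x ->
  closure (Ball `\` closure Om) x.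
Proof.
move=> [_ _ _ _ hdef] oB OmB Gx A nA.
have [U [psi [oU Ux spsi hU]]] := hdef _ Gx.
have [gr0 _ Gpsi] := hU x Ux.
have psi0 : psi x = 0 by apply/Gpsi.
pose u := grad psi x.
have dpsi : differentiable psi x by exact: (smooth_diff spsi Ux).
have Du : 'D_u psi x = enorm2 u.
  rewrite deriveE // [X in 'd psi x X]row_sum_delta linear_sum /=; apply: eq_bigr => i _.
  by rewrite linearZ /= -deriveE // expr2 {2}/u mxE.
have Du0 : 0 < 'D_u psi x.
  rewrite Du lt_neqAle enorm2_ge0 andbT eq_sym; apply: contra gr0 => /eqP e0.
  rewrite -/u -normr_eq0; have := norm_sqr_le_enorm2 u; rewrite e0 => h.
  have : `|u| ^+ 2 == 0 by rewrite eq_le h exprn_ge0.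
  by rewrite expf_eq0.
have nAll : nbhs x (A `&` (U `&` Ball)).
  apply: filterI => //; apply: filterI; apply: open_nbhs_nbhs; split=> //.
  by apply: OmB; case: Gx.
have nl : \forall h \near (0 : R), (A `&` (U `&` Ball)) (h *: u + x).
  have c : {for 0, continuous (fun h : R => h *: u + x)}.
    apply: differentiable_continuous.
    by apply: (@differentiableD _ _ _ (fun h : R => h *: u) (fun=> x)).
  by apply: (c _); rewrite scale0r add0r.
have /nbhs_ballP[e1 /= e10 he1] := nl.
have dq : (fun h => h^-1 *: (psi (h *: u + x) - psi x)) @ (0 : R)^' --> 'D_u psi x.
  exact: (@diff_derivable _ _ _ psi x u dpsi).
have pos : nbhs (0 : R) (fun h => h != 0 -> 0 < h^-1 *: (psi (h *: u + x) - psi x)).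
  exact: (cvgr_gt _ dq 0 Du0).
have /nbhs_ballP[e2 /= e20 he2] := pos.
pose h := Num.min (e1 / 2) (e2 / 2).
have h0 : 0 < h by rewrite lt_min !divr_gt0.
have h1 : h < e1 by apply: (@le_lt_trans _ _ (e1 / 2)); [rewrite ge_min lexx|lra].
have h2 : h < e2 by apply: (@le_lt_trans _ _ (e2 / 2)); [rewrite ge_min lexx orbT|lra].
have b1 : ball (0 : R) e1 h by rewrite /ball /= sub0r normrN gtr0_norm.
have b2 : ball (0 : R) e2 h by rewrite /ball /= sub0r normrN gtr0_norm.
have [Ah [Uh Bh]] := he1 _ b1.
have := he2 _ b2 (lt0r_neq0 h0); rewrite /= psi0 subr0 /GRing.scale /= pmulr_rgt0 ?invr_gt0 // => ph.
exists (h *: u + x); split=> //; split=> // cl.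
have [_ Omh Gh] := hU _ Uh.
have nOm : ~ Om (h *: u + x) by move/Omh; rewrite ltNge ltW.
have /Gh e0 : (closure Om `\` Om) (h *: u + x) by [].
by rewrite e0 ltxx in ph.
Qed.

End Geometry.

(** * The differentiated scattering problem *)

Section DifferentiatedSystem.
Context {R : realType} {V Y : normedModType R} {N d : nat}.
Local Notation pt := ('rV[R]_N * 'rV[R]_d)%type.
Variables (l : nat) (ga gk : metric R d).
Hypotheses (ga_riem : riemannian ga) (gk_riem : riemannian gk).
Context {Ball : set 'rV[R]_d} {v : nat -> vfield R d} {T : nat -> R -> 'rV[R]_d -> 'rV[R]_d}.
Hypothesis v_velocity : forall j, velocity_field Ball (v j).
Hypothesis T_flow : forall j, is_flow (v j) (T j).
Variables (D G GR : set 'rV[R]_d) (oD : open D).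
Local Notation Dt t := (comp_flows T t @` D).
Local Notation Gt t := (comp_flows T t @` G).
Variables (n : set 'rV[R]_d -> vfield R d) (phi : dform V d)
  (w : set 'rV[R]_d -> dform V d) (Rad : dform V d -> dform V d -> Y).
Variables (OW : set pt) (W : 'rV[R]_N -> dform V d) (U : set 'rV[R]_N).
Hypotheses (oOW : open OW) (W_smooth : smooth_fam OW W).
Hypothesis wW : forall s y, OW (s, y) -> Dt s y -> w (Dt s) y = W s y.
Hypothesis D_OW : forall x, closure D x -> OW (0, x).
Hypotheses (oU : open U) (U0 : U 0).
Hypothesis sol : forall t, U t ->
  neumann_system l ga gk GR Rad (Dt t) (Gt t) (n (Dt t))
    (hodge_surf ga (n (Dt t)) (interior_prod (n (Dt t)) (ext_deriv phi))) (w (Dt t)).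

Let J := iota 0 N.
Local Notation dw := (shape_derivs_form T J w D).

Let D0 : Dt (0 : 'rV[R]_N) = D.
Proof. exact: (image_comp_flows0 T_flow). Qed.

Let oDt (t : 'rV[R]_N) : open (Dt t).
Proof. exact: homeo_open (comp_flows_homeo v_velocity T_flow t) oD. Qed.

Let DO x : D x -> OW (0, x).
Proof. by move=> Dx; apply: D_OW; exact: subset_closure. Qed.

Let J_ok : sorted ltn J && all (fun j => j < N)%N J.
Proof.
rewrite iota_ltn_sorted /=; apply/allP => j; by rewrite mem_iota.
Qed.

Lemma shape_deriv_formE x S : D x -> dw x S = dts J W 0 x S.
Proof.
move=> Dx; have /andP[srt JN] := J_ok.
rewrite -{1}D0; apply: (shape_derivs_formE v_velocity T_flow oOW oD _ wW srt JN).
- exact: zero_below0.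
- exact: DO.
- by rewrite D0.
Qed.

Let sdW : smooth_fam OW (dts J W).
Proof. exact: smooth_dts. Qed.

Lemma shape_deriv_smooth S : smooth_on D (fun x => dw x S).
Proof.
have h : smooth_on D (fun x => dts J W 0 x S).
  by apply: smooth_sub (smooth_slice oOW (t := 0) (sdW S)) => x /DO.
by apply: (smooth_eq oD _ h) => x Dx; rewrite shape_deriv_formE.
Qed.

Lemma shape_deriv_degree : has_degree l D dw.
Proof.
move=> x S Dx cS; rewrite shape_deriv_formE //.
apply: (dts_vanish v_velocity T_flow oOW oD oU) => //.
- move=> t y Ut Oty Dy; have [[deg _] _ _ _] := sol Ut.
  by rewrite -(wW Oty Dy); exact: deg.
- exact: zero_below0.
- exact: DO.
- by rewrite D0.
Qed.

Lemma multiplierZ B (Op : dform V d -> dform V d) (k : R) : open B -> multiplier B Op ->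
  multiplier B (fun w x S => k *: Op w x S).
Proof.
move=> oB [A [sA E]]; exists (fun S K x => k * A S K x); split.
  by move=> S K; apply: smoothM => //; exact: smooth_cst.
by move=> u x S; rewrite E scaler_sumr; apply: eq_bigr => K _; rewrite scalerA.
Qed.

Lemma shape_deriv_equation x S : D x ->
  ext_deriv (hodge ga (ext_deriv dw)) x S + (-1) ^+ l *: hodge gk dw x S = 0.
Proof.
move=> Dx.
have mga : multiplier setT (hodge (V := V) ga) by apply: hodge_multiplier => //; exact: openT.
have mgk : multiplier setT (fun w x S => (-1) ^+ l *: hodge (V := V) gk w x S).
  by apply: multiplierZ; [exact: openT|apply: hodge_multiplier => //; exact: openT].
have local (u u' : dform V d) A y K : open A -> A y -> (forall z L, A z -> u z L = u' z L) ->
    ext_deriv (hodge ga (ext_deriv u)) y K + (-1) ^+ l *: hodge gk u y K =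
    ext_deriv (hodge ga (ext_deriv u')) y K + (-1) ^+ l *: hodge gk u' y K.
  move=> oA Ay uu; apply: (f_equal2 +%R).
    apply: (ext_deriv_eq _ oA Ay) => z L Az; apply: (multiplier_ext mga) => M.
    exact: (ext_deriv_eq _ oA Az).
  by apply: (multiplier_ext mgk) => M; exact: uu.
rewrite (local _ (dts J W 0) D) //; last exact: shape_deriv_formE.
have OT (p : pt) : OW p -> setT p.2 by [].
have s1 : smooth_fam OW (fun t => ext_deriv (W t)) by exact: smooth_ext.
have s2 := smooth_multiplier oOW mga OT s1.
have s3 : smooth_fam OW (fun t => ext_deriv (hodge ga (ext_deriv (W t)))) by exact: smooth_ext.
have s4 := smooth_multiplier oOW mgk OT W_smooth.
have O0 : OW (0, x) by exact: DO.
have -> : ext_deriv (hodge ga (ext_deriv (dts J W 0))) x S +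
    (-1) ^+ l *: hodge gk (dts J W 0) x S =
    dts J (fun t x S => ext_deriv (hodge ga (ext_deriv (W t))) x S +
      (-1) ^+ l *: hodge gk (W t) x S) 0 x S.
  apply/esym; apply: (etrans (dtsD oOW J S s3 s4 O0)); apply: (f_equal2 +%R).
    apply: (etrans (dts_ext oOW J S s2 O0)).
    apply: (ext_deriv_eq _ (@open_slice _ _ _ _ oOW 0)) => // y K Oy.
    apply: (etrans (dts_multiplier oOW J K mga s1 Oy)); apply: (multiplier_ext mga) => M.
    exact: (dts_ext oOW J M W_smooth Oy).
  exact: (dts_multiplier oOW J S mgk W_smooth O0).
apply: (dts_vanish v_velocity T_flow oOW oD oU) => //.
- move=> t y Ut Oty Dy; have [_ pde _ _] := sol Ut; rewrite -[RHS](pde y S Dy).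
  apply: (local _ _ (Dt t `&` [set z | OW (t, z)])) => //.
    by apply: openI; [exact: oDt|exact: open_slice].
  by move=> z L [Dz Oz]; rewrite -(wW Oz Dz).
- exact: zero_below0.
- by rewrite D0.
Qed.

Hypothesis GR_compact : compact GR.
Hypothesis Rad_op : radiation_operator GR Rad.
Hypothesis UO : forall t x, U t -> GR x -> OW (t, x).
Hypothesis GR_closure : forall t x, U t -> GR x -> closure (Dt t) x.

Lemma shape_deriv_radiation :
  exists a b, [/\ continuous_on GR a, continuous_on GR b,
        has_trace D GR dw a, has_trace D GR (hodge ga (ext_deriv dw)) b
        & Rad a b = 0].
Proof.
have mga : multiplier setT (hodge (V := V) ga) by apply: hodge_multiplier => //; exact: openT.
have OT (p : pt) : OW p -> setT p.2 by [].
have s1 : smooth_fam OW (fun t => ext_deriv (W t)) by exact: smooth_ext.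
have s2 := smooth_multiplier oOW mga OT s1.
have s3 := smooth_multiplier oOW mga OT (smooth_ext oOW sdW).
have cont (F : 'rV[R]_N -> dform V d) t x S : smooth_fam OW F -> OW (t, x) -> {for x, continuous (fun y => F t y S)}.
  move=> sF Otx; have sl := smooth_slice oOW (t := t) (sF S).
  exact: (differentiable_continuous (smooth_diff sl Otx)).
have radU t : U t -> Rad (W t) (hodge ga (ext_deriv (W t))) = 0.
  move=> Ut; have [_ _ _ [a [b [ca cb ta tb rab]]]] := sol Ut.
  rewrite -rab; apply: (Rad_eq Rad_op).
  - move=> x S Gx; apply: (trace_unique (GR_closure Ut Gx) _ (ta x S Gx)).
    apply: (trace_intro (u := W t) (@open_slice _ _ _ _ oOW t) (UO Ut Gx)).
      exact: (cont _ t x S W_smooth (UO Ut Gx)).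
    by move=> y Oy Dy; rewrite (wW Oy Dy).
  - move=> x S Gx; apply: (trace_unique (GR_closure Ut Gx) _ (tb x S Gx)).
    apply: (trace_intro (u := hodge ga (ext_deriv (W t)))
      (@open_slice _ _ _ _ oOW t) (UO Ut Gx)).
      exact: (cont _ t x S s2 (UO Ut Gx)).
    move=> y Oy Dy; apply: (multiplier_ext mga) => K.
    apply: (ext_deriv_eq _ (openI (@oDt t) (@open_slice _ _ _ _ oOW t))) => // z L [Dz Oz].
    by rewrite (wW Oz Dz).
  - exact: (continuous_on_fam oOW UO).
  - exact: (continuous_on_fam oOW UO s2 Ut).
exists (dts J W 0), (hodge ga (ext_deriv (dts J W 0))); split.
- exact: (continuous_on_fam oOW UO).
- exact: (continuous_on_fam oOW UO s3 U0).
- move=> x S Gx.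
  apply: (trace_intro (u := dts J W 0) (@open_slice _ _ _ _ oOW 0) (UO U0 Gx)).
    exact: (cont _ 0 x S sdW (UO U0 Gx)).
  by move=> y Oy Dy; rewrite shape_deriv_formE.
- move=> x S Gx.
  apply: (trace_intro (u := hodge ga (ext_deriv (dts J W 0)))
    (@open_slice _ _ _ _ oOW 0) (UO U0 Gx)).
    exact: (cont _ 0 x S s3 (UO U0 Gx)).
  move=> y Oy Dy; apply: (multiplier_ext mga) => K.
  by apply: (ext_deriv_eq _ oD) => // z L Dz; rewrite shape_deriv_formE.
- rewrite -(Rad_dts Rad_op GR_compact oOW oU UO W_smooth s2 radU U0 (@zero_below0 _ _ N)).
  apply/esym; apply: (Rad_eq Rad_op) => //.
  + move=> x S Gx; apply: (etrans (dts_multiplier oOW J S mga s1 (UO U0 Gx))).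
    apply: (multiplier_ext mga) => K; exact: (dts_ext oOW J K W_smooth (UO U0 Gx)).
  + exact: (continuous_on_fam oOW UO).
  + apply: (continuous_on_fam oOW UO _ U0); exact: smooth_dts.
Qed.

Variables (O : set pt) (Bx : set 'rV[R]_d).
Hypotheses (oO : open O) (oBx : open Bx).
Hypothesis O_OW : O `<=` OW.
Hypothesis OB : forall p, O p -> Bx p.2.
Hypothesis G_O : forall x, G x -> O (0, x).
Hypothesis v_smooth : forall j, smooth_on Bx (v j).
Hypothesis n0_smooth : smooth_on Bx (n D).
Hypothesis n_smooth : smooth_on O (fun p => n (Dt p.1) p.2).
Hypothesis n_unit : forall t x, O (t, x) -> enorm2 (n (Dt t) x) = 1.
Hypothesis phi_smooth : forall S, smooth_on Bx (fun x => phi x S).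
Hypothesis v_normal : forall j, (j < N)%N ->
  exists s : 'rV[R]_d -> R, forall x, Bx x -> v j x = s x *: n D x.
Hypothesis G_closure : forall (t : 'rV[R]_N) x, Gt t x -> closure (Dt t) x.
Local Notation pe := (peval ga v (n D) (fun t => n (Dt t)) phi W).

Let sWO : smooth_fam O W.
Proof. by move=> S; exact: smooth_sub O_OW (W_smooth S). Qed.

(** Both boundary values are taken from inside, hence equal at [x]; the star
    of a unit normal is injective on forms free of that normal. *)
Lemma residual_base t x S : U t -> O (t, x) -> Gt t x -> pe (residual 0) t x S = 0.
Proof.
move=> Ut Otx Gx; have [_ _ [a [ta tb]] _] := sol Ut.
set nt := n (Dt t) in ta tb *; pose St := [set y | O (t, y)].
have oSt : open St by exact: open_slice.
have snt : smooth_on St nt by exact: (smooth_slice oO (t := t) n_smooth).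
have mst : multiplier St (hodge_surf (V := V) ga nt) by exact: hodge_surf_multiplier.
have min : multiplier St (interior_prod (V := V) nt) by exact: interior_multiplier.
have mm : multiplier St (fun u : dform V d => hodge_surf ga nt (interior_prod nt u)).
  exact: multiplier_comp.
have smm (u : dform V d) : (forall K, smooth_on St (fun y => u y K)) ->
    forall K, {for x, continuous (fun y => hodge_surf ga nt (interior_prod nt u) y K)}.
  move=> su K; apply: differentiable_continuous; have [A [sA E]] := mm.
  have h : smooth_on St (fun y => \sum_L A K L y *: u y L).
    by apply: smooth_sum => // L _; apply: smooth_scale.
  apply: (@smooth_diff _ _ _ St) => //.
  by apply: (smooth_eq oSt _ h) => y _; rewrite E.
have sdWt K : smooth_on St (fun y => ext_deriv (W t) y K).
  exact: (smooth_slice oO (t := t) (smooth_ext oO sWO K)).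
have sdphi K : smooth_on St (fun y => ext_deriv phi y K).
  have sp : smooth_fam O (fun=> phi) by move=> L; exact: (smooth_snd oO OB (phi_smooth L)).
  exact: (smooth_slice oO (t := t) (smooth_ext oO sp K)).
have eqn K : hodge_surf ga nt (interior_prod nt (ext_deriv (W t))) x K =
    hodge_surf ga nt (interior_prod nt (ext_deriv phi)) x K.
  have e1 : a x K = hodge_surf ga nt (interior_prod nt (ext_deriv (W t))) x K.
    apply: (trace_unique (G_closure Gx) (ta x K Gx)).
    apply: (trace_intro (u := hodge_surf ga nt (interior_prod nt (ext_deriv (W t)))) oSt Otx).
      exact: smm.
    move=> y Oy Dy; apply: (multiplier_ext mm) => L.
    apply: (ext_deriv_eq _ (openI (@oDt t) oSt)) => // z M [Dz Oz].
    by rewrite (wW (O_OW Oz) Dz).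
  rewrite -e1; apply: (trace_unique (G_closure Gx) (tb x K Gx)).
  apply: (trace_intro (u := hodge_surf ga nt (interior_prod nt (ext_deriv phi))) oSt Otx) => //.
  exact: smm.
pose X : dform V d := fun y K =>
  interior_prod nt (ext_deriv (W t)) y K - interior_prod nt (ext_deriv phi) y K.
have X0 K : X x K = 0.
  apply: (hodge_surf_inj ga_riem (n_unit Otx)) => L.
    rewrite (multiplierB min).
    have cc (u : dform V d) : interior_prod nt (interior_prod nt u) x L = 0.
      exact: (contr_contr (fun i => nt x 0 i) (u x) L).
    by rewrite !cc subrr.
  by rewrite (multiplierB mst) eqn subrr.
have mst0 : multiplier Bx (hodge_surf (V := V) ga (n D)) by exact: hodge_surf_multiplier.
have lin := multiplierB mst0 (interior_prod nt (ext_deriv (W t)))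
  (interior_prod nt (ext_deriv phi)) x S.
by apply: (etrans (esym lin)); apply: (multiplier0 mst0) => K; exact: X0.
Qed.

Lemma shape_deriv_trace :
  same_trace D G (neumann_trace ga (n D) dw) (beval ga v T n phi w D (neumann_data N)).
Proof.
pose A := BStar (BContrN [::] (BExt (BField J))).
have /andP[/andP[iA _] iB] := indices_below_residual N.
have wWO s y : O (s, y) -> Dt s y -> w (Dt s) y = W s y by move=> /O_OW; exact: wW.
have spe e : smooth_fam O (pe e) by exact: (smooth_peval oO oBx OB).
have tr e : indices_below N e -> has_trace D G (beval ga v T n phi w D e) (pe e 0).
  move=> ie x S Gx.
  apply: (trace_intro (u := pe e 0) (@open_slice _ _ _ _ oO 0) (G_O Gx)).
    have sl := smooth_slice oO (t := 0) (spe e S).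
    exact: (differentiable_continuous (smooth_diff sl (G_O Gx))).
  move=> y Oy Dy; exact: (beval_peval v_velocity T_flow oO oD).
exists (pe A 0); split; first exact: (tr A iA).
move=> x S Gx; have -> : pe A 0 x S = pe (neumann_data N) 0 x S; last exact: tr.
have Gx0 : Gt (0 : 'rV[R]_N) x by rewrite (image_comp_flows0 T_flow).
have := residual_vanish oO oBx OB ga_riem v_smooth n0_smooth n_smooth phi_smooth sWO
  T_flow v_normal oU residual_base S (leqnn N) U0 (@zero_below0 _ _ N) (G_O Gx) Gx0.
by move/eqP; rewrite subr_eq0 => /eqP.
Qed.

End DifferentiatedSystem.

Theorem theorem3p4 (R : realType) (V Y : normedModType R) (d l : nat)
    (d_ge1 : (1 <= d)%N) (l_le_d : (l <= d)%N)
    (ga gk : metric R d) (ga_riem : riemannian ga) (gk_riem : riemannian gk)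
    (Om G D : set 'rV[R]_d) (c : 'rV[R]_d) (r : R) (r_gt0 : 0 < r)
    (Om_domain : bounded_smooth_domain Om)
    (Om_in_ball : closure Om `<=` eball c r)
    (G_def : G = closure Om `\` Om) (D_def : D = eball c r `\` closure Om)
    (Rad : dform V d -> dform V d -> Y)
    (Rad_op : radiation_operator (esphere c r) Rad)
    (phi : dform V d)
    (phi_smooth : exists U : set 'rV[R]_d,
       [/\ open U, G `<=` U, has_degree l U phi &
           forall S, smooth_on U (fun x => phi x S)])
    (n : set 'rV[R]_d -> vfield R d)
    (v : nat -> vfield R d) (T : nat -> R -> 'rV[R]_d -> 'rV[R]_d)
    (v_velocity : forall j, velocity_field (eball c r) (v j))
    (T_flow : forall j, is_flow (v j) (T j))
    (n_normal : normal_extension T Om G D n)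
    (n_parallel : forall (u : vfield R d) (Tu : R -> 'rV[R]_d -> 'rV[R]_d) (a : R),
       velocity_field (eball c r) u -> is_flow u Tu ->
       near_set G (fun x => u x = a *: n D x) ->
       near_set G (fun x =>
         is_derive (0 : R) (1 : R) (fun t => n (Tu t @` D) x) 0))
    (v_normal : forall j, exists s : 'rV[R]_d -> R,
       near_set G (fun x => v j x = s x *: n D x))
    (w : set 'rV[R]_d -> dform V d)
    (w_smooth : smooth_form_dependence T D w)
    (w_solution : forall N, \forall t \near (0 : 'rV[R]_N),
       let Dt := comp_flows T t @` D in
       neumann_system l ga gk (esphere c r) Rad Dt (comp_flows T t @` G) (n Dt)
         (hodge_surf ga (n Dt) (interior_prod (n Dt) (ext_deriv phi))) (w Dt))
    (N : nat) :
  neumann_system l ga gk (esphere c r) Rad D G (n D)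
    (beval ga v T n phi w D (neumann_data N.+1))
    (shape_derivs_form T (iota 0 N.+1) w D).
Proof.
have oD : open D.
  by rewrite D_def setDE; apply: openI; [exact: eball_open|apply: closed_openC; exact: closed_closure].
have [OW [W0 [oOW D_OW sW wW0]]] := w_smooth N.+1.
pose W (t : 'rV[R]_N.+1) : dform V d := fun x => W0 (t, x).
have W_smooth : smooth_fam OW W.
  by move=> S; apply: (smooth_eq oOW _ (sW S)) => -[t x] _.
have [_ [On [oOn G_On sn n_unit]]] := n_normal N.+1.
have [Up [oUp GUp _ sphi]] := phi_smooth.
have D0 A : comp_flows T (0 : 'rV[R]_N.+1) @` A = A by exact: (image_comp_flows0 T_flow).
have [Bv [oBv GBv vBv]] : exists B : set 'rV[R]_d, [/\ open B, G `<=` B &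
    forall j, (j < N.+1)%N -> exists s : 'rV[R]_d -> R, forall x, B x -> v j x = s x *: n D x].
  elim: N.+1 => [|M [B [oB GB hB]]]; first by exists setT; split=> //; exact: openT.
  have [s [B' [oB' GB' hs]]] := v_normal M.
  exists (B `&` B'); split; first exact: openI.
    by move=> x Gx; split; [exact: GB|exact: GB'].
  move=> j; rewrite ltnS leq_eqVlt => /orP[/eqP ->|jM].
    by exists s => x [_ /hs].
  by have [s' hs'] := hB j jM; exists s' => x [/hs'].
(* Near [G]: the incident field is smooth, the first velocities are normal
   and the unperturbed normal is defined. *)
pose Bx := Up `&` Bv `&` [set x | On (0, x)].
have oBx : open Bx by apply: openI; [exact: openI|exact: open_slice].
pose O := OW `&` On `&` snd @^-1` Bx.
have oO : open O.
  apply: openI; first exact: openI.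
  by apply: open_comp => // p _; exact: cvg_snd.
have G_clD x : G x -> closure D x.
  move=> Gx; rewrite D_def; apply: (boundary_closure Om_domain) => //; first exact: eball_open.
  by rewrite -G_def.
have GR_clD x : esphere c r x -> closure D x.
  by move=> xr; rewrite D_def; exact: esphere_closure.
have cGR := @esphere_compact R d c r.
have nearO : \forall t \near (0 : 'rV[R]_N.+1), esphere c r `<=` [set x | OW (t, x)].
  have /compact_near_coveringP nK := cGR.
  apply: (nK _ (nbhs (0 : 'rV[R]_N.+1)) (fun t x => OW (t, x))) => x xr.
  have [[A B] /= [nA nB] AB] := open_nbhs_nbhs (conj oOW (D_OW _ (GR_clD x xr))).
  by exists (B, A) => // -[y t] [By At]; exact: (AB (t, y)).
have [U [oU U0 Uall]] : exists U : set 'rV[R]_N.+1, [/\ open U, U 0 & forall t, U t ->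
   (let Dt := comp_flows T t @` D in
    neumann_system l ga gk (esphere c r) Rad Dt (comp_flows T t @` G) (n Dt)
      (hodge_surf ga (n Dt) (interior_prod (n Dt) (ext_deriv phi))) (w Dt)) /\
   esphere c r `<=` [set x | OW (t, x)]].
  exists (interior [set t | (let Dt := comp_flows T t @` D in
    neumann_system l ga gk (esphere c r) Rad Dt (comp_flows T t @` G) (n Dt)
      (hodge_surf ga (n Dt) (interior_prod (n Dt) (ext_deriv phi))) (w Dt)) /\
    esphere c r `<=` [set x | OW (t, x)]]).
  split; first exact: open_interior.
    exact: (filterI (w_solution N.+1) nearO).
  by move=> t /interior_subset.
have sol t (Ut : U t) := (Uall t Ut).1.
have UO t x (Ut : U t) (xr : esphere c r x) : OW (t, x) := (Uall t Ut).2 x xr.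
have v_sphere j x : esphere c r x -> v j x = 0.
  move=> xr; have [_ [K [_ KB vK]]] := v_velocity j; apply: vK => /KB.
  by rewrite /eball /= xr ltxx.
have clos t x : closure D x -> closure (comp_flows T t @` D) (comp_flows T (t : 'rV[R]_N.+1) x).
  exact: homeo_closure (comp_flows_homeo v_velocity T_flow t).
have wW s y : OW (s, y) -> (comp_flows T s @` D) y -> w (comp_flows T s @` D) y = W s y.
  exact: wW0.
split.
- split; first exact: (shape_deriv_degree v_velocity T_flow oD oOW wW D_OW oU U0 sol).
  move=> S; exact: (shape_deriv_smooth v_velocity T_flow oD oOW W_smooth wW D_OW).
- move=> x S Dx.
  exact: (shape_deriv_equation ga_riem gk_riem v_velocity T_flow oD oOW W_smooth wW D_OW
    oU U0 sol).
- apply: (shape_deriv_trace ga_riem v_velocity T_flow oD W_smooth wW oU U0 sol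
    oO oBx) => //.
  + by move=> p [[]].
  + by move=> p [].
  + move=> x Gx; split; [split; [exact: D_OW (G_clD x Gx)|exact: G_On]|].
    by split; [split; [exact: GUp|exact: GBv]|exact: G_On].
  + by move=> j; apply: smooth_sub (v_velocity j).1.
  + apply: (@smooth_sub _ _ _ [set x | On (0, x)]); first by move=> x [].
    apply: (smooth_eq (@open_slice _ _ _ _ oOn 0) _ (smooth_slice oOn (t := 0) sn)) => x _ /=.
    by rewrite D0.
  + by apply: smooth_sub sn => p [[]].
  + by move=> t x [[_ Onx] _]; exact: n_unit.
  + by move=> S; apply: smooth_sub (sphi S) => x [[]].
  + by move=> j jN; have [s hs] := vBv j jN; exists s => x [[_ /hs]].
  + by move=> t _ [x Gx <-]; apply: clos; exact: G_clD.
- apply: (shape_deriv_radiation ga_riem v_velocity T_flow oD oOW W_smooth wW D_OW oU U0 sol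
    cGR Rad_op) => //.
  move=> t x Ut xr; rewrite -[x](comp_flows_fix v_velocity T_flow t); last by move=> j; exact: v_sphere.
  by apply: clos; exact: GR_clD.
Qed.
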